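(* Let $M$ be a smooth manifold and $A\subset TM\setminus 0$ an open subset with $\pi(A)=M$. (1) A classical linear connection $\nabla$ on the vertical bundle over $A$ and a horizontal connection $\mathcal{H}$ over $A$, with non-linear coefficients $N^k_{\ l}$ positively homogeneous of degree one, are determined by the associated anisotropic connection $\hat\nabla$ and the associated anisotropic tensor $\mathfrak{C}\in\mathfrak{T}^1_2(M,A)$, whenever $N^k_{\ l}(v)=v^j\hat\Gamma^k_{\ lj}(v)$ holds in natural coordinates. (2) The converse also holds, namely, given an anisotropic connection $\hat\nabla$ on $A$ and an anisotropic tensor $\mathfrak{C}\in\mathfrak{T}^1_2(M,A)$, one can construct a classical linear connection on the vertical bundle over $A$, associated with the spray determined by the anisotropic connection $\hat\nabla$, using the non-linear connection associated with $\hat\nabla$.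
   Context: Notation. $\pi:TM\to M$ is the projection; $(x^i,y^i)$ are the natural coordinates on $TM$ associated with coordinates $(x^i)$ on $M$; $\mathcal{F}(\cdot)$ denotes smooth real functions. $\mathfrak{T}^r_s(M,A)$ is the space of $A$-anisotropic tensors: smooth assignments $A\ni v\mapsto T_v\in (T_{\pi(v)}M)^{\otimes r}\otimes(T^*_{\pi(v)}M)^{\otimes s}$; elements of $\mathfrak{X}(M)$ are regarded as elements of $\mathfrak{T}^1_0(M,A)$ by composing with $\pi$. $(1,2)$-tensors are viewed as bilinear maps $T_{\pi(v)}M\times T_{\pi(v)}M\to T_{\pi(v)}M$ depending on $v\in A$. For $v\in A$, $i_v:T_{\pi(v)}M\to\mathcal{V}_vTM=\ker(d\pi_v)$ is $i_v(u)=\frac{d}{dt}(v+tu)|_{t=0}$. Via $i_v$ the vertical bundle over $A$ is identified with the pullback bundle over $A$ with fibre $T_{\pi(v)}M$ at $v$, so its sections are the elements of $\mathfrak{T}^1_0(M,A)$. A classical linear connection is a linear connection $\nabla:\mathfrak{X}(A)\times\mathfrak{T}^1_0(M,A)\to\mathfrak{T}^1_0(M,A)$ on this vector bundle over the manifold $A$ (that is, $\mathcal{F}(A)$-linear in the first argument, linear and satisfying the Leibniz rule in the second). A horizontal connection over $A$ is a smooth choice of a complement of $\mathcal{V}_vTM$ in $T_vTM$ for each $v\in A$, spanned locally by $\frac{\partial}{\partial x^i}-N^j_{\ i}(v)\frac{\partial}{\partial y^j}$; the functions $N^j_{\ i}$ are its non-linear coefficients. $\mathcal{V}(\xi)$ and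 $\mathcal{H}(\xi)$ denote the vertical and horizontal parts of $\xi$. For $u\in T_{\pi(v)}M$, $u^{\mathcal V}=i_v(u)$ and $u^{\mathcal H}$ is the unique horizontal vector at $v$ with $d\pi(u^{\mathcal H})=u$; for $X\in\mathfrak{X}(M)$ this gives vector fields $X^{\mathcal V},X^{\mathcal H}$ on $A$. An anisotropic connection is a map $(v,X,Y)\mapsto\hat\nabla^v_XY\in T_{\pi(v)}M$, $v\in A$, $X,Y\in\mathfrak{X}(M)$, smooth in $v$ (i.e. $v\mapsto\hat\nabla^v_XY$ is in $\mathfrak{T}^1_0(M,A)$), additive in $Y$, $\mathcal{F}(M)$-linear in $X$, with $\hat\nabla^v_X(fY)=X(f)Y|_{\pi(v)}+f(\pi(v))\hat\nabla^v_XY$ for $f\in\mathcal{F}(M)$. Its Christoffel symbols are given by $\hat\nabla^v_{\partial_j}\partial_k=\hat\Gamma^i_{\ jk}(v)\partial_i$. It extends to $Z\in\mathfrak{T}^1_0(M,A)$ by $\hat\nabla^v_XZ=\hat\nabla^v_X(Z_V)-(\partial^\nu Z)_v(\hat\nabla^v_XV)$, where $V$ is any local vector field with values in $A$ and $V(\pi(v))=v$, $Z_V(p)=Z(V(p))$, and $(\partial^\nu Z)_v(w)=\frac{d}{dt}Z(v+tw)|_{t=0}$. The non-linear connection associated with an anisotropic connection $\hat\nabla$ is the horizontal connection with coefficients $N^k_{\ l}(v)=v^j\hat\Gamma^k_{\ lj}(v)$. The spray determined by $\hat\nabla$ is the vector field $y^k\frac{\partial}{\partial x^k}-y^iy^j\hat\Gamma^k_{\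 ij}\frac{\partial}{\partial y^k}$ on $A$, whose integral curves project onto the autoparallel curves of $\hat\nabla$, i.e. the curves with $\dot\gamma\in A$ and $\ddot\gamma^k+\dot\gamma^i\dot\gamma^j\hat\Gamma^k_{\ ij}(\dot\gamma)=0$. Given $(\nabla,\mathcal{H})$, the associated anisotropic connection is $\hat\nabla^v_XY=(\nabla_{X^{\mathcal H}}Y)(v)$, and the associated anisotropic tensor is $\mathfrak{C}_v(X,Y)=(\nabla_{X^{\mathcal V}}Y)(v)$, for $v\in A$, $X,Y\in\mathfrak{X}(M)$. The construction meant in (2) is, with $\mathcal{H}$ the non-linear connection associated with $\hat\nabla$, $(\nabla_\xi Z)(v)=(\partial^\nu Z)_v(i_v^{-1}(\mathcal{V}(\xi)))+\mathfrak{C}_v(i_v^{-1}(\mathcal{V}(\xi)),Z)+\hat\nabla^v_{d\pi(\mathcal{H}(\xi))}Z$ for $\xi\in\mathfrak{X}(A)$, $Z\in\mathfrak{T}^1_0(M,A)$. *)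

(* Defs.v *)
From HB Require Import structures.
From mathcomp Require Import all_boot all_order all_algebra.
From mathcomp Require Import all_classical all_reals all_analysis.

Set Implicit Arguments.
Unset Strict Implicit.
Unset Printing Implicit Defensive.

Import Order.TTheory GRing.Theory Num.Theory.
Import numFieldNormedType.Exports.

Local Open Scope classical_set_scope.
Local Open Scope ring_scope.

(* [xget 0 P] is used as a definite description: an element of [P], or 0 if
   [P] is empty.  It is applied to sets which are singletons whenever the
   ambient objects satisfy their axioms. *)

Section Smooth.
Variables (R : realType) (n : nat) (E : normedModType R).

Definition iter_partial (s : seq 'I_n) (f : 'rV[R]_n -> E) : 'rV[R]_n -> E :=
  foldr (fun i g x => 'D_(delta_mx 0 i : 'rV[R]_n) g x) f s.

(* C^infty on U, meant for open U: every iterated partial derivative is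
   differentiable (hence continuous) at every point of U. *)
Definition smooth_on (U : set 'rV[R]_n) (f : 'rV[R]_n -> E) : Prop :=
  forall s x, U x -> differentiable (iter_partial s f) x.

End Smooth.

(* The data of an atlas, without axioms; the axioms are in [is_manifold].
   [chart_map c] only matters on [chart_dom c].  Separating data from axioms
   makes it possible to form the tangent bundle and open subsets directly. *)
Record charted (R : realType) (n : nat) := Charted {
  carrier :> Type ;
  chart : Type ;
  chart_dom : chart -> set carrier ;
  chart_map : chart -> carrier -> 'rV[R]_n }.

Arguments chart_dom {R n c} _ _ : rename.
Arguments chart_map {R n c} _ _ : rename.

HB.instance Definition _ (R : realType) n (M : charted R n) :=
  gen_eqMixin (carrier M).
HB.instance Definition _ (R : realType) n (M : charted R n) :=
  gen_choiceMixin (carrier M).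

Section AtlasTopology.
Variables (R : realType) (n : nat) (M : charted R n).

(* When the charts are bijections onto open sets, this says that the image of
   U in every chart is open. *)
Definition atlas_open (U : set (carrier M)) : Prop :=
  forall c : chart M, exists2 W : set 'rV[R]_n, open W &
    forall x, chart_dom c x -> (U x <-> W (chart_map c x)).

Lemma atlas_openT : atlas_open setT.
Proof. by move=> c; exists setT => //; exact: openT. Qed.

Lemma atlas_openI : setI_closed atlas_open.
Proof.
move=> U V oU oV c; have [W oW UW] := oU c; have [W' oW' VW'] := oV c.
exists (W `&` W'); first exact: openI.
by move=> x cx; split=> -[/(UW _ cx) ? /(VW' _ cx) ?].
Qed.

Lemma atlas_open_bigcup (I : Type) (f : I -> set (carrier M)) :
  (forall i, atlas_open (f i)) -> atlas_open (\bigcup_i f i).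
Proof.
move=> of_ c.
have /choice[W HW] : forall i, exists W : set 'rV[R]_n, open W /\
    forall x, chart_dom c x -> (f i x <-> W (chart_map c x)).
  by move=> i; have [W ? ?] := of_ i c; exists W.
exists (\bigcup_i W i); first by apply: bigcup_open => i _; have [] := HW i.
move=> x cx; split=> -[i _ fi]; exists i => //.
  by have [_ /(_ _ cx)[+ _]] := HW i; apply.
by have [_ /(_ _ cx)[_]] := HW i; apply.
Qed.

HB.instance Definition _ := isOpenTopological.Build (carrier M)
  atlas_openT atlas_openI atlas_open_bigcup.

End AtlasTopology.

Section Charts.
Variables (R : realType) (n : nat) (M : charted R n).

(* f read in the chart c, i.e. f o (chart_map c)^-1 *)
Definition chart_rep (E : normedModType R) (c : chart M) (f : M -> E)
    (z : 'rV[R]_n) : E :=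
  xget 0 (f @` (chart_dom c `&` chart_map c @^-1` [set z])).

Definition smooth_in (E : normedModType R) (O : set M) (c : chart M)
    (f : M -> E) : Prop :=
  smooth_on (chart_map c @` (O `&` chart_dom c)) (chart_rep c f).

Definition smooth_fun (f : M -> R) : Prop :=
  forall c, smooth_in setT c (f : M -> R^o).

(* An n-dimensional smooth manifold, presented by any smooth atlas (not
   necessarily maximal); the topology is the one induced by the atlas. *)
Record is_manifold : Prop := IsManifold {
  chart_cover : forall x : M, exists c, chart_dom c x ;
  chart_inj : forall c : chart M, set_inj (chart_dom c) (chart_map c) ;
  chart_image_open : forall c d : chart M,
    open (chart_map c @` (chart_dom c `&` chart_dom d)) ;
  transition_smooth : forall c d : chart M,
    smooth_in (chart_dom d) c (chart_map d) ;
  manifold_hausdorff : hausdorff_space M ;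
  manifold_second_countable : @second_countable M }.

End Charts.

Arguments is_manifold {R n} M.

Section TangentSpace.
Variables (R : realType) (n : nat) (M : charted R n) (x : M).

(* A tangent vector at x is given by its components in all the charts around
   x, related by the Jacobians of the transition maps.  Components in charts
   that do not contain x are normalized to 0. *)
Definition tangent_pred (w : chart M -> 'rV[R]_n) : Prop :=
  (forall c d, chart_dom c x -> chart_dom d x ->
    w d = 'd (chart_rep c (chart_map d)) (chart_map c x) (w c)) /\
  (forall c, ~ chart_dom c x -> w c = 0).

Definition tangent_mem : {pred chart M -> 'rV[R]_n} :=
  fun w => `[< tangent_pred w >].

Lemma tangent_mem_submod : submod_closed tangent_mem.
Proof.
split.
  by apply/asboolP; split=> // c d _ _; rewrite linear0.
move=> a u v /asboolP[Hu Nu] /asboolP[Hv Nv]; apply/asboolP; split.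
  move=> c d cx dx; rewrite !(fctE, scalrfctE) /=.
  by rewrite linearP -Hu // -Hv.
by move=> c cx; rewrite !(fctE, scalrfctE) /= Nu // Nv // scaler0 addr0.
Qed.

Record tvec := TVec {
  tcomp :> chart M -> 'rV[R]_n ;
  tcompP : tcomp \in tangent_mem }.

HB.instance Definition _ := [isSub for tcomp].
HB.instance Definition _ := [Choice of tvec by <:].
HB.instance Definition _ :=
  GRing.SubChoice_isSubLmodule.Build R _ tangent_mem tvec tangent_mem_submod.

End TangentSpace.

Arguments tvec {R n M} x.

Section Differential.
Variables (R : realType) (n : nat) (M : charted R n).

Definition vector_of (c : chart M) (x : M) (e : 'rV[R]_n) : tvec x :=
  xget 0 [set w : tvec x | w c = e].

(* d/dx^i in the chart c (and 0 outside of the domain of c) *)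
Definition coord_field (c : chart M) (i : 'I_n) (x : M) : tvec x :=
  vector_of c x (delta_mx 0 i).

Definition smooth_field_on (O : set M) (X : forall x : M, tvec x) : Prop :=
  forall c, smooth_in O c (fun x => X x c).

Definition smooth_field (X : forall x : M, tvec x) : Prop :=
  smooth_field_on setT X.

(* w(f) *)
Definition dfun (f : M -> R) (x : M) (w : tvec x) : R :=
  xget 0 [set r | forall c, chart_dom c x ->
    r = 'd (chart_rep c (f : M -> R^o)) (chart_map c x) (w c)].

Definition dmap m (N : charted R m) (F : M -> N) (x : M) (w : tvec x)
    : tvec (F x) :=
  xget 0 [set u : tvec (F x) | forall c d,
    chart_dom c x -> chart_dom d (F x) ->
    u d = 'd (chart_rep c (chart_map d \o F)) (chart_map c x) (w c)].

(* The tangent bundle with its natural charts (x^i, y^i). *)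
Definition TM : charted R (n + n) :=
  @Charted R (n + n) {x : M & tvec x} (chart M)
    (fun c v => chart_dom c (projT1 v))
    (fun c v => row_mx (chart_map c (projT1 v)) (projT2 v c)).

Definition mkTM (x : M) (w : tvec x) : TM := existT _ x w.
Definition tpi (v : TM) : M := projT1 v.
Definition tfib (v : TM) : tvec (tpi v) := projT2 v.

Definition subcharted (A : set M) : charted R n :=
  @Charted R n (set_type A) (chart M)
    (fun c v => chart_dom c (val v)) (fun c v => chart_map c (val v)).

End Differential.

Arguments TM {R n} M.
Arguments subcharted {R n M} A.
Arguments dmap {R n M m N} F {x} w.
Arguments dfun {R n M} f {x} w.

(* Below, [A] is a subset of TM, meant to be open, and
   [subcharted A] is A as a manifold.  Sections (vector fields on M or on A,
   elements of T^1_0(M,A)) are plain dependent functions, and smoothness is a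
   separate predicate: an operator on sections is a function on all of them of
   which only the values at smooth sections are meaningful. *)
Section Anisotropic.
Variables (R : realType) (n : nat) (M : charted R n) (A : set (TM M)).

Notation AA := (subcharted A).

Definition base (v : AA) : M := tpi (val v).
Definition fib (v : AA) : tvec (base v) := tfib (val v).

(* v + w *)
Definition fib_shift (v : AA) (w : tvec (base v)) : TM M := mkTM (fib v + w).

Definition section := forall v : AA, tvec (base v).
Definition vfield := forall x : M, tvec x.
Definition vfieldA := forall v : AA, tvec v.

(* T^1_0(M,A) *)
Definition smooth_section (Z : section) : Prop :=
  forall c, smooth_in setT (c : chart AA) (fun v => Z v c).

Definition pull (X : vfield) : section := fun v => X (base v).

(* T^1_2(M,A) *)
Record is_tensor12 (C : forall v : AA, tvec (base v) -> tvec (base v) ->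
    tvec (base v)) : Prop := IsTensor12 {
  tensor_linl : forall v w, linear (fun u => C v u w) ;
  tensor_linr : forall v u, linear (C v u) ;
  tensor_smooth : forall (c : chart M) (j k : 'I_n), smooth_in setT (c : chart AA)
    (fun v => C v (coord_field c j (base v)) (coord_field c k (base v)) c) }.

Record is_linear_connection (nabla : vfieldA -> section -> section) : Prop :=
  IsLinearConnection {
  nabla_smooth : forall xi Z, smooth_field xi -> smooth_section Z ->
    smooth_section (nabla xi Z) ;
  nabla_addl : forall xi eta Z, smooth_field xi -> smooth_field eta ->
    smooth_section Z -> forall v,
    nabla (fun a => xi a + eta a) Z v = nabla xi Z v + nabla eta Z v ;
  nabla_scalel : forall f xi Z, smooth_fun f -> smooth_field xi ->
    smooth_section Z -> forall v,
    nabla (fun a => f a *: xi a) Z v = f v *: nabla xi Z v ;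
  nabla_linr : forall (k : R) xi Z W, smooth_field xi -> smooth_section Z ->
    smooth_section W -> forall v,
    nabla xi (fun a => k *: Z a + W a) v = k *: nabla xi Z v + nabla xi W v ;
  nabla_leibniz : forall f xi Z, smooth_fun f -> smooth_field xi ->
    smooth_section Z -> forall v,
    nabla xi (fun a => f a *: Z a) v
      = dfun f (xi v) *: Z v + f v *: nabla xi Z v }.

Definition vertical (v : AA) : set (tvec v) := [set xi | dmap base xi = 0].

(* i_v(u) = d/dt (v + t u) at t = 0 *)
Definition vlift (v : AA) (u : tvec (base v)) : tvec v :=
  xget 0 [set xi : tvec v | forall c : chart M, chart_dom c (base v) ->
    is_derive (0 : R) (1 : R)
      (fun t : R => chart_map (c : chart (TM M)) (fib_shift (t *: u))) (xi c)].

Definition vlift_inv (v : AA) (xi : tvec v) : tvec (base v) :=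
  xget 0 [set u | vlift u = xi].

(* The span of the d/dx^i - N^j_i(v) d/dy^j in T_vA, where the matrix entry
   N i j stands for N^j_i(v). *)
Definition spanned_by (c : chart M) (v : AA) (N : 'M[R]_n) : set (tvec v) :=
  [set xi : tvec v | exists a : 'rV[R]_n, xi c = row_mx a (- (a *m N))].
Arguments spanned_by : clear implicits.

Definition nonlin_coef (Hc : forall v : AA, set (tvec v)) (c : chart M)
    (v : AA) : 'M[R]_n :=
  xget 0 [set N | Hc v = spanned_by c v N].

Record is_horizontal (Hc : forall v : AA, set (tvec v)) : Prop :=
  IsHorizontal {
  horiz_zero : forall v, Hc v 0 ;
  horiz_lin : forall v (k : R) xi eta, Hc v xi -> Hc v eta ->
    Hc v (k *: xi + eta) ;
  horiz_cap : forall v xi, Hc v xi -> vertical xi -> xi = 0 ;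
  horiz_sum : forall v (xi : tvec v), exists eta zeta,
    [/\ vertical eta, Hc v zeta & xi = eta + zeta] ;
  horiz_span : forall c v, chart_dom c (base v) ->
    Hc v = spanned_by c v (nonlin_coef Hc c v) ;
  horiz_smooth : forall c k l, smooth_in setT (c : chart AA)
    (fun v => nonlin_coef Hc c v l k : R^o) }.

Section Horizontal.
Variable Hc : forall v : AA, set (tvec v).

(* N(lambda v) = lambda N(v), for lambda > 0; A need not be conic, so this is
   required whenever both v and lambda v are in A. *)
Definition coef_homogeneous : Prop :=
  forall (c : chart M) (v w : AA) (lambda : R), 0 < lambda ->
    chart_dom c (base v) -> val w = mkTM (lambda *: fib v) ->
    nonlin_coef Hc c w = lambda *: nonlin_coef Hc c v.

Definition vpart (v : AA) (xi : tvec v) : tvec v :=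
  xget 0 [set eta | vertical eta /\ Hc (xi - eta)].

Definition hpart (v : AA) (xi : tvec v) : tvec v :=
  xget 0 [set zeta | Hc zeta /\ vertical (xi - zeta)].

Definition hlift (v : AA) (u : tvec (base v)) : tvec v :=
  xget 0 [set zeta | Hc zeta /\ dmap base zeta = u].

End Horizontal.

Definition vlift_field (X : vfield) : vfieldA := fun v => vlift (pull X v).
Definition hlift_field (Hc : forall v : AA, set (tvec v)) (X : vfield)
  : vfieldA := fun v => hlift Hc (pull X v).

Definition aniso_op := forall v : AA, vfield -> vfield -> tvec (base v).

Record is_aniso_connection (hat : aniso_op) : Prop := IsAnisoConnection {
  hat_smooth : forall X Y, smooth_field X -> smooth_field Y ->
    smooth_section (fun v => hat v X Y) ;
  hat_addr : forall v X Y Z, smooth_field X -> smooth_field Y ->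
    smooth_field Z -> hat v X (fun x => Y x + Z x) = hat v X Y + hat v X Z ;
  hat_addl : forall v X Y Z, smooth_field X -> smooth_field Y ->
    smooth_field Z -> hat v (fun x => X x + Y x) Z = hat v X Z + hat v Y Z ;
  hat_scalel : forall v f X Y, smooth_fun f -> smooth_field X ->
    smooth_field Y -> hat v (fun x => f x *: X x) Y = f (base v) *: hat v X Y ;
  hat_leibniz : forall v f X Y, smooth_fun f -> smooth_field X ->
    smooth_field Y -> hat v X (fun x => f x *: Y x)
      = dfun f (X (base v)) *: Y (base v) + f (base v) *: hat v X Y }.

Definition assoc_connection (nabla : vfieldA -> section -> section)
    (Hc : forall v : AA, set (tvec v)) : aniso_op :=
  fun v X Y => nabla (hlift_field Hc X) (pull Y) v.

Definition assoc_tensor (nabla : vfieldA -> section -> section) : aniso_op :=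
  fun v X Y => nabla (vlift_field X) (pull Y) v.

Section HatConnection.
Variable hat : aniso_op.

(* hat^v_u Y for a vector u at base v and a field Y which may be only locally
   defined: hat^v_X Y depends only on X (base v) and on the germ of Y at
   base v, so it is evaluated on global extensions. *)
Definition hat_loc (v : AA) (u : tvec (base v)) (Y : vfield) : tvec (base v) :=
  xget 0 [set w | exists X Y' : vfield,
    [/\ smooth_field X, smooth_field Y', X (base v) = u,
        (\forall x \near base v, Y' x = Y x) & w = hat v X Y']].

(* christoffel c v i j k is Gamma^i_{jk}(v) in the chart c. *)
Definition christoffel (c : chart M) (v : AA) (i j k : 'I_n) : R :=
  hat_loc (coord_field c j (base v)) (coord_field c k) c 0 i.

(* N^k_l(v) = v^j Gamma^k_{lj}(v), at row l and column k *)
Definition hat_coef (c : chart M) (v : AA) : 'M[R]_n :=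
  \matrix_(l, k) \sum_j fib v c 0 j * christoffel c v k l j.

Definition hat_horizontal (v : AA) : set (tvec v) :=
  [set xi | forall c, chart_dom c (base v) -> spanned_by c v (hat_coef c v) xi].

(* N^k_l(v) = v^j Gamma^k_{lj}(v) holds for the coefficients of Hc *)
Definition coef_relation (Hc : forall v : AA, set (tvec v)) : Prop :=
  forall (c : chart M) (v : AA), chart_dom c (base v) ->
    nonlin_coef Hc c v = hat_coef c v.

(* y^k d/dx^k - y^i y^j Gamma^k_{ij} d/dy^k *)
Definition is_spray_of (S : vfieldA) : Prop :=
  forall (c : chart M) v, chart_dom c (base v) ->
    S v c = row_mx (fib v c)
      (- \row_k \sum_i \sum_j fib v c 0 i * fib v c 0 j * christoffel c v k i j).

(* Z at points of TM, extended by 0 outside A *)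
Definition ext0 (Z : section) (v : TM M) : tvec (tpi v) :=
  match pselect (A v) with
  | left Av => Z (exist (fun v : TM M => v \in A) v (mem_set Av))
  | right _ => 0
  end.

Definition comp_field (Z : section) (V : vfield) : vfield :=
  fun x => ext0 Z (mkTM (V x)).

(* (d^nu Z)_v(w) = d/dt Z(v + t w) at t = 0 *)
Definition vderiv (Z : section) (v : AA) (w : tvec (base v)) : tvec (base v) :=
  xget 0 [set u : tvec (base v) | forall c : chart M, chart_dom c (base v) ->
    is_derive (0 : R) (1 : R)
      (fun t : R => ext0 Z (fib_shift (t *: w)) c) (u c)].

(* V is a smooth A-valued vector field near base v, with V (base v) = v. *)
Definition local_extension (v : AA) (V : vfield) : Prop :=
  V (base v) = fib v /\
  exists O : set M, [/\ open O, O (base v), smooth_field_on O V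
    & forall x, O x -> A (mkTM (V x))].

Definition hat_ext (v : AA) (u : tvec (base v)) (Z : section) : tvec (base v) :=
  xget 0 [set w | exists2 V, local_extension v V &
    w = hat_loc u (comp_field Z V) - vderiv Z (hat_loc u V)].

Definition built_connection
    (C : forall v : AA, tvec (base v) -> tvec (base v) -> tvec (base v))
    (xi : vfieldA) (Z : section) : section := fun v =>
  let u := vlift_inv (vpart hat_horizontal (xi v)) in
  vderiv Z u + C v u (Z v)
    + hat_ext (dmap base (hpart hat_horizontal (xi v))) Z.

End HatConnection.

End Anisotropic.

Arguments vertical {R n M A} v _.
Arguments hat_horizontal {R n M A} hat v _.
Arguments pull {R n M A} X v.

(* Main.v *)
(* Part (1): C is well defined because nabla is tensorial in its first argument
   and the derivation term of the Leibniz rule vanishes along vertical lifts of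
   sections pulled back from M.  The difference of two connections is bilinear
   over the smooth functions on A, hence pointwise; every tangent vector of A is
   the sum of a horizontal and a vertical lift, and every vector at the base
   point extends to a field on M, so nabla is determined by hat and C.  Bump
   functions on M, pulled back to A, are enough for all pointwise arguments.

   Part (2): in a chart, with N^k_l = y^j Gamma^k_{lj}, the constructed operator is
     (nabla_xi Z)^k = dZ^k(xi) + C(omega(xi), Z)^k + Gamma^k_{ij} xi^i Z^j,
   where omega(xi)^k = xi^(n+k) + N^k_l xi^l is the vertical part of xi; the
   contributions of the auxiliary local field V to hat Z_V and to
   (d^nu Z)(hat V) cancel.  The horizontal spaces do not depend on the chart
   because the second-order terms in the transformation rules of Gamma and of
   the fibre components of xi are opposite. *)

From HB Require Import structures.
Require Import Defs.
From mathcomp Require Import all_boot all_order all_algebra.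
From mathcomp Require Import all_classical all_reals all_analysis.
From mathcomp Require Import ring lra.
Import Order.TTheory GRing.Theory Num.Theory.
Import numFieldNormedType.Exports.
Set Implicit Arguments.
Unset Strict Implicit.
Unset Printing Implicit Defensive.
Local Open Scope classical_set_scope.
Local Open Scope ring_scope.

(** * Smooth functions on coordinate space *)

(** Most objects are definite descriptions [xget 0 P] whose property ranges over all charts. Each is
    made usable by a component formula: a candidate is prescribed by its components in one chart,
    the property is verified for it, and uniqueness holds because a tangent vector is determined by
    its components in one chart. Later arguments run on components only. Smoothness is defined on
    chart images but used as a property of germs, [smooth_pt], so that a function may be replaced by
    one equal to it near a point; hence differentiability itself is first shown to depend on the
    germ only. The operators take global fields and are meaningful at smooth ones only, whereas
    coordinate fields and the auxiliary [V] exist locally. Bump functions supply global fields with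
    prescribed germs, and the operators are shown to depend on these germs only. In part (1) the
    relation N^k_l = v^j Gamma^k_{lj} recovers the horizontal spaces from the associated anisotropic
    connection; after that the two classical connections are compared on common lifts. *)

Section NearDifferentiable.
Variables (R : realType) (V W : normedModType R).

(** The difference [g - f] vanishes near [x], so its first-order expansion there is zero, and adding
    it to [f] preserves differentiability. *)
Lemma near_eq_differentiable (f g : V -> W) (x : V) :
  (\near x, f x = g x) -> differentiable f x -> differentiable g x.
Proof.
move=> fg df; pose h : V -> W := g - f.
have h0 : \near x, h x = 0.
  by move: fg; apply: filterS => y fgy; apply/eqP; rewrite /h subr_eq0; apply/eqP.
have hx : h x = 0 := nbhs_singleton h0.
have oh : h \o shift x = cst (h x) + (\0 : {linear V -> W}) +o_ 0 id.
  apply/eqaddoP => e e0; rewrite hx.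
  have : \forall y \near 0, h (y + x) = 0.
    by rewrite (near_shift x) /= sub0r; move: h0; apply: filterS => y; rewrite /= subrK.
  apply: filterS => y hy.
  by rewrite !fctE /= hy addr0 subrr normr0 mulr_ge0 // ltW.
have c0 : continuous (\0 : {linear V -> W}) by move=> y; exact: cvg_cst.
have dh : differentiable h x.
  by apply/diff_locallyP; rewrite (diff_unique c0 oh).
have -> : g = h + f by rewrite /h subrK.
exact: differentiableD.
Qed.

Lemma near_eq_diff (f g : V -> W) (x : V) :
  (\near x, f x = g x) -> differentiable f x -> 'd f x = 'd g x :> (V -> W).
Proof.
move=> fg df; apply/funext => v.
have dg := near_eq_differentiable fg df.
by rewrite -!deriveE //; exact: near_eq_derive.
Qed.

Lemma near_eq_diffE (f g : V -> W) (x v : V) :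
  (\near x, f x = g x) -> differentiable f x -> 'd f x v = 'd g x v.
Proof. by move=> fg df; rewrite (near_eq_diff fg df). Qed.

End NearDifferentiable.

(** The chain rule in the form in which charts supply it: the composite is known only near [x], and
    the base point of [g] is given by an equation. *)
Lemma diff_near_comp (R : realType) (U V W : normedModType R) (f : U -> V)
    (g : V -> W) (h : U -> W) x y v : f x = y ->
  differentiable f x -> differentiable g y -> (\near x, g (f x) = h x) ->
  'd h x v = 'd g y ('d f x v).
Proof.
move=> <- df dg gfh.
have E1 : 'd (g \o f) x = 'd g (f x) \o 'd f x :> (U -> W) := diff_comp df dg.
have E2 : 'd (g \o f) x = 'd h x :> (U -> W).
  by apply: near_eq_diff gfh _; exact: differentiable_comp.
exact: etrans (esym (congr1 (fun k => k v) E2)) (congr1 (fun k => k v) E1).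
Qed.

Lemma near_all (T : topologicalType) (z : T) (P : T -> Prop) :
  (forall y, P y) -> \near z, P z.
Proof. by move=> H; apply: filterS (@filterT _ (nbhs z) _) => y _; exact: H. Qed.

Definition row_unit (R : realType) n (i : 'I_n) : 'rV[R]_n := delta_mx 0 i.
Arguments row_unit R {n} i.

(** * The classes [Ck k]: locality, sums, products and compositions *)

Section Ck.
Variables (R : realType) (n : nat) (E : normedModType R).
Implicit Types (f g : 'rV[R]_n -> E) (z : 'rV[R]_n).

(** Equality near [z] is equality near every point close to [z], so partial derivatives again agree
    on a whole neighbourhood. *)
Lemma near_eq_iter_partial s f g z : (\near z, f z = g z) ->
  \near z, iter_partial s f z = iter_partial s g z.
Proof.
elim: s => [//|i s IH] /IH; rewrite /iter_partial /=.
move/near_join; apply: filterS => y; exact: near_eq_derive.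
Qed.

(** The last index is the first derivative taken. Peeling it off turns an iterated partial of [f]
    into one of lower order of a partial of [f], which is the recursion of [CkS]. *)
Lemma iter_partial_rcons s i f :
  iter_partial (rcons s i) f = iter_partial s (fun x => 'D_(row_unit R i) f x).
Proof. by rewrite /iter_partial -cats1 foldr_cat. Qed.

Lemma near_eq_near_differentiable f g z : (\near z, f z = g z) ->
  (\near z, differentiable f z) -> \near z, differentiable g z.
Proof.
move/near_join; apply: filterS2 => y; exact: near_eq_differentiable.
Qed.

(* The neighbourhood depends on [s], which is why [smooth_at] (all orders) is
   split into the classes [Ck k], to which induction on [k] applies. *)
Definition Ck k f z := forall s, (size s <= k)%N ->
  \near z, differentiable (iter_partial s f) z.

Definition smooth_at f z := forall k, Ck k f z.

Lemma smooth_onP (U : set 'rV[R]_n) f : open U ->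
  smooth_on U f <-> forall z, U z -> smooth_at f z.
Proof.
move=> oU; split=> [sf z Uz k s _|sf s z Uz].
  have := open_nbhs_nbhs (conj oU Uz); apply: filterS => y Uy; exact: sf.
by have := sf z Uz (size s) s (leqnn _); exact: nbhs_singleton.
Qed.

Lemma CkS k f z : Ck k.+1 f z <->
  (\near z, differentiable f z) /\ forall i, Ck k (fun x => 'D_(row_unit R i) f x) z.
Proof.
split=> [H|[H0 H]].
  split=> [|i s ks]; first exact: (H [::]).
  by rewrite -iter_partial_rcons; apply: H; rewrite size_rcons.
case/lastP=> [//|s i]; rewrite size_rcons iter_partial_rcons; exact: H.
Qed.

Lemma Ck0 f z : Ck 0 f z <-> \near z, differentiable f z.
Proof. by split=> [/(_ [::])|H [|//]]; exact. Qed.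

Lemma CkW k f z : Ck k.+1 f z -> Ck k f z.
Proof. by move=> H s ks; apply: H; exact: leqW. Qed.

Lemma Ck_near_eq k f g z : (\near z, f z = g z) -> Ck k f z -> Ck k g z.
Proof.
move=> fg H s ks; apply: near_eq_near_differentiable (H s ks).
exact: near_eq_iter_partial.
Qed.

Lemma Ck_cst k (a : E) z : Ck k (fun=> a) z.
Proof.
elim: k a => [|k IH] a.
  by apply/Ck0; apply: near_all => y; exact: differentiable_cst.
apply/CkS; split=> [|i]; first by apply: near_all => y; exact: differentiable_cst.
by under eq_fun do rewrite derive_cst; exact: IH.
Qed.

Lemma CkD k f g z : Ck k f z -> Ck k g z -> Ck k (fun x => f x + g x) z.
Proof.
elim: k f g => [|k IH] f g.
  move=> /Ck0 df /Ck0 dg; apply/Ck0; move: df dg; apply: filterS2 => y.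
  exact: differentiableD.
move=> /CkS[df Hf] /CkS[dg Hg]; apply/CkS; split.
  by move: df dg; apply: filterS2 => y; exact: differentiableD.
move=> i; apply: Ck_near_eq (IH _ _ (Hf i) (Hg i)).
move: df dg; apply: filterS2 => y dfy dgy.
by rewrite -deriveD //; exact: diff_derivable.
Qed.

Lemma Ck_sum k (I : Type) (r : seq I) (P : pred I) (F : I -> 'rV[R]_n -> E) z :
  (forall i, P i -> Ck k (F i) z) -> Ck k (fun x => \sum_(i <- r | P i) F i x) z.
Proof.
move=> H; elim: r => [|i r IH].
  by under eq_fun do rewrite big_nil; exact: Ck_cst.
under eq_fun do rewrite big_cons.
by case: (boolP (P i)) => // Pi; apply: CkD => //; exact: H.
Qed.

End Ck.

Section CkLinear.
Variables (R : realType) (n : nat) (E F : normedModType R).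
Implicit Types (z : 'rV[R]_n).

(** A continuous linear map is its own differential, hence commutes with partial derivatives. *)
Lemma Ck_linear_comp k (L : {linear E -> F}) (f : 'rV[R]_n -> E) z :
  continuous L -> Ck k f z -> Ck k (fun x => L (f x)) z.
Proof.
move=> cL; have dL y : differentiable L y by exact: linear_differentiable.
have dc f' y : differentiable f' y -> differentiable (fun x : 'rV_n => L (f' x)) y.
  by move=> df; exact: (@differentiable_comp _ _ _ _ f' L).
elim: k f => [|k IH] f.
  by move=> /Ck0 df; apply/Ck0; move: df; apply: filterS => y; exact: dc.
move=> /CkS[df H]; apply/CkS; split.
  by move: df; apply: filterS => y; exact: dc.
move=> i; apply: Ck_near_eq (IH _ (H i)); move: df; apply: filterS => y df.
rewrite !deriveE //; last exact: dc.
by rewrite -[RHS]/('d (L \o f) y (row_unit R i)) (diff_comp df (dL (f y))) /= (diff_lin _ cL).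
Qed.

End CkLinear.

Section CkCoord.
Variables (R : realType) (n m : nat).
Implicit Types (z : 'rV[R]_n).

Definition coordL (j : 'I_m) : 'rV[R]_m -> R^o := fun x => x 0 j.
Lemma coordL_linear j : linear (coordL j).
Proof. by move=> a u v; rewrite /coordL !mxE. Qed.
HB.instance Definition _ j := GRing.isLinear.Build _ _ _ _ (coordL j) (coordL_linear j).

Lemma coordL_cont j : continuous (coordL j).
Proof. exact: coord_continuous. Qed.

Lemma Ck_coord k (f : 'rV[R]_n -> 'rV[R]_m) z (j : 'I_m) :
  Ck k f z -> Ck k (fun x => f x 0 j : R^o) z.
Proof. by move=> H; apply: (@Ck_linear_comp _ _ _ _ _ (coordL j)) H; exact: coordL_cont. Qed.

Lemma Ck_row k (f : 'rV[R]_n -> 'rV[R]_m) z :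
  (forall j, Ck k (fun x => f x 0 j : R^o) z) -> Ck k f z.
Proof.
move=> H; have -> : f = fun x => \sum_j (f x 0 j) *: (delta_mx 0 j : 'rV_m).
  by apply/funext => x; exact: row_sum_delta.
apply: Ck_sum => j _.
have lin : linear ( *:%R ^~ (delta_mx 0 j : 'rV[R]_m) : R^o -> _).
  by move=> u y z0; rewrite scalerDl scalerA.
pose M := GRing.isLinear.Build _ _ _ _ _ lin.
pose L : {linear _ -> _} := HB.pack ( *:%R ^~ _) M.
exact: (@Ck_linear_comp _ _ _ _ _ L _ _ (@scalel_continuous _ _ _) (H j)).
Qed.

End CkCoord.

Section Scale.
Variables (R : realType) (V E : normedModType R).

(** Scaling as a bilinear map, so that the differential of a bilinear map gives the product rule for
    a scalar function times a vector-valued one. *)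
Definition scaleb (a : R^o) (w : E) : E := a *: w.

Lemma scaleb_is_bilinear :
  bilinear_for (GRing.Scale.Law.clone _ _ ( *:%R ) _)
    (GRing.Scale.Law.clone _ _ ( *:%R ) _) scaleb.
Proof.
split=> [w a u v|u a v w] /=.
  by rewrite /scaleb scalerDl scalerA.
by rewrite /scaleb scalerDr !scalerA mulrC.
Qed.

HB.instance Definition _ := bilinear_isBilinear.Build R R^o E E
  (GRing.Scale.Law.clone _ _ ( *:%R ) _) (GRing.Scale.Law.clone _ _ ( *:%R ) _)
  scaleb scaleb_is_bilinear.

Lemma is_diff_scaleb (f : V -> R^o) (g : V -> E) x :
  differentiable f x -> differentiable g x ->
  is_diff x (fun y => f y *: g y) (fun v => 'd f x v *: g x + f x *: 'd g x v).
Proof.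
move=> df dg.
have cb : continuous (fun p : R^o * E => scaleb p.1 p.2) by exact: scale_continuous.
have dp : differentiable (fun y => (f y, g y)) x by exact: differentiable_pair.
have db := @differentiable_bilin R R^o E E scaleb (f x, g x) cb.
have H := differentiable_comp dp db.
apply: DiffDef; first exact: H.
apply/funext => v.
rewrite -[LHS]/('d ((fun p => scaleb p.1 p.2) \o (fun y => (f y, g y))) x v).
rewrite (diff_comp dp db) /= diff_bilin // diff_pair //= /scaleb.
by rewrite addrC.
Qed.

End Scale.

Section CkScale.
Variables (R : realType) (n : nat) (E : normedModType R).
Implicit Types (f : 'rV[R]_n -> R^o) (g : 'rV[R]_n -> E) (z : 'rV[R]_n).

(** By the product rule a partial derivative is a sum of two products; the factor left
    undifferentiated is lowered from order [k.+1] to [k] by [CkW]. *)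
Lemma CkZ k f g z : Ck k f z -> Ck k g z -> Ck k (fun x => f x *: g x) z.
Proof.
have dZ f' g' y : differentiable f' y -> differentiable g' y ->
    differentiable (fun x : 'rV_n => (f' x : R) *: (g' x : E)) y.
  by move=> df dg; have [] := is_diff_scaleb df dg.
elim: k f g => [|k IH] f g.
  by move=> /Ck0 df /Ck0 dg; apply/Ck0; move: df dg; apply: filterS2 => y; exact: dZ.
move=> Hf Hg; have /CkS[df Df] := Hf; have /CkS[dg Dg] := Hg.
apply/CkS; split; first by move: df dg; apply: filterS2 => y; exact: dZ.
move=> i.
have := CkD (IH _ _ (Df i) (CkW Hg)) (IH _ _ (CkW Hf) (Dg i)).
apply: Ck_near_eq; move: df dg; apply: filterS2 => y dfy dgy.
rewrite [RHS]deriveE; last exact: dZ.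
by have [_ ->] := is_diff_scaleb dfy dgy; rewrite -!deriveE.
Qed.

End CkScale.

Lemma CkM (R : realType) n k (f g : 'rV[R]_n -> R^o) z :
  Ck k f z -> Ck k g z -> Ck k (fun x => f x * g x : R^o) z.
Proof. exact: CkZ. Qed.

Section CkComp.
Variables (R : realType) (n m : nat) (E : normedModType R).
Implicit Types (z : 'rV[R]_n).

Lemma diff_row_sum (f : 'rV[R]_m -> E) y (v : 'rV[R]_m) :
  differentiable f y -> 'd f y v = \sum_j v 0 j *: 'D_(row_unit R j) f y.
Proof.
move=> df; rewrite {1}(row_sum_delta v) linear_sum; apply: eq_bigr => j _.
by rewrite linearZ /= -deriveE.
Qed.

(** By the chain rule a partial of the composite is a sum of products of a partial of a component of
    [g] with a partial of [f] taken at [g]; the induction hypothesis applies to the latter. *)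
Lemma Ck_comp k (f : 'rV[R]_m -> E) (g : 'rV[R]_n -> 'rV[R]_m) z :
  Ck k f (g z) -> Ck k g z -> Ck k (fun x => f (g x)) z.
Proof.
have base f' g' : (\forall y \near g' z, differentiable (f' : _ -> E) y) ->
    (\near z, differentiable g' z) ->
    \near z, differentiable (fun x : 'rV_n => f' (g' x) : E) z.
  move=> df dg; have cg : \near z, differentiable f' (g' z) :=
    differentiable_continuous (nbhs_singleton dg) df.
  by move: cg dg; apply: filterS2 => y /[swap]; exact: differentiable_comp.
elim: k f g => [|k IH] f g; first by move=> /Ck0 df /Ck0 dg; apply/Ck0; exact: base.
move=> /CkS[df Df] Hg; have /CkS[dg Dg] := Hg; apply/CkS; split; first exact: base.
move=> i.
have : Ck k (fun x => \sum_j (('D_(row_unit R i) g x) 0 j *: 'D_(row_unit R j) f (g x)) : E) z.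
  apply: Ck_sum => j _; apply: CkZ; first exact: Ck_coord.
  by apply: (IH (fun y => 'D_(row_unit R j) f y)) => //; exact: CkW.
apply: Ck_near_eq.
have cg : \near z, differentiable f (g z) :=
  differentiable_continuous (nbhs_singleton dg) df.
move: cg dg; apply: filterS2 => y dfy dgy.
rewrite -['D_(row_unit R i) (fun x => f (g x)) y]/('D_(row_unit R i) (f \o g) y).
rewrite [RHS]deriveE; last exact: differentiable_comp.
rewrite [RHS](_ : _ = 'd f (g y) ('D_(row_unit R i) g y)); last first.
  by rewrite (diff_comp dgy dfy) /= deriveE.
rewrite diff_row_sum //.

Qed.

End CkComp.

Section CkComp2.
Variables (R : realType) (n m p : nat).
Implicit Types (z : 'rV[R]_n).

Lemma Ck_id k z : Ck k (fun x : 'rV[R]_n => x) z.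
Proof.
elim: k => [|k IH].
  by apply/Ck0; apply: near_all => y.
apply/CkS; split=> [|i]; first by apply: near_all => y.
by under eq_fun do rewrite derive_id; exact: Ck_cst.
Qed.

Lemma Ck_lsubmx k (f : 'rV[R]_n -> 'rV[R]_(m + p)) z :
  Ck k f z -> Ck k (fun x => lsubmx (f x)) z.
Proof. by move=> H; apply: Ck_linear_comp => //; exact: continuous_lsubmx. Qed.

Lemma Ck_rsubmx k (f : 'rV[R]_n -> 'rV[R]_(m + p)) z :
  Ck k f z -> Ck k (fun x => rsubmx (f x)) z.
Proof. by move=> H; apply: Ck_linear_comp => //; exact: continuous_rsubmx. Qed.

Lemma Ck_row_mx k (f : 'rV[R]_n -> 'rV[R]_m) (g : 'rV[R]_n -> 'rV[R]_p) z :
  Ck k f z -> Ck k g z -> Ck k (fun x => row_mx (f x) (g x)) z.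
Proof.
move=> Hf Hg; apply: Ck_row => j; case: (split_ordP j) => i ->.
  by under eq_fun do rewrite row_mxEl; exact: Ck_coord.
by under eq_fun do rewrite row_mxEr; exact: Ck_coord.
Qed.

End CkComp2.

Arguments Ck_cst {R n E} k a z.
Arguments Ck_id {R n} k z.

(** * Bump functions *)

Section Flat.
Variable R : realType.
Implicit Types (P : {poly R}) (t : R).

(** For [P = 1] this is the classical smooth function exp(-1/t) extended by 0. Allowing a polynomial
    in 1/t makes the family closed under differentiation. *)
Definition flat P t : R := if 0 < t then P.[t^-1] * expR (- t^-1) else 0.

(* For t > 0 the derivative of P(1/t) exp(-1/t) is Q(1/t) exp(-1/t), where
   Q(s) = s^2 (P(s) - P'(s)). *)
Definition flat_deriv P : {poly R} := 'X^2 * (P - P^`()).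

(** With s = 1/t, the inequality s^(i+2) / (i+2)! <= exp(s) gives s^i exp(-s) <= (i+2)! t^2 for each
    monomial. A quadratic bound is what makes the difference quotient at 0 tend to 0. *)
Lemma flat_bound P : exists2 K, 0 <= K &
  forall t, 0 < t -> `|flat P t| <= K * t ^+ 2.
Proof.
exists (\sum_(i < size P) `|P`_i| * (i.+2)`!%:R).
  by apply: sumr_ge0 => i _; rewrite mulr_ge0.
move=> t t0; rewrite /flat t0 normrM (ger0_norm (expR_ge0 _)).
rewrite horner_coef (le_trans (ler_wpM2r (expR_ge0 _) (ler_norm_sum _ _ _))) //.
rewrite mulr_suml mulr_suml; apply: ler_sum => i _.
rewrite normrM -!mulrA ler_wpM2l //; have s0 : 0 < t^-1 by rewrite invr_gt0.
rewrite (ger0_norm (exprn_ge0 _ (ltW s0))) expRN ler_pdivrMr ?expR_gt0 //.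
have := expR_ge1Dxn i.+1 (ltW s0); move/(le_trans _) => H.
have {H} : t^-1 ^+ i.+2 / (i.+2)`!%:R <= expR t^-1.
  by apply: H; rewrite lerDr ler01.
rewrite ler_pdivrMr ?ltr0n ?fact_gt0 // => H.
have t20 : 0 < t ^+ 2 by rewrite exprn_gt0.
rewrite (_ : t^-1 ^+ i = t ^+ 2 * t^-1 ^+ i.+2); last first.
  by rewrite !exprS; field; rewrite gt_eqF.
rewrite (_ : _ * _ * expR _ = t ^+ 2 * (expR t^-1 * (i.+2)`!%:R)); last by ring.
by apply: ler_wpM2l => //; exact: ltW.
Qed.

Lemma is_derive_flat P t : is_derive t 1 (flat P) (flat (flat_deriv P) t).
Proof.
have [t0|t0|<-] := ltgtP 0 t.
- have : is_derive t 1 (fun t => P.[t^-1] * expR (- t^-1)) (flat (flat_deriv P) t).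
    have tn0 : id t != 0 by rewrite gt_eqF.
    have dV := @is_deriveV R id t 1 1 tn0 (is_derive_id t 1).
    have dP : is_derive t 1 (fun t => P.[t^-1]) (P^`().[t^-1] * (- t ^- 2 *: 1)).
      exact: (@is_derive1_comp _ (horner P) (fun t => t^-1)).
    have dE : is_derive t 1 (fun t => expR (- t^-1)) (expR (- t^-1) * - (- t ^- 2 *: 1)).
      exact: (@is_derive1_comp _ expR (fun t => - t^-1)).
    apply: is_derive_eq (is_deriveM dP dE) _.
    rewrite /flat t0 /flat_deriv !hornerE /= /GRing.scale /=.
    by field; rewrite gt_eqF.
  apply: near_eq_is_derive; near=> s; rewrite /flat ifT //; near: s.
  exact: lt_nbhsr.
- rewrite /flat ltNge (ltW t0) /=; apply: near_eq_is_derive (is_derive_cst 0 t 1).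
  near=> s; rewrite ifF //; apply/negbTE; rewrite -leNgt ltW //; near: s.
  exact: lt_nbhsl.
- rewrite {2}/flat ltxx; have [K K0 HK] := flat_bound P.
  have HK' s : `|flat P s| <= K * s ^+ 2.
    case: (ltP 0 s) => [/HK //|s0].
    by rewrite /flat ltNge s0 /= normr0 mulr_ge0 // sqr_ge0.
  (* By the quadratic bound the difference quotient at 0 has absolute value at most [K * |h|]. *)
  have H : (fun h => h^-1 *: ((flat P \o shift 0) (h *: 1) - flat P 0)) @ 0^' --> (0 : R).
    apply/cvgrPdist_le => e e0; near=> h.
    have h0 : h != 0 by near: h; exact: nbhs_dnbhs_neq.
    rewrite sub0r normrN /= addr0 [flat P 0]/flat ltxx subr0 normrM normfV.
    rewrite [h *: 1]mulr1 mulrC ler_pdivrMr ?normr_gt0 //.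
    apply: le_trans (HK' _) _; rewrite -real_normK ?num_real // expr2 mulrA.
    rewrite ler_wpM2r //.
    (* [K] may be 0, so the radius is obtained by dividing by [K + 1]. *)
    have : `|h| <= e / (K + 1).
      by near: h; apply: dnbhs0_le; rewrite divr_gt0 // ltr_wpDl.
    rewrite ler_pdivlMr ?ltr_wpDl // => /(le_trans _); apply.
    by rewrite mulrC ler_wpM2l // lerDl.
  apply: DeriveDef; first by apply/cvg_ex; exists 0.
  exact: cvg_lim.
Unshelve. all: by end_near. Qed.

Lemma flat1_gt0 t : (0 < flat 1 t) = (0 < t).
Proof.
by rewrite /flat; case: ifP; rewrite ?ltxx // hornerC mul1r expR_gt0.
Qed.

Lemma flat1_le s t : s <= t -> flat 1 s <= flat 1 t.
Proof.
rewrite /flat; case: ltP => [s0 st|s0 _]; last first.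
  by case: ifP => // _; rewrite hornerC mul1r expR_ge0.
have t0 := lt_le_trans s0 st.
by rewrite t0 !hornerC !mul1r ler_expR lerN2 lef_pV2.
Qed.

Lemma flat1_le0 t : t <= 0 -> flat 1 t = 0.
Proof. by rewrite /flat ltNge => ->. Qed.

(** A partial derivative replaces [P] by [flat_deriv P] and multiplies by a partial of [q], so the
    induction on [k] keeps [P] general. *)
Lemma Ck_flat n k P (q : 'rV[R]_n -> R^o) z :
  Ck k q z -> Ck k (fun x => flat P (q x) : R^o) z.
Proof.
have df Q (y : 'rV[R]_n) (g : 'rV[R]_n -> R^o) : differentiable g y ->
    differentiable (fun x => flat Q (g x) : R^o) y.
  move=> dg; apply: (@differentiable_comp _ _ _ _ g (flat Q : R^o -> R^o)) => //.
  by apply/derivable1_diffP; have [] := is_derive_flat Q (g y).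
elim: k P => [|k IH] P.
  by move/Ck0 => H; apply/Ck0; move: H; apply: filterS => y; exact: df.
move=> Hq; have /CkS[dq Dq] := Hq; apply/CkS; split.
  by move: dq; apply: filterS => y; exact: df.
move=> i; have := CkM (IH (flat_deriv P) (CkW Hq)) (Dq i).
apply: Ck_near_eq; move: dq; apply: filterS => y dqy.
rewrite [RHS]deriveE; last exact: df.
have dF : differentiable (flat P : R^o -> R^o) (q y).
  by apply/derivable1_diffP; have [] := is_derive_flat P (q y).
rewrite [RHS](_ : _ = 'd (flat P : R^o -> R^o) (q y) ('d q y (row_unit R i))); last first.
  by rewrite -[LHS]/('d ((flat P : R^o -> R^o) \o q) y (row_unit R i)) (diff_comp dqy dF).
rewrite diff1E // -deriveE // derive1E; have [_ ->] := is_derive_flat P (q y).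
by rewrite mulrC.
Qed.

End Flat.

Section Bump.
Variables (R : realType) (n : nat).

(** Distance to [p] is measured by a sum of squares, which is smooth, unlike the maximum norm of row
    vectors. A bound on it bounds every coordinate, so the support lies in a cube. *)
Lemma bump_rV (p : 'rV[R]_n) (e : R) : 0 < e -> exists b : 'rV[R]_n -> R^o,
  [/\ forall k z, Ck k b z, \near p, b p = 1 &
      forall z, b z != 0 -> forall i, `|z 0 i - p 0 i| <= e].
Proof.
move=> e0; pose q (z : 'rV[R]_n) : R^o := \sum_i (z 0 i - p 0 i) ^+ 2.
have Cq k z : Ck k q z.
  apply: Ck_sum => i _; under eq_fun do rewrite expr2.
  have H : Ck k (fun x : 'rV[R]_n => x 0 i - p 0 i : R^o) z.
    apply: CkD; last exact: Ck_cst.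
    by apply: Ck_coord; exact: Ck_id.
  exact: CkM.
have e20 : 0 < e ^+ 2 / 2 by rewrite divr_gt0 // exprn_gt0.
pose c := flat 1 (e ^+ 2 / 2).
have c0 : 0 < c by rewrite flat1_gt0.
have fc0 : 0 < flat 1 c by rewrite flat1_gt0.
(* [c - flat 1 (q - e^2/2)] is [c] for q <= e^2/2 and nonpositive for q >= e^2,
   so no partition-of-unity quotient is needed. *)
exists (fun z => (flat 1 c)^-1 * flat 1 (c - flat 1 (q z - e ^+ 2 / 2))); split.
- move=> k z; apply: CkM; first exact: Ck_cst.
  apply: Ck_flat; apply: CkD; first exact: Ck_cst.
  have H : Ck k (fun x => flat 1 (q x - e ^+ 2 / 2) : R^o) z.
    by apply: Ck_flat; apply: CkD => //; exact: Ck_cst.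
  have := CkM (Ck_cst k (-1 : R^o) z) H.
  by under eq_fun do rewrite mulN1r.
- have qp : q p = 0 by rewrite /q big1 // => i _; rewrite subrr expr0n.
  have cq : {for p, continuous q}.
    by apply: differentiable_continuous; have /Ck0/nbhs_singleton := Cq 0%N p.
  have : \near p, q p < e ^+ 2 / 2 by apply: (cvgr_lt _ cq); rewrite qp.
  apply: filterS => z qz.
  by rewrite [flat 1 (_ - _ / _)]flat1_le0 ?subr_le0 ?ltW // subr0 mulVf // gt_eqF.
- move=> z bz i; rewrite leNgt; apply: contraNN bz => ezi.
  have qz : e ^+ 2 <= q z.
    rewrite /q (bigD1 i) //= -[leLHS]addr0 lerD ?sumr_ge0 // => [|j _].
      rewrite -[leRHS]real_normK ?num_real // ler_sqr ?nnegrE ?ltW //.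
      exact: lt_trans ezi.
    exact: sqr_ge0.
  rewrite [flat 1 (c - _)]flat1_le0 ?mulr0 // subr_le0; apply: flat1_le.
  by lra.
Qed.

End Bump.

(** * Functions and tangent vectors in charts *)

(** The chart axioms of [is_manifold], isolated so that they can be verified for [A] and the same
    calculus of charts serves [M] and [A]. *)
Record is_atlas (R : realType) n (N : charted R n) : Prop := IsAtlas {
  atlas_cover : forall x : N, exists c, chart_dom c x ;
  atlas_inj : forall c : chart N, set_inj (chart_dom c) (chart_map c) ;
  atlas_image_open : forall c d : chart N,
    open (chart_map c @` (chart_dom c `&` chart_dom d)) ;
  atlas_transition : forall c d : chart N, smooth_in (chart_dom d) c (chart_map d) }.

Lemma manifold_atlas (R : realType) n (M : charted R n) :
  is_manifold M -> is_atlas M.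
Proof. by case. Qed.

Section Atlas.
Variables (R : realType) (n : nat) (N : charted R n).
Hypothesis atN : is_atlas N.
Implicit Types (x y : N) (c d : chart N) (E F : normedModType R).

Lemma chart_repE E c (f : N -> E) x : chart_dom c x ->
  chart_rep c f (chart_map c x) = f x.
Proof.
move=> cx; apply: xget_unique => [|_ [y [cy yx] <-]]; first by exists x.
by congr f; apply: (atlas_inj atN (c := c)); rewrite ?inE.
Qed.

Lemma smooth_transition c d x : chart_dom c x -> chart_dom d x ->
  smooth_at (chart_rep c (chart_map d)) (chart_map c x).
Proof.
move=> cx dx; have oU : open (chart_map c @` (chart_dom d `&` chart_dom c)).
  by rewrite setIC; exact: atlas_image_open.
have := (smooth_onP (chart_rep c (chart_map d)) oU).1 (@atlas_transition _ _ _ atN c d).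
by apply; exists x.
Qed.

Lemma smooth_at_cont m E (f : 'rV[R]_m -> E) z : smooth_at f z -> {for z, continuous f}.
Proof.
by move=> /(_ 0%N)/Ck0/nbhs_singleton; exact: differentiable_continuous.
Qed.

Lemma atlas_openP (U : set N) : open U <-> atlas_open U.
Proof. by []. Qed.

Lemma open_dom c : open (chart_dom c : set N).
Proof.
apply/atlas_openP => d; exists (chart_map d @` (chart_dom d `&` chart_dom c)).
  exact: atlas_image_open.
move=> x dx; split=> [cx|[y [dy cy]] yx]; first by exists x.
by rewrite -(atlas_inj atN (c := d) _ _ yx) ?inE.
Qed.

Lemma near_dom c x : chart_dom c x -> \near x, chart_dom c x.
Proof. by move=> cx; apply: open_nbhs_nbhs; split => //; exact: open_dom. Qed.

(** The open set [W] expressing openness may stick out of the image of the chart; it is intersected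
    with that image, itself open, so that every point has a preimage. *)
Lemma near_chart c x (P : N -> Prop) : chart_dom c x -> (\near x, P x) ->
  \forall z \near chart_map c x, exists y, [/\ chart_dom c y, chart_map c y = z & P y].
Proof.
move=> cx nP; have : nbhs x P by [].
rewrite topology_structure.nbhsE => -[U [oU Ux] UP].
have [W oW UW] := oU c.
have nW : \forall z \near chart_map c x, W z.
  by apply: open_nbhs_nbhs; split => //; exact/UW.
have nD : \forall z \near chart_map c x, (chart_map c @` (chart_dom c `&` chart_dom c)) z.
  by apply: open_nbhs_nbhs; split; [exact: atlas_image_open|exists x].
move: nW nD; apply: filterS2 => z Wz [y [cy _] yz]; rewrite -yz in Wz.
by exists y; split => //; apply: UP; apply/(UW _ cy).
Qed.

(** Openness of a set has to be tested in every chart [d]; there the preimage of [W] becomes its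
    preimage under the transition map from [d] to [c], which is continuous on the overlap. *)
Lemma chart_continuous c x : chart_dom c x -> {for x, continuous (chart_map c)}.
Proof.
move=> cx V; rewrite topology_structure.nbhsE => -[W [oW Wx] WV].
suff : nbhs x (chart_map c @^-1` V) by [].
rewrite topology_structure.nbhsE; exists [set y | chart_dom c y /\ W (chart_map c y)]; last first.
  by move=> y [_ /WV].
split=> //; apply/atlas_openP => d.
exists [set z | (chart_map d @` (chart_dom d `&` chart_dom c)) z /\
   W (chart_rep d (chart_map c) z)].
  rewrite openE => z [[y [dy cy] yz]] Wz.
  have cont : {for z, continuous (chart_rep d (chart_map c))}.
    by rewrite -yz; apply: smooth_at_cont; exact: smooth_transition.
  apply: filterI; first by apply: open_nbhs_nbhs; split; [exact: atlas_image_open|exists y].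
  by apply: cont; apply: open_nbhs_nbhs.
move=> y dy; rewrite /= chart_repE //; split=> [[cy Wy]|[[w [dw cw]] wy] Wy].
  by split => //; exists y.
by split => //; rewrite -(atlas_inj atN (c := d) _ _ wy) ?inE.
Qed.

Lemma near_chart_map c x (P : 'rV[R]_n -> Prop) : chart_dom c x ->
  (\forall z \near chart_map c x, P z) -> \forall y \near x, P (chart_map c y).
Proof. by move=> cx nP; exact: chart_continuous cx _ nP. Qed.

Lemma near_chartP c x (P : N -> Prop) (Q : 'rV[R]_n -> Prop) : chart_dom c x ->
  (\near x, P x) -> (forall y, chart_dom c y -> P y -> Q (chart_map c y)) ->
  \forall z \near chart_map c x, Q z.
Proof.
move=> cx nP PQ; have := near_chart cx nP; apply: filterS => z [y [cy <- Py]].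
exact: PQ.
Qed.

(** Smoothness of the germ of [f] at [x], asked for in every chart around [x]; by [smooth_pt_chart]
    one chart suffices to establish it. *)
Definition smooth_pt E (f : N -> E) x :=
  forall c, chart_dom c x -> smooth_at (chart_rep c f) (chart_map c x).

Lemma chart_rep_near_eq E (f g : N -> E) c x : chart_dom c x ->
  (\near x, f x = g x) ->
  \forall z \near chart_map c x, chart_rep c f z = chart_rep c g z.
Proof.
by move=> cx fg; apply: near_chartP cx fg _ => y cy fgy; rewrite !chart_repE.
Qed.

Lemma chart_rep_change E (f : N -> E) c d x : chart_dom c x -> chart_dom d x ->
  \forall z \near chart_map c x,
    chart_rep d f (chart_rep c (chart_map d) z) = chart_rep c f z.
Proof.
by move=> cx dx; apply: near_chartP cx (near_dom dx) _ => y cy dy; rewrite !chart_repE.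
Qed.

Lemma smooth_pt_chart E (f : N -> E) c x : chart_dom c x ->
  smooth_at (chart_rep c f) (chart_map c x) -> smooth_pt f x.
Proof.
move=> cx sf d dx k; apply: Ck_near_eq (chart_rep_change f dx cx) _.
apply: Ck_comp; last exact: smooth_transition.
by rewrite chart_repE.
Qed.

Lemma smooth_pt_near_eq E (f g : N -> E) x : (\near x, f x = g x) ->
  smooth_pt f x -> smooth_pt g x.
Proof.
by move=> fg sf c cx k; apply: Ck_near_eq (chart_rep_near_eq cx fg) (sf c cx k).
Qed.

Lemma open_chart_image (O : set N) c : open O ->
  open (chart_map c @` (O `&` chart_dom c)).
Proof.
move=> oO; rewrite openE => _ [x [Ox cx] <-].
have := near_chart cx (open_nbhs_nbhs (conj oO Ox)).
by apply: filterS => z [y [cy yz Oy]]; exists y.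
Qed.

Lemma smooth_inP E (O : set N) c (f : N -> E) : open O ->
  smooth_in O c f <-> forall x, O x -> chart_dom c x -> smooth_pt f x.
Proof.
move=> oO; rewrite /smooth_in smooth_onP; last exact: open_chart_image.
split=> [H x Ox cx|H _ [x [Ox cx] <-]]; last exact: H.
by apply: (smooth_pt_chart cx); apply: (H (chart_map c x)); exists x.
Qed.

Lemma smooth_funP (f : N -> R) : smooth_fun f <-> forall x, smooth_pt (f : N -> R^o) x.
Proof.
split=> [H x|H c]; last by apply/(smooth_inP _ _ openT) => x _ _; exact: H.
by have [c cx] := atlas_cover atN x; exact: (smooth_inP c _ openT).1 (H c) x I cx.
Qed.

Lemma smooth_pt_chart_map c x : chart_dom c x -> smooth_pt (chart_map c) x.
Proof. by move=> cx d dx; exact: smooth_transition. Qed.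

Lemma smooth_pt_cst E (a : E) x : smooth_pt (fun=> a) x.
Proof.
move=> c cx k; apply: Ck_near_eq (Ck_cst k a _).
by apply: near_chartP cx (near_dom cx) _ => y cy _; rewrite chart_repE.
Qed.

Lemma smooth_pt_comp m E (f : N -> 'rV[R]_m) (F : 'rV[R]_m -> E) x :
  smooth_at F (f x) -> smooth_pt f x -> smooth_pt (fun y => F (f y)) x.
Proof.
move=> sF sf c cx k; apply: (@Ck_near_eq _ _ _ _ (fun z => F (chart_rep c f z))).
  by apply: near_chartP cx (near_dom cx) _ => y cy _; rewrite !chart_repE.
by apply: Ck_comp (sf c cx k); rewrite chart_repE.
Qed.

Lemma smooth_ptD E (f g : N -> E) x :
  smooth_pt f x -> smooth_pt g x -> smooth_pt (fun y => f y + g y) x.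
Proof.
move=> sf sg c cx k; apply: Ck_near_eq (CkD (sf c cx k) (sg c cx k)).
by apply: near_chartP cx (near_dom cx) _ => y cy _; rewrite !chart_repE.
Qed.

Lemma smooth_ptZ E (f : N -> R^o) (g : N -> E) x :
  smooth_pt f x -> smooth_pt g x -> smooth_pt (fun y => f y *: g y) x.
Proof.
move=> sf sg c cx k; apply: Ck_near_eq (CkZ (sf c cx k) (sg c cx k)).
by apply: near_chartP cx (near_dom cx) _ => y cy _; rewrite !chart_repE.
Qed.

Lemma smooth_ptM (f g : N -> R^o) x :
  smooth_pt f x -> smooth_pt g x -> smooth_pt (fun y => f y * g y : R^o) x.
Proof. exact: smooth_ptZ. Qed.

Lemma smooth_ptN E (f : N -> E) x : smooth_pt f x -> smooth_pt (fun y => - f y) x.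
Proof.
move=> sf; have sc : smooth_pt (fun=> -1 : R^o) x by exact: smooth_pt_cst.
have := smooth_ptZ sc sf.
by under eq_fun do rewrite scaleN1r.
Qed.

Lemma smooth_pt_sum (I : Type) (r : seq I) E (f : I -> N -> E) x :
  (forall i, smooth_pt (f i) x) -> smooth_pt (fun y => \sum_(i <- r) f i y) x.
Proof.
move=> H; elim: r => [|i r IH].
  by under eq_fun do rewrite big_nil; exact: smooth_pt_cst.
by under eq_fun do rewrite big_cons; exact: smooth_ptD.
Qed.

Lemma smooth_pt_coord m (f : N -> 'rV[R]_m) x j :
  smooth_pt f x -> smooth_pt (fun y => f y 0 j : R^o) x.
Proof.
by apply: (@smooth_pt_comp _ R^o f (fun z => z 0 j)) => k; apply: Ck_coord; exact: Ck_id.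
Qed.

Lemma smooth_pt_row m (f : N -> 'rV[R]_m) x :
  (forall j, smooth_pt (fun y => f y 0 j : R^o) x) -> smooth_pt f x.
Proof.
move=> sf c cx k; apply: Ck_row => j; apply: Ck_near_eq (sf j c cx k).
by apply: near_chartP cx (near_dom cx) _ => y cy _; rewrite !chart_repE.
Qed.

Lemma smooth_pt_row_mx m p (f : N -> 'rV[R]_m) (g : N -> 'rV[R]_p) x :
  smooth_pt f x -> smooth_pt g x -> smooth_pt (fun y => row_mx (f y) (g y)) x.
Proof.
move=> sf sg c cx k; apply: Ck_near_eq (Ck_row_mx (sf c cx k) (sg c cx k)).
by apply: near_chartP cx (near_dom cx) _ => y cy _; rewrite !chart_repE.
Qed.

Lemma smooth_pt_differentiable E (f : N -> E) c x : smooth_pt f x -> chart_dom c x ->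
  differentiable (chart_rep c f) (chart_map c x).
Proof. by move=> sf cx; have /Ck0/nbhs_singleton := sf c cx 0%N. Qed.

(** * Tangent vectors through their components *)

Section TangentVectors.
Variable x : N.
Implicit Types (w u : tvec x).

Lemma tcompE w c d : chart_dom c x -> chart_dom d x ->
  w d = 'd (chart_rep c (chart_map d)) (chart_map c x) (w c).
Proof. by move=> cx dx; have /asboolP[H _] := tcompP w; exact: H. Qed.

Lemma tcomp0 w c : ~ chart_dom c x -> w c = 0.
Proof. by have /asboolP[_] := tcompP w; exact. Qed.

Lemma tcompD w u c : (w + u) c = w c + u c. Proof. by []. Qed.
Lemma tcompZ a w c : (a *: w) c = a *: w c. Proof. by []. Qed.
Lemma tcompB w u c : (w - u) c = w c - u c. Proof. by []. Qed.
Lemma tcomp_0 c : (0 : tvec x) c = 0. Proof. by []. Qed.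

Lemma tcomp_sum (I : Type) (r : seq I) (f : I -> tvec x) c :
  (\sum_(i <- r) f i) c = \sum_(i <- r) f i c.
Proof. by elim: r => [|i r IH]; rewrite ?big_nil // !big_cons tcompD IH. Qed.

Lemma tvec_eq c w u : chart_dom c x -> w c = u c -> w = u.
Proof.
move=> cx wu; apply: val_inj; apply/funext => d /=.
case: (pselect (chart_dom d x)) => dx; last by rewrite !tcomp0.
by rewrite (tcompE w cx dx) (tcompE u cx dx) wu.
Qed.

Lemma diff_chart E (f : N -> E) c d w : chart_dom c x -> chart_dom d x ->
  smooth_pt f x ->
  'd (chart_rep c f) (chart_map c x) (w c) = 'd (chart_rep d f) (chart_map d x) (w d).
Proof.
move=> cx dx sf; rewrite (tcompE w cx dx).
apply: diff_near_comp (chart_rep_change f cx dx); first exact: chart_repE.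
  exact: smooth_pt_differentiable (smooth_pt_chart_map dx) cx.
exact: smooth_pt_differentiable sf dx.
Qed.

(** The components in the other charts are forced to be the images of [e] under the differentials of
    the transition maps; their mutual compatibility is the chain rule. *)
Lemma tvec_exists c e : chart_dom c x -> exists w, w c = e.
Proof.
move=> cx.
pose w d : 'rV[R]_n := if `[<chart_dom d x>] then
  'd (chart_rep c (chart_map d)) (chart_map c x) e else 0.
have wP : w \in @tangent_mem R n N x.
  apply/asboolP; split=> [d d' dx d'x|d dx]; last by rewrite /w asboolF.
  rewrite /w !asboolT //.
  apply: diff_near_comp (chart_rep_change _ cx dx); first exact: chart_repE.
    exact: smooth_pt_differentiable (smooth_pt_chart_map dx) cx.
  exact: smooth_pt_differentiable (smooth_pt_chart_map d'x) dx.
exists (TVec wP); rewrite /= /w asboolT //.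
(* In the chart [c] itself the transition map is the identity near the point, so the component there
   is [e]. *)
rewrite -(@near_eq_diff _ _ _ id) ?diff_id //; first by have [_ ->] := is_diff_id (chart_map c x).
by apply: near_chartP cx (near_dom cx) _ => y cy _; rewrite chart_repE.
Qed.

Lemma vector_ofE c e : chart_dom c x -> (vector_of c x e) c = e.
Proof.
by move=> cx; apply: (xgetPex 0 (P := [set w : tvec x | w c = e])); exact: tvec_exists.
Qed.

Lemma dfunE (f : N -> R) w c : smooth_pt (f : N -> R^o) x -> chart_dom c x ->
  dfun f w = 'd (chart_rep c (f : N -> R^o)) (chart_map c x) (w c).
Proof.
move=> sf cx; apply: xget_unique => [d dx|r /(_ c cx)//].
exact: (@diff_chart R^o).
Qed.

Lemma diff_chart_map_comp E c (F : 'rV[R]_n -> E) : chart_dom c x ->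
  differentiable F (chart_map c x) ->
  'd (chart_rep c (fun y => F (chart_map c y))) (chart_map c x) = 'd F (chart_map c x) :> (_ -> _).
Proof.
move=> cx dF; apply/esym/near_eq_diff => //.
by apply: near_chartP cx (near_dom cx) _ => y cy _; rewrite chart_repE.
Qed.

End TangentVectors.

Arguments smooth_pt_cst {E} a x.
End Atlas.

(** * The charts of A *)

Lemma is_derive_affine (R : realType) (V W : normedModType R) (f : V -> W) z v L :
  (\forall h \near (0 : R), f (h *: v + z) = f z + h *: L) -> is_derive z v f L.
Proof.
move=> H; have C : (fun h : R => h^-1 *: ((f \o shift z) (h *: v) - f z)) @ 0^' --> L.
  apply: cvg_near_cst; near=> h.
  have h0 : h != 0 by near: h; exact: nbhs_dnbhs_neq.
  rewrite /= (_ : f (h *: v + z) = f z + h *: L); last by near: h; exact: nbhs_dnbhs.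
  by rewrite addrAC subrr add0r scalerA mulVf // scale1r.
apply: DeriveDef; first by apply/cvg_ex; exists L.
exact: cvg_lim.
Unshelve. all: by end_near. Qed.

Section TangentAtlas.
Variables (R : realType) (n : nat) (M : charted R n) (A : set (TM M)).
Hypotheses (atM : is_atlas M) (A_open : open A).
Notation AA := (subcharted A).
Implicit Types (c d : chart M) (v : AA) (E : normedModType R).

Definition mk_point (x : M) (w : tvec x) (Aw : A (mkTM w)) : AA :=
  exist (fun v : TM M => v \in A) (mkTM w) (mem_set Aw).

Lemma chart_map_pointE c v : chart_map (c : chart AA) v = row_mx (chart_map c (base v)) (fib v c).
Proof. by []. Qed.

Lemma point_chart_inj c : set_inj (chart_dom (c : chart AA)) (chart_map (c : chart AA)).
Proof.
move=> v v'; rewrite !inE /= => cv cv' /eq_row_mx[].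
case: v cv => -[x w] Aw /= cx; case: v' cv' => -[x' w'] Aw' /= cx' xx' ww'.
apply: val_inj => /=.
have ex : x = x' by apply: (atlas_inj atM (c := c)); rewrite ?inE.
subst x'; congr existT; exact: (tvec_eq cx).
Qed.

(** Over a given base point every fibre component is realised by a tangent vector. The image is
    therefore the open set [W] describing [A] in the chart, cut by an open condition on the base
    components. *)
Lemma point_chart_open_image c d :
  open (chart_map (c : chart AA) @` (chart_dom (c : chart AA) `&` chart_dom (d : chart AA))).
Proof.
have [W oW AW] := A_open (c : chart (TM M)).
rewrite (_ : image _ _ = W `&` (lsubmx @^-1` (chart_map c @` (chart_dom c `&` chart_dom d)))).
  apply: openI => //; apply: open_comp; last exact: atlas_image_open.
  by move=> z _; exact: continuous_lsubmx.
apply/seteqP; split=> [_ [v [cv dv] <-]|z [Wz [x [cx dx] xz]]].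
  split; first by apply/(AW (val v) cv); exact: set_mem (valP v).
  by exists (base v) => //; rewrite chart_map_pointE row_mxKl.
have [w wz] := tvec_exists atM (rsubmx z) cx.
have Aw : A (mkTM w).
  by apply/(AW (mkTM w) cx); rewrite /= wz xz hsubmxK.
by exists (mk_point Aw) => //; rewrite chart_map_pointE /= /fib /= wz xz hsubmxK.
Qed.

(** The transition map of the natural charts, (x, y) |-> (phi(x), Dphi(x) y). The differential is
    expanded in partial derivatives so that smoothness in [x] and [y] jointly can be read off. *)
Definition tangent_map c d (z : 'rV[R]_(n + n)) : 'rV[R]_(n + n) :=
  row_mx (chart_rep c (chart_map d) (lsubmx z))
    (\sum_j (rsubmx z) 0 j *: 'D_(row_unit R j) (chart_rep c (chart_map d)) (lsubmx z)).

Lemma tangent_mapE c d v : chart_dom c (base v) -> chart_dom d (base v) ->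
  tangent_map c d (chart_map (c : chart AA) v) = chart_map (d : chart AA) v.
Proof.
move=> cv dv; rewrite chart_map_pointE /tangent_map row_mxKl row_mxKr chart_repE // chart_map_pointE.
rewrite -diff_row_sum -?tcompE //.
exact: (smooth_pt_differentiable (smooth_pt_chart_map atM dv) cv).
Qed.

Lemma smooth_tangent_map c d v : chart_dom c (base v) -> chart_dom d (base v) ->
  smooth_at (tangent_map c d) (chart_map (c : chart AA) v).
Proof.
move=> cv dv k.
have St := smooth_transition atM cv dv.
have Sl : Ck k (fun z : 'rV[R]_(n + n) => lsubmx z) (chart_map (c : chart AA) v).
  by apply: (@Ck_lsubmx R (n + n) n n); exact: Ck_id.
apply: Ck_row_mx; first by apply: Ck_comp => //; rewrite row_mxKl.
apply: Ck_sum => j _; apply: CkZ.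
  by apply: Ck_coord; apply: (@Ck_rsubmx R (n + n) n n); exact: Ck_id.
apply: (Ck_comp (f := fun y => 'D_(row_unit R j) (chart_rep c (chart_map d)) y)) => //.
by rewrite row_mxKl; have /CkS[_] := St k.+1; exact.
Qed.

Lemma point_chart_repE E c (f : AA -> E) v : chart_dom c (base v) ->
  chart_rep (c : chart AA) f (chart_map (c : chart AA) v) = f v.
Proof.
move=> cv; apply: xget_unique => [|_ [y [cy yx] <-]]; first by exists v.
by congr f; apply: (@point_chart_inj c); rewrite ?inE.
Qed.

Lemma subtangent_atlas : is_atlas AA.
Proof.
split=> [v|c|c d|c d].
- exact: (atlas_cover atM (base v)).
- exact: point_chart_inj.
- exact: point_chart_open_image.
- have oI := @point_chart_open_image c d; rewrite setIC in oI.
  apply/(smooth_onP _ oI) => _ [v [dv cv] <-] k.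
  apply: Ck_near_eq (smooth_tangent_map cv dv (k := k)).
  have : \forall z \near chart_map (c : chart AA) v,
    (chart_map (c : chart AA) @` (chart_dom (d : chart AA) `&` chart_dom (c : chart AA))) z.
    by apply: open_nbhs_nbhs; split => //; exists v.
  by apply: filterS => _ [v' [dv' cv'] <-]; rewrite tangent_mapE // point_chart_repE.
Qed.
Let atA := subtangent_atlas.

Lemma near_point_dom c v : chart_dom c (base v) -> \near v, chart_dom c (base v).
Proof. exact: (@near_dom _ _ _ atA c v). Qed.

Lemma near_point_chart c v (P : AA -> Prop) (Q : 'rV[R]_(n + n) -> Prop) :
  chart_dom c (base v) -> (\near v, P v) ->
  (forall u : AA, chart_dom c (base u) -> P u -> Q (chart_map (c : chart AA) u)) ->
  \forall z \near chart_map (c : chart AA) v, Q z.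
Proof. exact: (@near_chartP _ _ _ atA c v P Q). Qed.

Lemma smooth_pull E (f : M -> E) v : smooth_pt f (base v) ->
  smooth_pt (fun u : AA => f (base u)) v.
Proof.
move=> sf c cv k.
apply: (@Ck_near_eq _ _ E _ (fun z : 'rV[R]_(n + n) => @chart_rep R n M E c f (lsubmx z))).
  apply: near_point_chart cv (near_point_dom cv) _ => u cu _.
  by rewrite (chart_repE atA _ cu) chart_map_pointE row_mxKl chart_repE.
apply: Ck_comp; first by rewrite chart_map_pointE row_mxKl; exact: sf.
by apply: (@Ck_lsubmx R (n + n) n n); exact: Ck_id.
Qed.

Lemma diff_pull E (f : M -> E) c v (xi : 'rV[R]_(n + n)) :
  smooth_pt f (base v) -> chart_dom c (base v) ->
  'd (chart_rep (c : chart AA) (fun u : AA => f (base u))) (chart_map (c : chart AA) v) xi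
  = 'd (chart_rep c f) (chart_map c (base v)) (lsubmx xi).
Proof.
move=> sf cv.
have dl := @differentiable_lsubmx R 1 n n (chart_map (c : chart AA) v).
rewrite (@diff_near_comp _ _ _ _ lsubmx (chart_rep c f) _ _ (chart_map c (base v))) //.
- by rewrite diff_lin //; exact: continuous_lsubmx.
- by rewrite chart_map_pointE row_mxKl.
- exact: smooth_pt_differentiable.
- apply: near_point_chart cv (near_point_dom cv) _ => u cu _.
  by rewrite (chart_repE atA _ cu) chart_map_pointE row_mxKl chart_repE.
Qed.

Lemma smooth_fib c v : chart_dom c (base v) -> smooth_pt (fun u : AA => fib u c) v.
Proof.
move=> cv; have := smooth_pt_chart_map atA (cv : chart_dom (c : chart AA) v).
move/(smooth_pt_comp atA (F := rsubmx)); under eq_fun do rewrite chart_map_pointE row_mxKr.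
by apply=> k; apply: (@Ck_rsubmx R (n + n) n n); exact: Ck_id.
Qed.

(** Both sides are the derivative along [xi] of the function [chart_map d] pulled back to [A],
    computed in the two charts. This makes the base components a tangent vector of [M]. *)
Lemma tcomp_lsub v (xi : tvec v) c d : chart_dom c (base v) -> chart_dom d (base v) ->
  lsubmx (xi d) =
  'd (chart_rep c (chart_map d)) (chart_map c (base v)) (lsubmx (xi c)).
Proof.
move=> cv dv; rewrite -diff_pull //; last exact: smooth_pt_chart_map.
rewrite (diff_chart (f := fun u : AA => chart_map d (base u)) atA xi (c := c) (d := d)) //; last first.
  by apply: smooth_pull; exact: smooth_pt_chart_map.
rewrite diff_pull //; last exact: smooth_pt_chart_map.
have dv' : chart_dom d (base v) by [].
have := @diff_chart_map_comp _ _ _ atM (base v) _ d (fun z => z) dv'.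
by move=> -> //; have [_ ->] := is_diff_id (chart_map d (base v)).
Qed.

(** [tangent_map] is affine along each fibre, so its derivative in a vertical direction involves
    only first derivatives of the transition map. *)
Lemma tcomp_vert v (xi : tvec v) c d b : chart_dom c (base v) -> chart_dom d (base v) ->
  xi c = row_mx 0 b ->
  xi d = row_mx 0 ('d (chart_rep c (chart_map d)) (chart_map c (base v)) b).
Proof.
move=> cv dv xic.
have dt : differentiable (chart_rep c (chart_map d)) (chart_map c (base v)).
  exact: (smooth_pt_differentiable (smooth_pt_chart_map atM dv) cv).
have dT : differentiable (tangent_map c d) (chart_map (c : chart AA) v).
  by have /Ck0/nbhs_singleton := smooth_tangent_map cv dv (k := 0%N).
rewrite (tcompE xi (cv : chart_dom (c : chart AA) v) dv) xic.
rewrite -(@near_eq_diff _ _ _ (tangent_map c d)) //.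
  rewrite -deriveE //; apply: (@derive_val _ _ _ _ _ _ _ (is_derive_affine _)).
  apply: near_all => h; rewrite chart_map_pointE /tangent_map.
  rewrite scale_row_mx add_row_mx !row_mxKl !row_mxKr scaler0 add0r.
  rewrite -!diff_row_sum // scale_row_mx add_row_mx scaler0 addr0.
  by rewrite linearP addrC.
apply: near_point_chart cv (near_point_dom dv) _ => u cu du.
by rewrite tangent_mapE // (chart_repE atA _ cu).
Qed.

Lemma dmap_baseE v (xi : tvec v) c : chart_dom c (base v) ->
  dmap (@base R n M A) xi c = lsubmx (xi c).
Proof.
move=> cv; pose P := [set u : tvec (base v) | forall c d,
    chart_dom (c : chart AA) v -> chart_dom d (base v) ->
    u d = 'd (chart_rep (c : chart AA) (chart_map d \o @base R n M A))
      (chart_map (c : chart AA) v) (xi c)].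
have Pex : exists u, P u.
  have [u uc] := tvec_exists atM (lsubmx (xi c)) cv.
  exists u => c' d' c'v d'v.
  rewrite (@diff_pull _ (chart_map d')) //; last exact: smooth_pt_chart_map.
  have H1 := tcompE u cv d'v; rewrite uc in H1.
  exact: etrans H1 (etrans (esym (tcomp_lsub xi cv d'v)) (tcomp_lsub xi c'v d'v)).
have := xgetPex 0 Pex => /(_ c c cv cv); rewrite /dmap => ->.
by rewrite (@diff_pull _ (chart_map c)) // -?tcomp_lsub //; exact: smooth_pt_chart_map.
Qed.

Lemma verticalP v (xi : tvec v) c : chart_dom c (base v) ->
  vertical v xi <-> lsubmx (xi c) = 0.
Proof.
move=> cv; split=> [vx|xi0]; first by rewrite -dmap_baseE // vx.
by apply: (tvec_eq cv); rewrite dmap_baseE.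
Qed.

Lemma vliftE v (u : tvec (base v)) c : chart_dom c (base v) ->
  vlift u c = row_mx 0 (u c).
Proof.
move=> cv.
have H (d : chart M) : is_derive (0 : R) (1 : R)
    (fun t : R => chart_map (d : chart (TM M)) (fib_shift (t *: u))) (row_mx 0 (u d)).
  apply: is_derive_affine; apply: near_all => h.
  rewrite /fib_shift /= scale0r !addr0 [h *: 1]mulr1.
  by rewrite scale_row_mx scaler0 add_row_mx addr0.
have [xi xic] := tvec_exists atA (row_mx 0 (u c)) (cv : chart_dom (c : chart AA) v).
have xiE d : chart_dom d (base v) -> xi d = row_mx 0 (u d).
  by move=> dv; rewrite (tcomp_vert cv dv xic) -tcompE.
rewrite /vlift (@xget_unique _ _ _ xi) // => [d dv|z Hz]; first by rewrite xiE.
apply: (tvec_eq (cv : chart_dom (c : chart AA) v)).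
by have [_ <-] := Hz c cv; have [_ ->] := H c; rewrite xiE.
Qed.

Lemma vlift_invE v (xi : tvec v) c : chart_dom c (base v) -> vertical v xi ->
  vlift_inv xi c = rsubmx (xi c).
Proof.
move=> cv /(verticalP xi cv) xi0.
have [u uc] := tvec_exists atM (rsubmx (xi c)) cv.
rewrite /vlift_inv (@xget_unique _ _ _ u) //=.
  apply: (tvec_eq (cv : chart_dom (c : chart AA) v)).
  by rewrite vliftE // uc -{2}[xi c]hsubmxK xi0.
by move=> w wxi; apply: (tvec_eq cv); rewrite uc -wxi vliftE // row_mxKr.
Qed.

Lemma vlift_vertical v (u : tvec (base v)) : vertical v (vlift u).
Proof.
by have [c cv] := atlas_cover atM (base v); apply/(verticalP _ cv); rewrite vliftE // row_mxKl.
Qed.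

End TangentAtlas.

(** * Smooth functions act pointwise *)

Section ManifoldBump.
Variables (R : realType) (n : nat) (M : charted R n).
Hypothesis Mm : is_manifold M.
Let atM := manifold_atlas Mm.

(* The preimage of a compact cube of the chart is compact, hence closed since M
   is Hausdorff; this makes the extension by 0 smooth. *)
Lemma bump_manifold (x : M) (U : M -> Prop) : (\near x, U x) ->
  exists b : M -> R^o, [/\ forall y, smooth_pt b y, \near x, b x = 1 &
    forall y, ~ U y -> \near y, b y = 0].
Proof.
move=> nU0; have [c cx] := atlas_cover atM x.
pose U' y := U y /\ chart_dom c y.
have nU : \near x, U' x by have := near_dom atM cx; apply: filterS2 nU0.
have /nbhs_ballP[e /= e0 He] := near_chart atM cx nU.
set p := chart_map c x in He.
have e20 : 0 < e / 2 by rewrite divr_gt0.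
have [b [Cb b1 bK]] := bump_rV p e20.
(* The closed cube of half-side [e / 2] lies in the open ball of radius [e] for the maximum norm,
   hence in the chart image of [U']. *)
pose K := [set z : 'rV[R]_n | forall i, `|z 0 i - p 0 i| <= e / 2].
have KU z : K z -> exists y, [/\ chart_dom c y, chart_map c y = z & U' y].
  move=> Kz; apply: He; split=> // i j; rewrite (ord1 i) /ball /= distrC.
  by apply: le_lt_trans (Kz j) _; rewrite ltr_pdivrMr // ltr_pMr // ltr1n.
have cK : compact K.
  have := @rV_compact R n (fun i => [set` `[p 0 i - e / 2, p 0 i + e / 2]]).
  rewrite (_ : mkset _ = K); first by apply=> i; exact: segment_compact.
  apply/seteqP; split=> z /= Hz i; have := Hz i; rewrite /= in_itv /= ler_distl //.
(* The inverse of the chart; the default value [x] does not occur on [K], which lies in the image of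
   the chart. *)
pose inv z := xget x [set y | chart_dom c y /\ chart_map c y = z].
have invE y : chart_dom c y -> inv (chart_map c y) = y.
  move=> cy; apply: xget_unique => // y' [cy' yy'].
  by apply: (atlas_inj atM (c := c)); rewrite ?inE.
have icont : {within K, continuous inv}.
  apply: continuous_in_subspaceT => z; rewrite inE => /KU[y [cy <- _]] V.
  rewrite invE // => nV; have := near_chart atM cy nV.
  by apply: filterS => _ [y' [cy' <- Vy']]; rewrite /= invE.
have iK : closed (inv @` K).
  apply: compact_closed; first exact: manifold_hausdorff.
  exact: continuous_compact.
pose bM (y : M) : R^o := if `[< chart_dom c y >] then b (chart_map c y) else 0.
have bM0 y : ~ U' y -> \near y, bM y = 0.
  move=> nUy; have : (~` (inv @` K)) y.
    by move=> [z Kz zy]; case: (KU z Kz) => y' [cy' y'z Uy']; apply: nUy; rewrite -zy -y'z invE.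
  move=> iKy; have := open_nbhs_nbhs (conj (closed_openC iK) iKy).
  apply: filterS => y' iKy'; rewrite /bM; case: asboolP => // cy'.
  apply/eqP; apply: contra_notT iKy' => bn0; exists (chart_map c y'); last exact: invE.
  exact: bK.
exists bM; split => // [y||].
  case: (pselect (chart_dom c y)) => cy.
    apply: (@smooth_pt_near_eq _ _ _ atM _ (fun y => b (chart_map c y))).
      by have := near_dom atM cy; apply: filterS => y' cy'; rewrite /bM asboolT.
    apply: smooth_pt_comp => //; exact: smooth_pt_chart_map.
  have n0 : \near y, bM y = 0 by apply: bM0 => -[].
  apply: (@smooth_pt_near_eq _ _ _ atM _ (fun=> 0)); last exact: smooth_pt_cst.
  by move: n0; apply: filterS => y' ->.
  have := near_chart_map atM cx b1.
  by have := near_dom atM cx; apply: filterS2 => y cy by1; rewrite /bM asboolT.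
by move=> y Uy; apply: bM0 => -[].
Qed.

(** Continuity of the projection from [A] to [M], which in natural charts is [lsubmx]. *)
Lemma near_base (A : set (TM M)) (A_open : open A) (v : subcharted A) (P : M -> Prop) :
  (\forall y \near base v, P y) -> \forall u \near v, P (base u).
Proof.
move=> nP; have [c cv] := atlas_cover atM (base v).
have atA := subtangent_atlas atM A_open.
have := near_chart atM cv nP => H.
have : \forall z \near chart_map (c : chart (subcharted A)) v,
    exists y, [/\ chart_dom c y, chart_map c y = lsubmx z & P y].
  have cl := @continuous_lsubmx R 1 n n (chart_map (c : chart (subcharted A)) v).
  have H' : \forall z \near lsubmx (chart_map (c : chart (subcharted A)) v),
      exists y, [/\ chart_dom c y, chart_map c y = z & P y].
    by rewrite chart_map_pointE row_mxKl.
  exact: (cl _ H').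
move/(near_chart_map atA (cv : chart_dom (c : chart (subcharted A)) v)).
have := near_point_dom atM A_open cv; apply: filterS2 => u cu [y [cy]].
rewrite chart_map_pointE row_mxKl => yu.
by rewrite (atlas_inj atM (c := c) _ _ yu) ?inE.
Qed.

Lemma bump_point (A : set (TM M)) (A_open : open A) (v : subcharted A) (c : chart M) :
  chart_dom c (base v) ->
  exists b : subcharted A -> R^o, [/\ forall y, smooth_pt b y, \near v, b v = 1 &
    forall u, ~ chart_dom (c : chart (subcharted A)) u -> \near u, b u = 0].
Proof.
move=> cv; have [b [sb b1 b0]] := bump_manifold (near_dom atM cv).
exists (fun u => b (base u)); split=> [u||u cu].
- exact: smooth_pull.
- exact: near_base b1.
- exact: (near_base A_open (b0 _ cu)).
Qed.

Lemma bump_chart (x : M) (c : chart M) : chart_dom c x ->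
  exists b : M -> R^o, [/\ forall y, smooth_pt b y, \near x, b x = 1 &
    forall y, ~ chart_dom c y -> \near y, b y = 0].
Proof. by move=> cx; exact: bump_manifold (near_dom atM cx). Qed.

End ManifoldBump.

(* [V] stands for the tangent bundle of M, its pullback to A, or the tangent
   bundle of A. *)
Section Bundle.
Variables (R : realType) (n : nat) (N : charted R n) (m : nat).
Variables (V : N -> lmodType R) (comp : forall x, V x -> chart N -> 'rV[R]_m).
Hypotheses (atN : is_atlas N)
  (bumpN : forall x c, chart_dom c x ->
    exists b : N -> R^o, [/\ forall y, smooth_pt b y, \near x, b x = 1 &
      forall y, ~ chart_dom c y -> \near y, b y = 0])
  (comp_lin : forall x c, linear (fun w : V x => comp w c))
  (comp_inj : forall x c (w u : V x), chart_dom c x -> comp w c = comp u c -> w = u)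
  (comp_surj : forall x c e, chart_dom c x -> exists w : V x, comp w c = e)
  (comp_trans : forall (s : forall x, V x) x c d, chart_dom c x -> chart_dom d x ->
    smooth_pt (fun y => comp (s y) c) x -> smooth_pt (fun y => comp (s y) d) x).
Implicit Types (s t : forall x, V x) (x y : N) (c d : chart N).

Definition smooth_sec s := forall c, smooth_in setT c (fun x => comp (s x) c).

Lemma smooth_secP s :
  smooth_sec s <-> forall x, exists2 c, chart_dom c x & smooth_pt (fun y => comp (s y) c) x.
Proof.
split=> [H x|H c].
  have [c cx] := atlas_cover atN x; exists c => //.
  exact: (smooth_inP atN c _ openT).1 (H c) x I cx.
apply/(smooth_inP atN _ _ openT) => x _ cx; have [d dx sd] := H x.
exact: comp_trans sd.
Qed.

Lemma smooth_sec_pt s c x : smooth_sec s -> chart_dom c x ->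
  smooth_pt (fun y => comp (s y) c) x.
Proof. by move=> H cx; exact: (smooth_inP atN c _ openT).1 (H c) x I cx. Qed.

Lemma compD x c (w u : V x) : comp (w + u) c = comp w c + comp u c.
Proof. by have := comp_lin c 1 w u; rewrite !scale1r. Qed.
Lemma comp0 x c : comp (0 : V x) c = 0.
Proof. by apply: (addrI (comp (0 : V x) c)); rewrite -compD !addr0. Qed.
Lemma compZ x c a (w : V x) : comp (a *: w) c = a *: comp w c.
Proof. by have := comp_lin c a w 0; rewrite !addr0 comp0 addr0. Qed.
Lemma comp_sum x c (I : Type) (r : seq I) (w : I -> V x) :
  comp (\sum_(i <- r) w i) c = \sum_(i <- r) comp (w i) c.
Proof. by elim: r => [|i r IH]; rewrite ?big_nil ?comp0 // !big_cons compD IH. Qed.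

Lemma smooth_secD s t : smooth_sec s -> smooth_sec t -> smooth_sec (fun y => s y + t y).
Proof.
move=> ss st; apply/smooth_secP => x; have [c cx] := atlas_cover atN x; exists c => //.
by under eq_fun do rewrite compD; apply: smooth_ptD => //; exact: smooth_sec_pt.
Qed.

Lemma smooth_secZ (f : N -> R) s : smooth_fun f -> smooth_sec s ->
  smooth_sec (fun y => f y *: s y).
Proof.
move=> /(smooth_funP atN) sf ss; apply/smooth_secP => x.
have [c cx] := atlas_cover atN x; exists c => //.
by under eq_fun do rewrite compZ; apply: smooth_ptZ => //; exact: smooth_sec_pt.
Qed.

Lemma smooth_sec0 : smooth_sec (fun y => 0).
Proof.
apply/smooth_secP => x; have [c cx] := atlas_cover atN x; exists c => //.
by under eq_fun do rewrite comp0; exact: smooth_pt_cst.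
Qed.

Lemma smooth_sec_sum (I : Type) (r : seq I) (s : I -> forall x, V x) :
  (forall i, smooth_sec (s i)) -> smooth_sec (fun y => \sum_(i <- r) s i y).
Proof.
move=> H; elim: r => [|i r IH].
  rewrite (_ : (fun y => _) = (fun y => 0 : V y)); first exact: smooth_sec0.
  by apply: functional_extensionality_dep => y; rewrite big_nil.
rewrite (_ : (fun y => _) = (fun y => s i y + \sum_(i <- r) s i y)); first exact: smooth_secD.
by apply: functional_extensionality_dep => y; rewrite big_cons.
Qed.

Definition vector_of_comp c (e : 'rV[R]_m) x : V x := xget 0 [set w | comp w c = e].

Lemma vector_of_compE c e x : chart_dom c x -> comp (vector_of_comp c e x) c = e.
Proof.
by move=> cx; apply: (xgetPex 0 (P := [set w : V x | comp w c = e])); exact: comp_surj.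
Qed.

(** [s] may be arbitrary outside the chart: [b] vanishes near each point there. *)
Lemma bump_sec c (b : N -> R^o) s : (forall y, smooth_pt b y) ->
  (forall y, ~ chart_dom c y -> \near y, b y = 0) ->
  (forall y, chart_dom c y -> smooth_pt (fun y => comp (s y) c) y) ->
  smooth_sec (fun y => b y *: s y).
Proof.
move=> sb b0 ss; apply/smooth_secP => x.
case: (pselect (chart_dom c x)) => cx.
  exists c => //; under eq_fun do rewrite compZ.
  by apply: smooth_ptZ => //; exact: ss.
have [d dx] := atlas_cover atN x; exists d => //.
apply: (@smooth_pt_near_eq _ _ _ atN _ (fun=> 0)); last exact: smooth_pt_cst.
by have := b0 x cx; apply: filterS => y by0; rewrite by0 scale0r comp0.
Qed.

Lemma frame_exists c x e : chart_dom c x ->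
  exists2 s, smooth_sec s & \near x, comp (s x) c = e.
Proof.
move=> cx; have [b [sb b1 b0]] := bumpN cx.
exists (fun y => b y *: vector_of_comp c e y).
  apply: (bump_sec sb b0) => y cy.
  apply: (@smooth_pt_near_eq _ _ _ atN _ (fun=> e)); last exact: smooth_pt_cst.
  by have := near_dom atN cy; apply: filterS => z cz; rewrite vector_of_compE.
have := near_dom atN cx; move: b1; apply: filterS2 => y -> cy.
by rewrite scale1r vector_of_compE.
Qed.

Lemma section_exists x (u : V x) : exists2 s, smooth_sec s & s x = u.
Proof.
have [c cx] := atlas_cover atN x; have [s ss /nbhs_singleton sx] := frame_exists (comp u c) cx.
by exists s => //; exact: (comp_inj cx).
Qed.

Section Pointwise.
Variables (L : lmodType R) (F : (forall x, V x) -> L) (x : N).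
Hypotheses (FD : forall s t, smooth_sec s -> smooth_sec t ->
    F (fun y => s y + t y) = F s + F t)
  (FZ : forall (f : N -> R) s, smooth_fun f -> smooth_sec s ->
    F (fun y => f y *: s y) = f x *: F s).

Lemma pointwise_sum (I : Type) (r : seq I) (s : I -> forall x, V x) :
  (forall i, smooth_sec (s i)) ->
  F (fun y => \sum_(i <- r) s i y) = \sum_(i <- r) F (s i).
Proof.
move=> H; elim: r => [|i r IH].
  have s0 : smooth_fun (fun _ : N => 0 : R) by apply/(smooth_funP atN) => y; exact: smooth_pt_cst.
  have := FZ s0 smooth_sec0; rewrite big_nil scale0r => <-; congr F.
  by apply: functional_extensionality_dep => y; rewrite big_nil scale0r.
rewrite big_cons -IH -FD //; last exact: smooth_sec_sum.
by congr F; apply: functional_extensionality_dep => y; rewrite big_cons.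
Qed.

(** With a bump [b] equal to 1 near [x], b^2 s = sum_i (b s^i) (b e_i) holds globally: one factor
    [b] makes the coefficients smooth, the other makes the frame smooth. Applying [F] gives [F s] on
    the left, and on the right every coefficient vanishes at [x]. *)
Lemma pointwise0 s : smooth_sec s -> s x = 0 -> F s = 0.
Proof.
move=> ss sx; have [c cx] := atlas_cover atN x; have [b [sb b1 b0]] := bumpN cx.
pose a i y : R := b y * comp (s y) c 0 i.
pose e i y := b y *: vector_of_comp c (delta_mx 0 i) y.
have be : forall y, smooth_pt (fun y => b y * b y : R^o) y by move=> y; exact: smooth_ptM.
have se i : smooth_sec (e i).
  apply: (bump_sec sb b0) => y cy.
  apply: (@smooth_pt_near_eq _ _ _ atN _ (fun=> delta_mx 0 i)); last exact: smooth_pt_cst.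
  by have := near_dom atN cy; apply: filterS => z cz; rewrite vector_of_compE.
have sa i : smooth_fun (a i).
  apply/(smooth_funP atN) => y; case: (pselect (chart_dom c y)) => cy.
    apply: smooth_ptM => //; apply: smooth_pt_coord => //; exact: smooth_sec_pt.
  apply: (@smooth_pt_near_eq _ _ _ atN _ (fun=> 0)); last exact: smooth_pt_cst.
  by have := b0 y cy; apply: filterS => z bz; rewrite /a bz mul0r.
have E : (fun y => (b y * b y) *: s y) = (fun y => \sum_i a i y *: e i y).
  apply: functional_extensionality_dep => y; case: (pselect (chart_dom c y)) => cy.
    apply: (comp_inj cy); rewrite compZ comp_sum [in LHS](row_sum_delta (comp (s y) c)).
    rewrite scaler_sumr; apply: eq_bigr => i _.
    by rewrite !compZ vector_of_compE // !scalerA /a mulrAC.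
  have b0y := nbhs_singleton (b0 y cy).
  by rewrite b0y mul0r scale0r big1 // => i _; rewrite /a b0y mul0r scale0r.
have sbb : smooth_fun (fun y => b y * b y : R) by exact/(smooth_funP atN).
have := FZ sbb ss; rewrite (nbhs_singleton b1) mul1r scale1r => <-; rewrite E.
rewrite pointwise_sum; last by move=> i; exact: smooth_secZ.
rewrite big1 // => i _; rewrite FZ // /a sx comp0 mxE mulr0 scale0r //.
Qed.

Lemma pointwise s t : smooth_sec s -> smooth_sec t -> s x = t x -> F s = F t.
Proof.
move=> ss st stx; apply/eqP; rewrite -subr_eq0; apply/eqP.
have sN : smooth_fun (fun _ : N => -1 : R) by apply/(smooth_funP atN) => y; exact: smooth_pt_cst.
have <- : F (fun y => s y + -1 *: t y) = F s - F t.
  by rewrite FD // ?FZ ?scaleN1r //; exact: smooth_secZ.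
apply: pointwise0; last by rewrite stx scaleN1r subrr.
by apply: smooth_secD => //; exact: smooth_secZ.
Qed.

End Pointwise.

End Bundle.

(** * Change of chart for fields and sections; fields with prescribed values or germs *)

Section Jacobian.
Variables (R : realType) (n : nat) (N : charted R n).
Hypothesis atN : is_atlas N.
Implicit Types (c d : chart N).

Definition jacobian_row c d (y : N) (j : 'I_n) : 'rV[R]_n :=
  'D_(row_unit R j) (chart_rep c (chart_map d)) (chart_map c y).

Lemma smooth_jacobian_row c d x j : chart_dom c x -> chart_dom d x ->
  smooth_pt (fun y => jacobian_row c d y j) x.
Proof.
move=> cx dx; apply: (smooth_pt_comp atN (F := fun z => 'D_(row_unit R j) (chart_rep c (chart_map d)) z)).
  by move=> k; have /CkS[_] := smooth_transition atN cx dx (k := k.+1); exact.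
exact: smooth_pt_chart_map.
Qed.

Lemma tcomp_jacobian_row x (w : tvec x) c d : chart_dom c x -> chart_dom d x ->
  w d = \sum_j (w c) 0 j *: jacobian_row c d x j.
Proof.
move=> cx dx; rewrite (tcompE w cx dx) diff_row_sum //.
exact: (smooth_pt_differentiable (smooth_pt_chart_map atN dx) cx).
Qed.

Lemma tvec_trans (s : forall x : N, tvec x) x c d : chart_dom c x -> chart_dom d x ->
  smooth_pt (fun y => s y c) x -> smooth_pt (fun y => s y d) x.
Proof.
move=> cx dx ss.
apply: (@smooth_pt_near_eq _ _ _ atN _ (fun y => \sum_j (s y c) 0 j *: jacobian_row c d y j)).
  have := near_dom atN cx; have := near_dom atN dx; apply: filterS2 => y dy cy.
  exact/esym/tcomp_jacobian_row.
apply: smooth_pt_sum => // j; apply: smooth_ptZ => //; last exact: smooth_jacobian_row.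
exact: smooth_pt_coord.
Qed.

End Jacobian.

Section Instances.
Variables (R : realType) (n : nat) (M : charted R n) (A : set (TM M)).
Hypotheses (Mm : is_manifold M) (A_open : open A).
Let atM := manifold_atlas Mm.
Let atA := subtangent_atlas atM A_open.
Notation AA := (subcharted A).
Implicit Types (c : chart M) (v : AA).

Lemma section_trans (Z : section A) v c d : chart_dom c (base v) -> chart_dom d (base v) ->
  smooth_pt (fun u : AA => Z u c) v -> smooth_pt (fun u : AA => Z u d) v.
Proof.
move=> cv dv sZ.
apply: (@smooth_pt_near_eq _ _ _ atA _ (fun u : AA => \sum_j (Z u c) 0 j *: jacobian_row c d (base u) j)).
  have := near_point_dom atM A_open cv; have := near_point_dom atM A_open dv.
  by apply: filterS2 => u du cu; rewrite (tcomp_jacobian_row atM (Z u) cu du).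
apply: smooth_pt_sum => // j; apply: smooth_ptZ => //.
  exact: smooth_pt_coord.
apply: (smooth_pull atM A_open (f := fun y => jacobian_row c d y j)).
exact: smooth_jacobian_row.
Qed.

Let compM (x : M) (w : tvec x) (c : chart M) : 'rV[R]_n := w c.
Let compZ_ (v : AA) (w : tvec (base v)) (c : chart AA) : 'rV[R]_n := w c.
Let compA (v : AA) (w : tvec v) (c : chart AA) : 'rV[R]_(n + n) := w c.

Lemma smooth_fieldP (X : vfield M) : smooth_field X <->
  forall x, exists2 c, chart_dom c x & smooth_pt (fun y => X y c) x.
Proof. exact: (@smooth_secP _ _ _ _ _ compM atM (tvec_trans atM)). Qed.

Lemma smooth_field_pt (X : vfield M) c x : smooth_field X -> chart_dom c x ->
  smooth_pt (fun y => X y c) x.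
Proof. exact: (@smooth_sec_pt _ _ _ _ _ compM atM). Qed.

Lemma smooth_sectionP (Z : section A) : smooth_section Z <->
  forall v, exists2 c : chart M, chart_dom c (base v) & smooth_pt (fun u : AA => Z u c) v.
Proof. exact: (@smooth_secP _ _ _ _ _ compZ_ atA section_trans). Qed.

Lemma smooth_section_pt (Z : section A) c v : smooth_section Z -> chart_dom c (base v) ->
  smooth_pt (fun u : AA => Z u c) v.
Proof. exact: (@smooth_sec_pt _ _ _ _ _ compZ_ atA). Qed.

Lemma smooth_fieldAP (xi : vfieldA A) : smooth_field xi <->
  forall v, exists2 c : chart M, chart_dom c (base v) & smooth_pt (fun u : AA => xi u c) v.
Proof. exact: (@smooth_secP _ _ _ _ _ compA atA (tvec_trans atA)). Qed.

Lemma smooth_fieldA_pt (xi : vfieldA A) c v : smooth_field xi -> chart_dom c (base v) ->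
  smooth_pt (fun u : AA => xi u c) v.
Proof. exact: (@smooth_sec_pt _ _ _ _ _ compA atA). Qed.

Lemma frame_field c x (e : 'rV[R]_n) : chart_dom c x ->
  exists2 X : vfield M, smooth_field X & \near x, X x c = e.
Proof.
apply: (@frame_exists _ _ _ _ _ compM) => //.
- exact: bump_chart.
- by move=> y c0 e0; exact: tvec_exists.
- by move=> y; exact: tvec_trans.
Qed.

Lemma field_exists x (u : tvec x) : exists2 X : vfield M, smooth_field X & X x = u.
Proof.
apply: (@section_exists _ _ _ _ _ compM) => //.
- exact: bump_chart.
- by move=> y c w w'; exact: tvec_eq.
- by move=> y c0 e0; exact: tvec_exists.
- by move=> y; exact: tvec_trans.
Qed.

Lemma pointwise_field (L : lmodType R) (F : vfield M -> L) x :
  (forall X Y, smooth_field X -> smooth_field Y -> F (fun y => X y + Y y) = F X + F Y) ->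
  (forall f X, smooth_fun f -> smooth_field X -> F (fun y => f y *: X y) = f x *: F X) ->
  forall X Y, smooth_field X -> smooth_field Y -> X x = Y x -> F X = F Y.
Proof.
move=> FD FZ X Y; apply: (@pointwise _ _ _ _ _ compM) => //.
- exact: bump_chart.
- by move=> y c w w'; exact: tvec_eq.
- by move=> y c0 e0; exact: tvec_exists.
- by move=> y; exact: tvec_trans.
Qed.

Lemma pointwise_section (L : lmodType R) (F : section A -> L) v :
  (forall X Y, smooth_section X -> smooth_section Y -> F (fun y => X y + Y y) = F X + F Y) ->
  (forall f X, smooth_fun f -> smooth_section X -> F (fun y => f y *: X y) = f v *: F X) ->
  forall X Y, smooth_section X -> smooth_section Y -> X v = Y v -> F X = F Y.
Proof.
move=> FD FZ X Y; apply: (@pointwise _ _ _ _ _ compZ_) => //.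
- by move=> u c; exact: bump_point.
- by move=> y c w w'; exact: (@tvec_eq _ _ M (base y) c).
- by move=> y c e; exact: (@tvec_exists _ _ M atM (base y) c).
- exact: section_trans.
Qed.

Lemma pointwise_fieldA (L : lmodType R) (F : vfieldA A -> L) v :
  (forall X Y, smooth_field X -> smooth_field Y -> F (fun y => X y + Y y) = F X + F Y) ->
  (forall f X, smooth_fun f -> smooth_field X -> F (fun y => f y *: X y) = f v *: F X) ->
  forall X Y, smooth_field X -> smooth_field Y -> X v = Y v -> F X = F Y.
Proof.
move=> FD FZ X Y; apply: (@pointwise _ _ _ _ _ compA) => //.
- by move=> u c; exact: bump_point.
- by move=> y c w w'; exact: tvec_eq.
- by move=> y c e; exact: tvec_exists.
- exact: tvec_trans.
Qed.

Lemma smooth_fieldD (X Y : vfield M) : smooth_field X -> smooth_field Y ->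
  smooth_field (fun x => X x + Y x).
Proof. by apply: (@smooth_secD _ _ _ _ _ compM) => // x; exact: tvec_trans. Qed.

Lemma smooth_fieldZ f (X : vfield M) : smooth_fun f -> smooth_field X ->
  smooth_field (fun x => f x *: X x).
Proof. by apply: (@smooth_secZ _ _ _ _ _ compM) => // x; exact: tvec_trans. Qed.

Lemma smooth_pull_field (X : vfield M) : smooth_field X -> smooth_section (pull X : section A).
Proof.
move=> sX; apply/smooth_sectionP => v; have [c cv] := atlas_cover atM (base v).
by exists c => //; apply: (smooth_pull atM A_open (f := fun y => X y c)); exact: smooth_field_pt.
Qed.

Lemma smooth_fun_pull (f : M -> R) : smooth_fun f -> smooth_fun (fun v : AA => f (base v)).
Proof.
move=> /(smooth_funP atM) sf; apply/(smooth_funP atA) => v.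
exact: (smooth_pull atM A_open (f := f : M -> R^o)).
Qed.

(** The bump function is taken for the set of points at which [Y] is smooth: elsewhere it vanishes
    on a neighbourhood, so [b *: Y] is smooth everywhere and has the germ of [Y] at [x]. *)
Lemma extend_field (Y : vfield M) (x : M) :
  (\forall y \near x, forall c, chart_dom c y -> smooth_pt (fun y => Y y c) y) ->
  exists2 Y' : vfield M, smooth_field Y' & \forall y \near x, Y' y = Y y.
Proof.
move=> nY; have [b [sb b1 b0]] := bump_manifold Mm nY.
exists (fun y => b y *: Y y); last by move: b1; apply: filterS => y ->; rewrite scale1r.
apply/smooth_fieldP => y; have [c cy] := atlas_cover atM y; exists c => //.
case: (pselect (forall c, chart_dom c y -> smooth_pt (fun y => Y y c) y)) => [sY|/b0 b0y].
  by apply: smooth_ptZ => //; exact: sY.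
apply: (@smooth_pt_near_eq _ _ _ atM _ (fun=> 0)); last exact: smooth_pt_cst.
by move: b0y; apply: filterS => z ->; rewrite scale0r.
Qed.

End Instances.

(** * Lifts and the associated objects *)

Section Lifts.
Variables (R : realType) (n : nat) (M : charted R n) (A : set (TM M)).
Hypotheses (Mm : is_manifold M) (A_open : open A).
Let atM := manifold_atlas Mm.
Let atA := subtangent_atlas atM A_open.
Notation AA := (subcharted A).
Implicit Types (c : chart M) (v : AA).

Lemma tvecA_eq v (xi eta : tvec v) c : chart_dom c (base v) -> xi c = eta c -> xi = eta.
Proof. exact: (@tvec_eq _ _ AA v c). Qed.

Lemma tvecA_exists v c (e : 'rV[R]_(n + n)) : chart_dom c (base v) ->
  exists xi : tvec v, xi c = e.
Proof. exact: (@tvec_exists _ _ AA atA v c). Qed.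

Lemma dfunA_E (f : AA -> R) v (xi : tvec v) c : smooth_pt (f : AA -> R^o) v ->
  chart_dom c (base v) ->
  dfun f xi = 'd (chart_rep (c : chart AA) (f : AA -> R^o)) (chart_map (c : chart AA) v) (xi c).
Proof. exact: (@dfunE _ _ AA atA v f xi c). Qed.

(** For functions pulled back from [M] the derivation term of the Leibniz rule sees only the
    projection of [xi]: it is X(f) along a horizontal lift of X and 0 along a vertical lift. *)
Lemma dfun_pull (f : M -> R) v (xi : tvec v) : smooth_fun f ->
  dfun (fun u : AA => f (base u)) xi = dfun f (dmap (@base R n M A) xi).
Proof.
move=> /(smooth_funP atM) sf; have [c cv] := atlas_cover atM (base v).
have sf' : smooth_pt (fun u : AA => f (base u) : R^o) v.
  exact: (smooth_pull atM A_open (f := f : M -> R^o)).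
rewrite (dfunA_E xi sf' cv) (dfunE atM _ (sf _) cv) dmap_baseE //.
exact: (diff_pull atM A_open (f := f : M -> R^o)).
Qed.

Lemma spanned_byP c v (N : 'M[R]_n) (xi : tvec v) :
  spanned_by c N xi <-> rsubmx (xi c) = - (lsubmx (xi c) *m N).
Proof.
split=> [[a ->]|H]; first by rewrite row_mxKl row_mxKr.
by exists (lsubmx (xi c)); rewrite -H hsubmxK.
Qed.

(** The spanned vector with base components [delta_mx 0 i] shows row [i] of the matrix. Thus at most
    one matrix satisfies the description [nonlin_coef]. *)
Lemma spanned_by_inj c v (N N' : 'M[R]_n) : chart_dom c (base v) ->
  @spanned_by R n M A c v N = spanned_by c N' -> N = N'.
Proof.
move=> cv NN'; apply/row_matrixP => i.
have [xi xic] := tvecA_exists (row_mx (delta_mx 0 i) (- ((delta_mx 0 i : 'rV_n) *m N))) cv.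
have : spanned_by c N xi by apply/spanned_byP; rewrite xic row_mxKl row_mxKr.
rewrite NN' => /spanned_byP; rewrite xic row_mxKl row_mxKr !rowE.
exact: oppr_inj.
Qed.

Lemma dmap_base_lin v a (xi eta : tvec v) :
  dmap (@base R n M A) (a *: xi + eta)
  = a *: dmap (@base R n M A) xi + dmap (@base R n M A) eta.
Proof.
have [c cv] := atlas_cover atM (base v); apply: (tvec_eq cv).
rewrite tcompD tcompZ !dmap_baseE //.
rewrite (_ : (a *: xi + eta) c = a *: xi c + eta c) //.
exact: linearP.
Qed.

Lemma vlift_lin v a (u w : tvec (base v)) :
  vlift (a *: u + w) = a *: vlift u + vlift w.
Proof.
have [c cv] := atlas_cover atM (base v); apply: (tvecA_eq cv).
rewrite vliftE // (_ : (a *: vlift u + vlift w) c = a *: vlift u c + vlift w c) //.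
rewrite !vliftE // (_ : (a *: u + w) c = a *: u c + w c) //.
by rewrite scale_row_mx add_row_mx scaler0 add0r.
Qed.

Lemma dmap_vlift v (u : tvec (base v)) : dmap (@base R n M A) (vlift u) = 0.
Proof. exact: vlift_vertical. Qed.

Lemma vlift_invK v (xi : tvec v) : vertical v xi -> vlift (vlift_inv xi) = xi.
Proof.
move=> vx; have [c cv] := atlas_cover atM (base v); apply: (tvecA_eq cv).
have /(verticalP atM A_open _ cv) x0 := vx.
by rewrite vliftE // vlift_invE // -[in RHS](hsubmxK (xi c)) x0.
Qed.

Lemma smooth_vlift_field (X : vfield M) :
  smooth_field X -> smooth_field (vlift_field X : vfieldA A).
Proof.
move=> sX; apply/(smooth_fieldAP Mm A_open) => v; have [c cv] := atlas_cover atM (base v).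
exists c => //.
apply: (@smooth_pt_near_eq _ _ _ atA _ (fun u : AA => row_mx 0 (X (base u) c))).
  have := near_point_dom atM A_open cv; apply: filterS => u cu.
  by rewrite /vlift_field vliftE.
apply: smooth_pt_row_mx => //; first exact: smooth_pt_cst.
apply: (smooth_pull atM A_open (f := fun x => X x c)).
exact: (smooth_field_pt Mm).
Qed.

Section Horizontal.
Variable Hc : forall v : AA, set (tvec v).
Hypothesis hHc : is_horizontal Hc.

Lemma horizP v (xi : tvec v) c : chart_dom c (base v) ->
  Hc xi <-> rsubmx (xi c) = - (lsubmx (xi c) *m nonlin_coef Hc c v).
Proof. by move=> cv; rewrite {1}(horiz_span hHc cv); exact: spanned_byP. Qed.

Lemma hliftP v (u : tvec (base v)) c : chart_dom c (base v) ->
  [/\ Hc (hlift Hc u), dmap (@base R n M A) (hlift Hc u) = u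
    & hlift Hc u c = row_mx (u c) (- (u c *m nonlin_coef Hc c v))].
Proof.
move=> cv; have [xi xic] := tvecA_exists (row_mx (u c) (- (u c *m nonlin_coef Hc c v))) cv.
have Hxi : Hc xi by apply/(horizP xi cv); rewrite xic row_mxKl row_mxKr.
have dxi : dmap (@base R n M A) xi = u.
  by apply: (tvec_eq cv); rewrite dmap_baseE // xic row_mxKl.
rewrite /hlift (@xget_unique _ _ _ xi) // => eta [/(horizP eta cv) He de].
apply: (tvecA_eq cv); have := He; rewrite -(dmap_baseE atM A_open eta cv) de => He'.
by rewrite -[eta c]hsubmxK He' -(dmap_baseE atM A_open eta cv) de xic.
Qed.

Lemma hliftE v (u : tvec (base v)) c : chart_dom c (base v) ->
  hlift Hc u c = row_mx (u c) (- (u c *m nonlin_coef Hc c v)).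
Proof. by move=> cv; have [] := hliftP u cv. Qed.

Lemma dmap_hlift v (u : tvec (base v)) : dmap (@base R n M A) (hlift Hc u) = u.
Proof. by have [c cv] := atlas_cover atM (base v); have [] := hliftP u cv. Qed.

Lemma hlift_lin v a (u w : tvec (base v)) :
  hlift Hc (a *: u + w) = a *: hlift Hc u + hlift Hc w.
Proof.
have [c cv] := atlas_cover atM (base v); apply: (tvecA_eq cv).
rewrite hliftE // (_ : (a *: hlift Hc u + hlift Hc w) c = a *: hlift Hc u c + hlift Hc w c) //.
rewrite !hliftE // (_ : (a *: u + w) c = a *: u c + w c) //.
by rewrite scale_row_mx add_row_mx mulmxDl opprD -scalemxAl scalerN.
Qed.

(** Sections over [A] are allowed, beyond fields pulled back from [M], because the spray is the
    horizontal lift of the section [fib]. *)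
Lemma smooth_hlift (Z : section A) : smooth_section Z ->
  smooth_field (fun v => hlift Hc (Z v)).
Proof.
move=> sZ; apply/(smooth_fieldAP Mm A_open) => v; have [c cv] := atlas_cover atM (base v).
exists c => //.
apply: (@smooth_pt_near_eq _ _ _ atA _
    (fun u : AA => row_mx (Z u c) (- (Z u c *m nonlin_coef Hc c u)))).
  have := near_point_dom atM A_open cv; apply: filterS => u cu.
  by rewrite hliftE.
have sZv := smooth_section_pt Mm A_open sZ cv.
apply: smooth_pt_row_mx => //; apply: smooth_ptN => //; apply: smooth_pt_row => // k.
apply: (@smooth_pt_near_eq _ _ _ atA _
    (fun u : AA => \sum_l (Z u c 0 l * nonlin_coef Hc c u l k) : R^o)).
  by apply: near_all => u; rewrite mxE.
apply: smooth_pt_sum => // l; apply: smooth_ptM => //; first exact: smooth_pt_coord.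
exact: (smooth_inP atA c _ openT).1 (@horiz_smooth _ _ _ _ _ hHc c k l) v I cv.
Qed.

Lemma smooth_hlift_field (X : vfield M) : smooth_field X -> smooth_field (hlift_field Hc X).
Proof. by move=> sX; apply: smooth_hlift; exact: (smooth_pull_field Mm). Qed.

End Horizontal.

(** * The anisotropic connection and tensor associated with a classical connection *)

Section Associated.
Variables (nabla : vfieldA A -> section A -> section A).
Hypothesis hn : is_linear_connection nabla.

Lemma nabla_addr xi Z W v : smooth_field xi -> smooth_section Z -> smooth_section W ->
  nabla xi (fun a => Z a + W a) v = nabla xi Z v + nabla xi W v.
Proof.
move=> sxi sZ sW; rewrite -[X in X + _]scale1r -(nabla_linr hn) //.
apply: (congr1 (fun Z => nabla xi Z v)).
by apply: functional_extensionality_dep => a; rewrite scale1r.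
Qed.

Let sp (X : vfield M) : smooth_field X -> smooth_section (pull X : section A).
Proof. exact: smooth_pull_field. Qed.

Lemma assoc_connection_aniso Hc : is_horizontal Hc ->
  is_aniso_connection (assoc_connection nabla Hc).
Proof.
move=> hHc; have sh X : smooth_field X -> smooth_field (hlift_field Hc X).
  exact: smooth_hlift_field.
split=> [X Y sX sY|v X Y Z sX sY sZ|v X Y Z sX sY sZ|v f X Y sf sX sY|v f X Y sf sX sY].
- exact: (nabla_smooth hn (sh _ sX) (sp sY)).
- exact: (nabla_addr v (sh _ sX) (sp sY) (sp sZ)).
- rewrite /assoc_connection -(nabla_addl hn (sh _ sX) (sh _ sY) (sp sZ)).
  apply: (congr1 (fun xi => nabla xi (pull _) v)).
apply: functional_extensionality_dep => a.
  rewrite /hlift_field -[hlift Hc (pull X a)]scale1r -(hlift_lin hHc).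
  by rewrite scale1r.
- rewrite /assoc_connection.
  rewrite -(nabla_scalel hn (smooth_fun_pull Mm A_open sf) (sh _ sX) (sp sY)).
  apply: (congr1 (fun xi => nabla xi (pull _) v)).
apply: functional_extensionality_dep => a.
  have := hlift_lin hHc (f (base a)) (pull X a) (0 : tvec (base a)).
  rewrite addr0 /hlift_field => H; rewrite [LHS]H.
  have -> : hlift Hc (0 : tvec (base a)) = 0; last by rewrite addr0.
  have := hlift_lin hHc 1 (0 : tvec (base a)) 0.
  by rewrite !scale1r addr0 => /esym/(canRL (addrK _)); rewrite subrr.
- rewrite /assoc_connection.
  have := nabla_leibniz hn (smooth_fun_pull Mm A_open sf) (sh _ sX) (sp sY) v.
  by rewrite dfun_pull // /hlift_field dmap_hlift.
Qed.

Lemma assoc_tensor_smooth X Y : smooth_field X -> smooth_field Y ->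
  smooth_section (fun v => assoc_tensor nabla v X Y).
Proof. by move=> sX sY; exact: (nabla_smooth hn (smooth_vlift_field sX) (sp sY)). Qed.

Lemma assoc_tensor_addl v X Y Z : smooth_field X -> smooth_field Y -> smooth_field Z ->
  assoc_tensor nabla v (fun x => X x + Y x) Z
  = assoc_tensor nabla v X Z + assoc_tensor nabla v Y Z.
Proof.
move=> sX sY sZ; rewrite /assoc_tensor.
rewrite -(nabla_addl hn (smooth_vlift_field sX) (smooth_vlift_field sY) (sp sZ)).
apply: (congr1 (fun xi => nabla xi (pull _) v)).
apply: functional_extensionality_dep => a.
rewrite /vlift_field -[vlift (pull X a)]scale1r -vlift_lin.
by rewrite scale1r.
Qed.

Lemma vlift0 v : vlift (0 : tvec (base v)) = 0.
Proof.
have := vlift_lin 1 (0 : tvec (base v)) 0.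
by rewrite !scale1r addr0 => /esym/(canRL (addrK _)); rewrite subrr.
Qed.

Lemma assoc_tensor_scalel v f X Y : smooth_fun f -> smooth_field X -> smooth_field Y ->
  assoc_tensor nabla v (fun x => f x *: X x) Y = f (base v) *: assoc_tensor nabla v X Y.
Proof.
move=> sf sX sY; rewrite /assoc_tensor.
rewrite -(nabla_scalel hn (smooth_fun_pull Mm A_open sf) (smooth_vlift_field sX) (sp sY)).
apply: (congr1 (fun xi => nabla xi (pull _) v)).
apply: functional_extensionality_dep => a.
have := vlift_lin (f (base a)) (pull X a) (0 : tvec (base a)).
by rewrite addr0 vlift0 addr0.
Qed.

Lemma assoc_tensor_addr v X Y Z : smooth_field X -> smooth_field Y -> smooth_field Z ->
  assoc_tensor nabla v X (fun x => Y x + Z x)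
  = assoc_tensor nabla v X Y + assoc_tensor nabla v X Z.
Proof.
by move=> sX sY sZ; exact: (nabla_addr v (smooth_vlift_field sX) (sp sY) (sp sZ)).
Qed.

Lemma dfun0 (f : M -> R) x : smooth_fun f -> dfun f (0 : tvec x) = 0.
Proof.
move=> /(smooth_funP atM) sf; have [c cx] := atlas_cover atM x.
by rewrite (dfunE atM _ (sf _) cx) linear0.
Qed.

Lemma assoc_tensor_scaler v f X Y : smooth_fun f -> smooth_field X -> smooth_field Y ->
  assoc_tensor nabla v X (fun x => f x *: Y x) = f (base v) *: assoc_tensor nabla v X Y.
Proof.
move=> sf sX sY.
have := nabla_leibniz hn (smooth_fun_pull Mm A_open sf) (smooth_vlift_field sX) (sp sY) v.
by rewrite dfun_pull // /vlift_field dmap_vlift dfun0 // scale0r add0r.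
Qed.

Lemma assoc_tensor_pointwise v X X' Y Y' : smooth_field X -> smooth_field X' ->
  smooth_field Y -> smooth_field Y' -> X (base v) = X' (base v) -> Y (base v) = Y' (base v) ->
  assoc_tensor nabla v X Y = assoc_tensor nabla v X' Y'.
Proof.
move=> sX sX' sY sY' XX' YY'; transitivity (assoc_tensor nabla v X' Y).
  apply: (pointwise_field Mm (F := fun X => assoc_tensor nabla v X Y) (x := base v)) => //.
    by move=> *; exact: assoc_tensor_addl.
  by move=> *; exact: assoc_tensor_scalel.
apply: (pointwise_field Mm (F := fun Y => assoc_tensor nabla v X' Y) (x := base v)) => //.
  by move=> *; exact: assoc_tensor_addr.
by move=> *; exact: assoc_tensor_scaler.
Qed.

Lemma smooth_fun_cst (N : charted R n) (a : R) : is_atlas N -> smooth_fun (fun _ : N => a).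
Proof. by move=> atN; apply/(smooth_funP atN) => x; exact: smooth_pt_cst. Qed.

(** Vectors are extended to global fields by choice, and [assoc_tensor_pointwise] makes the choice
    irrelevant. The chosen extensions need not vary smoothly with the point, so for smoothness they
    are replaced near [v] by two fixed fields that are coordinate fields there. *)
Lemma assoc_tensor_exists :
  exists2 C : forall v : AA, tvec (base v) -> tvec (base v) -> tvec (base v),
    is_tensor12 C &
    forall v X Y, smooth_field X -> smooth_field Y ->
      C v (pull X v) (pull Y v) = assoc_tensor nabla v X Y.
Proof.
pose X x (u : tvec x) : vfield M := s2val (cid2 (field_exists Mm u)).
have sX x (u : tvec x) : smooth_field (X x u) by rewrite /X; case: cid2.
have Xx x (u : tvec x) : X x u x = u by rewrite /X; case: cid2.
exists (fun v u w => assoc_tensor nabla v (X _ u) (X _ w)); last first.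
  by move=> v Y Z sY sZ; apply: assoc_tensor_pointwise; rewrite ?Xx //.
split=> [v w a u u'|v w a u u'|c j k].
- have sc := smooth_fun_cst a atM.
  rewrite -(@assoc_tensor_scalel v (fun _ => a)) // -assoc_tensor_addl //; last exact: smooth_fieldZ.
  apply: assoc_tensor_pointwise => //; rewrite ?Xx //.
  by apply: smooth_fieldD => //; exact: smooth_fieldZ.
- have sc := smooth_fun_cst a atM.
  rewrite -(@assoc_tensor_scaler v (fun _ => a)) // -assoc_tensor_addr //; last exact: smooth_fieldZ.
  apply: assoc_tensor_pointwise => //; rewrite ?Xx //.
  by apply: smooth_fieldD => //; exact: smooth_fieldZ.
apply/(smooth_inP atA _ _ openT) => v _ cv.
have [Y sY Yc] := frame_field Mm (delta_mx 0 j) (cv : chart_dom c (base v)).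
have [Z sZ Zc] := frame_field Mm (delta_mx 0 k) (cv : chart_dom c (base v)).
apply: (@smooth_pt_near_eq _ _ _ atA _ (fun v => assoc_tensor nabla v Y Z c)).
  have := near_base Mm A_open Yc; have := near_base Mm A_open Zc.
  have := near_point_dom atM A_open cv; apply: filterS3 => u cu Zu Yu.
  congr (tcomp _ c); apply: assoc_tensor_pointwise => //; rewrite Xx.
    by apply: (tvec_eq cu); rewrite Yu vector_ofE.
  by apply: (tvec_eq cu); rewrite Zu vector_ofE.
exact: (smooth_section_pt Mm A_open (assoc_tensor_smooth sY sZ)).
Qed.

End Associated.

(** [hat_loc] evaluates the operator on smooth fields only, so agreement on these gives equal
    Christoffel symbols. *)
Lemma hat_loc_eq (hat1 hat2 : aniso_op A) v u Y :
  (forall v X Y, smooth_field X -> smooth_field Y -> hat1 v X Y = hat2 v X Y) ->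
  @hat_loc _ _ _ _ hat1 v u Y = hat_loc hat2 u Y.
Proof.
move=> H; rewrite /hat_loc; congr xget; apply/seteqP.
by split=> w [X [Y' [sX sY' Xu Y'Y ->]]]; exists X, Y'; split => //; rewrite H.
Qed.

Lemma connection_unique (nabla1 nabla2 : vfieldA A -> section A -> section A)
    (Hc : forall v : AA, set (tvec v)) :
  is_linear_connection nabla1 -> is_linear_connection nabla2 -> is_horizontal Hc ->
  (forall v X Y, smooth_field X -> smooth_field Y ->
    assoc_connection nabla1 Hc v X Y = assoc_connection nabla2 Hc v X Y) ->
  (forall v X Y, smooth_field X -> smooth_field Y ->
    assoc_tensor nabla1 v X Y = assoc_tensor nabla2 v X Y) ->
  forall xi Z, smooth_field xi -> smooth_section Z ->
    forall v, nabla1 xi Z v = nabla2 xi Z v.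
Proof.
move=> h1 h2 hHc Hconn Htens xi Z sxi sZ v.
pose D xi Z := nabla1 xi Z v - nabla2 xi Z v.
(* The derivation terms of the Leibniz rule cancel in [D], so [D] is bilinear over
   the smooth functions and depends only on the values of xi and Z at v. *)
suff : D xi Z = 0 by move/subr0_eq.
have [X sX Xv] := field_exists Mm (dmap (@base R n M A) (xi v)).
have [c cv] := atlas_cover atM (base v).
have vx : vertical v (xi v - hlift_field Hc X v).
  rewrite /vertical /= -scaleN1r addrC dmap_base_lin dmap_hlift // /pull Xv.
  by rewrite scaleN1r addNr.
have [Y sY Yv] := field_exists Mm (vlift_inv (xi v - hlift_field Hc X v)).
have xiE : xi v = hlift_field Hc X v + vlift_field Y v.
  by rewrite /vlift_field /pull Yv vlift_invK // addrC subrK.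
have [W sW Wv] := field_exists Mm (Z v).
have sh := smooth_hlift_field hHc sX; have sv := smooth_vlift_field sY.
have sp := smooth_pull_field Mm A_open sW.
have D1 xi1 xi2 Z' : smooth_field xi1 -> smooth_field xi2 -> smooth_section Z' ->
    D (fun a => xi1 a + xi2 a) Z' = D xi1 Z' + D xi2 Z'.
  by move=> s1 s2 s3; rewrite /D !nabla_addl // opprD addrACA.
have sD : smooth_field (fun a => hlift_field Hc X a + vlift_field Y a).
  by apply: (@smooth_secD _ _ _ _ (fun v => tvec v : lmodType R) (fun v w c => w c)) => //; exact: tvec_trans.
(* First [xi] and then [Z] is replaced by an object with the same value at [v] that comes from
   fields on [M], where the two hypotheses apply. *)
transitivity (D (fun a => hlift_field Hc X a + vlift_field Y a) Z).
  apply: (pointwise_fieldA Mm A_open (F := fun xi => D xi Z) (v := v)) => //.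
    by move=> *; exact: D1.
  by move=> f xi' sf sxi'; rewrite /D !nabla_scalel // scalerBr.
transitivity (D (fun a => hlift_field Hc X a + vlift_field Y a) (pull W)).
  apply: (pointwise_section Mm A_open (F := fun Z => D _ Z) (v := v)) => //.
    by move=> Z1 Z2 s1 s2; rewrite /D !nabla_addr // opprD addrACA.
  move=> f Z' sf sZ'; rewrite /D !nabla_leibniz // opprD addrACA subrr add0r.
  by rewrite scalerBr.
rewrite D1 // /D.
have := Hconn v X W sX sW; have := Htens v Y W sY sW.
by rewrite /assoc_connection /assoc_tensor => -> ->; rewrite !subrr addr0.
Qed.

End Lifts.

(** * Derivatives in charts *)

Section ChartDerivative.
Variables (R : realType) (n : nat) (N : charted R n).
Hypothesis atN : is_atlas N.
Implicit Types (c d : chart N) (x : N) (E : normedModType R).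

(** The chart and the components of the direction are kept explicit, because the functions
    differentiated are often components of fields, which themselves depend on a chart. *)
Definition chart_diff E c (f : N -> E) x (a : 'rV[R]_n) : E :=
  'd (chart_rep c f) (chart_map c x) a.

Lemma chart_diff_lin E c (f : N -> E) x k a b :
  chart_diff c f x (k *: a + b) = k *: chart_diff c f x a + chart_diff c f x b.
Proof. exact: linearP. Qed.
Lemma chart_diffD E c (f : N -> E) x a b :
  chart_diff c f x (a + b) = chart_diff c f x a + chart_diff c f x b.
Proof. exact: linearD. Qed.
Lemma chart_diffB E c (f : N -> E) x a b :
  chart_diff c f x (a - b) = chart_diff c f x a - chart_diff c f x b.
Proof. exact: linearB. Qed.
Lemma chart_diff0 E c (f : N -> E) x : chart_diff c f x 0 = 0.
Proof. exact: linear0. Qed.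

Lemma chart_diff_change E (f : N -> E) c d x (w : tvec x) : chart_dom c x -> chart_dom d x ->
  smooth_pt f x -> chart_diff c f x (w c) = chart_diff d f x (w d).
Proof. by move=> cx dx sf; exact: diff_chart. Qed.

Lemma chart_diff_near_eq E (f g : N -> E) c x a : chart_dom c x -> smooth_pt f x ->
  (\near x, f x = g x) -> chart_diff c f x a = chart_diff c g x a.
Proof.
move=> cx sf fg; have df := smooth_pt_differentiable sf cx.
exact: near_eq_diffE (chart_rep_near_eq atN cx fg) df.
Qed.

Lemma chart_diff_cst E (k : E) c x a : chart_dom c x -> chart_diff c (fun=> k) x a = 0.
Proof.
move=> cx; rewrite /chart_diff -(@near_eq_diff _ _ _ (fun=> k)).
- exact: (congr1 (fun g => g a) (diff_cst _ _)).
- by apply: near_chartP atN _ _ _ _ cx (near_dom atN cx) _ => y cy _; rewrite chart_repE.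
- exact: differentiable_cst.
Qed.

Lemma chart_diff_fD E (f g : N -> E) c x a : chart_dom c x -> smooth_pt f x -> smooth_pt g x ->
  chart_diff c (fun y => f y + g y) x a = chart_diff c f x a + chart_diff c g x a.
Proof.
move=> cx sf sg; have df := smooth_pt_differentiable sf cx.
have dg := smooth_pt_differentiable sg cx.
have fg : \forall z \near chart_map c x, (chart_rep c f + chart_rep c g) z
    = chart_rep c (fun y => f y + g y) z.
  apply: (near_chartP atN cx (near_dom atN cx)) => y cy _.
  rewrite -[LHS]/(chart_rep c f (chart_map c y) + chart_rep c g (chart_map c y)).
  by rewrite !chart_repE.
apply: etrans (esym (near_eq_diffE a fg (differentiableD df dg))) _.
exact: (congr1 (fun g => g a) (diffD df dg)).
Qed.

Lemma chart_diff_fZ E (f : N -> R^o) (g : N -> E) c x a :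
  chart_dom c x -> smooth_pt f x -> smooth_pt g x ->
  chart_diff c (fun y => f y *: g y) x a = chart_diff c f x a *: g x + f x *: chart_diff c g x a.
Proof.
move=> cx sf sg; have df := smooth_pt_differentiable sf cx.
have dg := smooth_pt_differentiable sg cx.
have [dfg Hd] := is_diff_scaleb df dg.
have fg : \forall z \near chart_map c x, chart_rep c f z *: chart_rep c g z
    = chart_rep c (fun y => f y *: g y) z.
  by apply: (near_chartP atN cx (near_dom atN cx)) => y cy _; rewrite !chart_repE.
apply: etrans (esym (near_eq_diffE a fg dfg)) _.
by rewrite Hd !chart_repE.
Qed.

Lemma chart_diff_fsum E (I : Type) (r : seq I) (f : I -> N -> E) c x a : chart_dom c x ->
  (forall i, smooth_pt (f i) x) ->
  chart_diff c (fun y => \sum_(i <- r) f i y) x a = \sum_(i <- r) chart_diff c (f i) x a.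
Proof.
move=> cx sf; elim: r => [|i r IH].
  by rewrite big_nil; under eq_fun do rewrite big_nil; rewrite chart_diff_cst.
have sS : smooth_pt (fun y => \sum_(i <- r) f i y) x by exact: smooth_pt_sum.
rewrite big_cons -IH -(chart_diff_fD a cx (sf i) sS).
apply: (congr1 (fun h => chart_diff c h x a)).
by apply/funext => y; rewrite big_cons.
Qed.

Lemma chart_diff_coord m (f : N -> 'rV[R]_m) j c x a : chart_dom c x -> smooth_pt f x ->
  chart_diff c (fun y => f y 0 j : R^o) x a = chart_diff c f x a 0 j.
Proof.
move=> cx sf; have df := smooth_pt_differentiable sf cx.
have dL : differentiable (@coordL R m j) (chart_rep c f (chart_map c x)).
  by apply: linear_differentiable; exact: coordL_cont.
rewrite /chart_diff (@diff_near_comp _ _ _ _ (chart_rep c f) (@coordL R m j) _ _ _ _ erefl df dL).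
  by rewrite diff_lin //; exact: coordL_cont.
by apply: (near_chartP atN cx (near_dom atN cx)) => y cy _; rewrite !chart_repE.
Qed.

Lemma chart_diff_row m (f : N -> 'rV[R]_m) c x a : smooth_pt f x -> chart_dom c x ->
  chart_diff c f x a = \sum_j a 0 j *: 'D_(row_unit R j) (chart_rep c f) (chart_map c x).
Proof.
by move=> sf cx; rewrite /chart_diff diff_row_sum //; exact: smooth_pt_differentiable.
Qed.

Lemma smooth_chart_diff m (f : N -> 'rV[R]_m) (a : N -> 'rV[R]_n) c x : chart_dom c x ->
  smooth_pt f x -> smooth_pt a x -> (\near x, smooth_pt f x) ->
  smooth_pt (fun y => chart_diff c f y (a y)) x.
Proof.
move=> cx sf sa nsf.
apply: (@smooth_pt_near_eq _ _ _ atN _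
    (fun y => \sum_j a y 0 j *: 'D_(row_unit R j) (chart_rep c f) (chart_map c y))).
  have := near_dom atN cx; move: nsf; apply: filterS2 => y sfy cy.
  by rewrite chart_diff_row.
apply: smooth_pt_sum => // j; apply: smooth_ptZ => //; first exact: smooth_pt_coord.
apply: (smooth_pt_comp atN (F := fun z => 'D_(row_unit R j) (chart_rep c f) z)).
  by move=> k; have /CkS[_] := sf c cx k.+1; exact.
exact: smooth_pt_chart_map.
Qed.

Lemma chart_diff_comp m E (F : 'rV[R]_m -> E) (f : N -> 'rV[R]_m) c x a :
  chart_dom c x -> smooth_pt f x -> differentiable F (f x) ->
  chart_diff c (fun y => F (f y)) x a = 'd F (f x) (chart_diff c f x a).
Proof.
move=> cx sf dF; apply: diff_near_comp => //; first exact: chart_repE.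
  exact: smooth_pt_differentiable.
by apply: (near_chartP atN cx (near_dom atN cx)) => y cy _; rewrite !chart_repE.
Qed.

Lemma chart_diff_chart_map c x a : chart_dom c x -> chart_diff c (chart_map c) x a = a.
Proof.
move=> cx; have H := @diff_chart_map_comp _ _ N atN x _ c (fun z => z) cx.
have di : differentiable (fun z : 'rV[R]_n => z) (chart_map c x) by [].
apply: etrans (congr1 (fun g => g a) (H di)) _.
by have [_ ->] := is_diff_id (chart_map c x).
Qed.

Lemma chart_diff_row_mx m p (f : N -> 'rV[R]_m) (g : N -> 'rV[R]_p) c x a :
  chart_dom c x -> smooth_pt f x -> smooth_pt g x ->
  chart_diff c (fun y => row_mx (f y) (g y)) x a = row_mx (chart_diff c f x a) (chart_diff c g x a).
Proof.
move=> cx sf sg; have sfg := smooth_pt_row_mx atN sf sg.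
apply/rowP => i; rewrite -(chart_diff_coord i a cx sfg).
case: (split_ordP i) => k ->.
  rewrite row_mxEl -(chart_diff_coord k a cx sf).
  apply: (congr1 (fun h : N -> R^o => chart_diff c h x a)).
  by apply/funext => y; rewrite row_mxEl.
rewrite row_mxEr -(chart_diff_coord k a cx sg).
apply: (congr1 (fun h : N -> R^o => chart_diff c h x a)).
by apply/funext => y; rewrite row_mxEr.
Qed.

(* The second-order term by which the derivative of the components of a vector
   field fails to transform as a vector. *)
Definition chart_defect c d x (a b : 'rV[R]_n) : 'rV[R]_n :=
  \sum_j b 0 j *: chart_diff c (fun y => jacobian_row c d y j) x a.

(** The product rule for V^d = sum_j V^c_j J_j, with J_j the Jacobian rows: differentiating the
    coefficients gives the vectorial part, differentiating the rows gives the defect. *)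
Lemma chart_diff_field_change (V : forall x : N, tvec x) c d x (u : tvec x) :
  chart_dom c x -> chart_dom d x -> smooth_pt (fun y => V y c) x ->
  chart_diff d (fun y => V y d) x (u d) =
  'd (chart_rep c (chart_map d)) (chart_map c x) (chart_diff c (fun y => V y c) x (u c))
  + chart_defect c d x (u c) (V x c).
Proof.
move=> cx dx sV; have sVd := tvec_trans atN cx dx sV.
rewrite -(chart_diff_change u cx dx sVd).
have sj j : smooth_pt (fun y => jacobian_row c d y j) x by exact: smooth_jacobian_row.
have sVj j : smooth_pt (fun y => V y c 0 j : R^o) x by exact: smooth_pt_coord.
rewrite -(@chart_diff_near_eq _ (fun y => \sum_j (V y c) 0 j *: jacobian_row c d y j)) //.
- rewrite chart_diff_fsum // => [|j]; last exact: smooth_ptZ.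
  rewrite diff_row_sum; last exact: (smooth_pt_differentiable (smooth_pt_chart_map atN dx) cx).
  rewrite /chart_defect -big_split; apply: eq_bigr => j _.
  by rewrite chart_diff_fZ // chart_diff_coord.
- by apply: smooth_pt_sum => // j; exact: smooth_ptZ.
- have := near_dom atN cx; have := near_dom atN dx; apply: filterS2 => y dy cy.
  exact/esym/tcomp_jacobian_row.
Qed.

End ChartDerivative.

Lemma is_derive_line (R : realType) (V W : normedModType R) (g : V -> W) z e : differentiable g z ->
  is_derive (0 : R) (1 : R) (fun t : R => g (t *: e + z)) ('d g z e).
Proof.
move=> dg; have dg' : derivable g z e by exact: diff_derivable.
pose F (t : R) := g (t *: e + z).
have FE : (fun h : R => h^-1 *: ((F \o shift 0) (h *: 1) - F 0))
    = (fun h => h^-1 *: ((g \o shift z) (h *: e) - g z)).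
  by apply/funext => h; rewrite /F /= addr0 scale0r add0r [h *: 1]mulr1.
apply: DeriveDef; first by rewrite /derivable FE.
by rewrite -deriveE // /derive FE.
Qed.

(** * Derivatives of sections over [A], and fibre derivatives *)

Section AADerivative.
Variables (R : realType) (n : nat) (M : charted R n) (A : set (TM M)).
Hypotheses (Mm : is_manifold M) (A_open : open A).
Let atM := manifold_atlas Mm.
Let atA := subtangent_atlas atM A_open.
Notation AA := (subcharted A).
Implicit Types (c d : chart M) (v : AA).

Definition chart_diffA (E : normedModType R) c (f : AA -> E) v (a : 'rV[R]_(n + n)) : E :=
  @chart_diff R (n + n) AA E c f v a.

Lemma chart_diffA_pull (E : normedModType R) (f : M -> E) c v a : smooth_pt f (base v) ->
  chart_dom c (base v) ->
  chart_diffA c (fun u => f (base u)) v a = chart_diff c f (base v) (lsubmx a).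
Proof. by move=> sf cv; exact: (diff_pull atM A_open (f := f)). Qed.

Lemma chart_diffA_fib c v a : chart_dom c (base v) ->
  chart_diffA c (fun u : AA => fib u c) v a = rsubmx a.
Proof.
move=> cv; have dr : differentiable rsubmx (chart_map (c : chart AA) v).
  exact: (@differentiable_rsubmx R 1 n n).
have := @diff_chart_map_comp _ _ AA atA v _ c rsubmx cv dr.
rewrite /chart_diffA /chart_diff => H.
have -> : (fun u : AA => fib u c) = (fun u : AA => rsubmx (chart_map (c : chart AA) u)).
  by apply/funext => u; rewrite chart_map_pointE row_mxKr.
apply: etrans (congr1 (fun g => g a) H) _.
have cr : continuous (@rsubmx R 1 n n) by exact: continuous_rsubmx.
exact: (congr1 (fun g => g a) (diff_lin (chart_map (c : chart AA) v) cr)).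
Qed.

(** The Jacobian rows depend on the base point alone, so the defect sees only the base components of
    [xi]; it vanishes in vertical directions. *)
Lemma chart_diffA_section_change (Z : section A) c d v (xi : tvec v) :
  chart_dom c (base v) -> chart_dom d (base v) -> smooth_pt (fun u : AA => Z u c) v ->
  chart_diffA d (fun u => Z u d) v (xi d) =
  'd (chart_rep c (chart_map d)) (chart_map c (base v)) (chart_diffA c (fun u => Z u c) v (xi c))
  + chart_defect c d (base v) (lsubmx (xi c)) (Z v c).
Proof.
move=> cv dv sZ; have sZd := section_trans Mm A_open cv dv sZ.
rewrite /chart_diffA -(@chart_diff_change _ _ AA atA _ _ c d v xi cv dv sZd).
have sjM j : smooth_pt (fun y => jacobian_row c d y j) (base v) by exact: smooth_jacobian_row.
have sj j : smooth_pt (fun u : AA => jacobian_row c d (base u) j) v.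
  exact: (smooth_pull atM A_open (sjM j)).
have sZj j : smooth_pt (fun u : AA => Z u c 0 j : R^o) v by exact: smooth_pt_coord.
rewrite -(@chart_diff_near_eq _ _ AA atA _ (fun u : AA => \sum_j (Z u c) 0 j *: jacobian_row c d (base u) j)) //.
- rewrite chart_diff_fsum // => [|j]; last exact: smooth_ptZ.
  rewrite diff_row_sum; last exact: (smooth_pt_differentiable (smooth_pt_chart_map atM dv) cv).
  rewrite /chart_defect -big_split; apply: eq_bigr => j _.
  rewrite chart_diff_fZ // chart_diff_coord // -(chart_diffA_pull _ (sjM j) cv) //.
- by apply: smooth_pt_sum => // j; exact: smooth_ptZ.
- have := near_point_dom atM A_open cv; have := near_point_dom atM A_open dv; apply: filterS2 => u du cu.
  by rewrite (tcomp_jacobian_row atM (Z u) cu du).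
Qed.

Lemma smooth_fib_section : smooth_section (fun v : AA => fib v).
Proof.
apply/(smooth_sectionP Mm A_open) => v; have [c cv] := atlas_cover atM (base v).
by exists c => //; exact: smooth_fib.
Qed.

Lemma ext0_mk_point (Z : section A) (x : M) (w : tvec x) (Aw : A (mkTM w)) :
  ext0 Z (mkTM w) = Z (mk_point Aw).
Proof.
rewrite /ext0; case: pselect => // Aw'; rewrite /mk_point.
by rewrite (Prop_irrelevance Aw' Aw).
Qed.

Lemma mk_point_fib v (Av : A (mkTM (fib v))) : mk_point Av = v.
Proof. by apply: val_inj; case: v Av => -[x w] p. Qed.

(** The line v + t w stays in [A] for small t because [A] is open, so the value 0 of [ext0] outside
    [A] does not enter the derivative at 0. *)
Lemma vderivE (Z : section A) v (w : tvec (base v)) c : smooth_section Z ->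
  chart_dom c (base v) -> vderiv Z w c = chart_diffA c (fun u => Z u c) v (row_mx 0 (w c)).
Proof.
move=> sZ cv.
have sZc d : chart_dom d (base v) -> smooth_pt (fun u : AA => Z u d) v.
  exact: smooth_section_pt.
have H d : chart_dom d (base v) -> is_derive (0 : R) (1 : R)
    (fun t : R => ext0 Z (fib_shift (t *: w)) d) (chart_diffA d (fun u => Z u d) v (row_mx 0 (w d))).
  move=> dv.
  have dZ := smooth_pt_differentiable (sZc d dv) (dv : chart_dom (d : chart AA) v).
  apply: near_eq_is_derive (is_derive_line _ dZ).
  have [W oW AW] := A_open (d : chart (TM M)).
  have Wv : W (0 *: row_mx 0 (w d) + chart_map (d : chart AA) v).
    by rewrite scale0r add0r; apply/(AW (val v) dv); exact: set_mem (valP v).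
  have ct : {for (0 : R), continuous (fun t : R => t *: row_mx 0 (w d) + chart_map (d : chart AA) v)}.
    by apply: cvgD; [exact: scalel_continuous|exact: cvg_cst].
  have nW : \forall t \near (0 : R), W (t *: row_mx 0 (w d) + chart_map (d : chart AA) v).
    exact: ct _ (open_nbhs_nbhs (conj oW Wv)).
  move: nW; apply: filterS => t Wt.
  have tE : t *: row_mx 0 (w d) + row_mx (chart_map d (base v)) (fib v d)
      = row_mx (chart_map d (base v)) ((fib v + t *: w) d).
    by rewrite scale_row_mx add_row_mx scaler0 add0r tcompD tcompZ addrC.
  have At : A (mkTM (fib v + t *: w)).
    by apply/(AW (mkTM (fib v + t *: w)) dv); rewrite /= -tE.
  rewrite /fib_shift ext0_mk_point.
  rewrite (_ : t *: _ + _ = chart_map (d : chart AA) (mk_point At)); last exact: tE.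
  by rewrite (point_chart_repE atM).
(* The candidate is prescribed in the chart [c]; it has the right components in the other charts
   because a vertical direction produces no defect. *)
have [u0 u0c] := tvec_exists atM (chart_diffA c (fun u => Z u c) v (row_mx 0 (w c))) cv.
have u0E d : chart_dom d (base v) -> u0 d = chart_diffA d (fun u => Z u d) v (row_mx 0 (w d)).
  move=> dv; rewrite -!(vliftE atM A_open w) //.
  rewrite (chart_diffA_section_change (vlift w) cv dv (sZc c cv)).
  rewrite !(vliftE atM A_open w cv) // row_mxKl -u0c -tcompE //.
  by rewrite /chart_defect big1 ?addr0 // => j _; rewrite chart_diff0 scaler0.
rewrite /vderiv (@xget_unique _ _ _ u0) //.
  by move=> d dv; rewrite u0E //; exact: H.
move=> u Hu; apply: (tvec_eq cv); rewrite u0c.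
by have [_ <-] := Hu c cv; have [_ ->] := H c cv.
Qed.

(** The extension has constant components in a chart; it stays in [A] near [base v] because [A] is
    open. *)
Lemma local_extension_exists v : exists V, local_extension v V.
Proof.
have [c cv] := atlas_cover atM (base v); pose V y := vector_of c y (fib v c).
have VE y : chart_dom c y -> V y c = fib v c by move=> cy; rewrite /V vector_ofE.
have [W oW AW] := A_open (c : chart (TM M)).
pose O := [set y | chart_dom c y /\ W (row_mx (chart_map c y) (fib v c))].
have oO : open (O : set M).
  rewrite openE => y [cy Wy]; have [B [oB By BW]] : exists B : set 'rV[R]_n,
      [/\ open B, B (chart_map c y) & forall z, B z -> W (row_mx z (fib v c))].
    exists ((fun z => row_mx z (fib v c)) @^-1` W); split => //.
    apply: open_comp => // z _; apply: (@smooth_at_cont R n _ (fun z => row_mx z (fib v c))) => k.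
    by apply: Ck_row_mx; [exact: Ck_id|exact: Ck_cst].
  have nB := near_chart_map atM cy (open_nbhs_nbhs (conj oB By)).
  have := near_dom atM cy; move: nB; apply: filterS2 => z Bz cz.
  by split => //; exact: BW.
exists V; split; first by apply: (tvec_eq cv); rewrite VE.
exists O; split => //.
- split => //; apply/(AW (val v) cv); exact: set_mem (valP v).
- move=> d; apply/(smooth_inP atM d _ oO) => y [cy _] dy; apply: (tvec_trans atM cy dy).
  apply: (@smooth_pt_near_eq _ _ _ atM _ (fun=> fib v c)); last exact: smooth_pt_cst.
  by have := near_dom atM cy; apply: filterS => z cz; rewrite VE.
- by move=> y [cy Wy]; apply/(AW (mkTM (V y)) cy); rewrite /= VE.
Qed.

End AADerivative.

(** * Anisotropic connections in charts *)

Section Hat.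
Variables (R : realType) (n : nat) (M : charted R n) (A : set (TM M)).
Hypotheses (Mm : is_manifold M) (A_open : open A).
Let atM := manifold_atlas Mm.
Let atA := subtangent_atlas atM A_open.
Notation AA := (subcharted A).
Implicit Types (c d : chart M) (v : AA).
Variable hat : aniso_op A.
Hypothesis hh : is_aniso_connection hat.

Lemma hat_pointwise v X X' Y : smooth_field X -> smooth_field X' -> smooth_field Y ->
  X (base v) = X' (base v) -> hat v X Y = hat v X' Y.
Proof.
move=> sX sX' sY; apply: (pointwise_field Mm (F := fun X => hat v X Y) (x := base v)) => //.
  by move=> *; exact: hat_addl.
by move=> *; exact: hat_scalel.
Qed.

(* [hat v X] minus its principal part in the chart [c]; it is linear over the
   smooth functions, hence pointwise in [Y]. *)
Definition hat0 c v (X Y : vfield M) : 'rV[R]_n :=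
  hat v X Y c - chart_diff c (fun y => Y y c) (base v) (X (base v) c).

Lemma hat0_add c v X Y Y' : chart_dom c (base v) -> smooth_field X -> smooth_field Y ->
  smooth_field Y' -> hat0 c v X (fun y => Y y + Y' y) = hat0 c v X Y + hat0 c v X Y'.
Proof.
move=> cv sX sY sY'; rewrite /hat0 (hat_addr hh) // tcompD.
rewrite (_ : (fun y => (Y y + Y' y) c) = (fun y => Y y c + Y' y c)) //.
rewrite chart_diff_fD //; try exact: (smooth_field_pt Mm).
by rewrite opprD addrACA.
Qed.

Lemma hat0_scale c v f X Y : chart_dom c (base v) -> smooth_fun f -> smooth_field X ->
  smooth_field Y -> hat0 c v X (fun y => f y *: Y y) = f (base v) *: hat0 c v X Y.
Proof.
move=> cv sf sX sY; rewrite /hat0 (hat_leibniz hh) // tcompD !tcompZ.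
have sf' := (smooth_funP atM f).1 sf (base v).
rewrite (_ : (fun y => (f y *: Y y) c) = (fun y => (f y : R^o) *: Y y c)) //.
rewrite (chart_diff_fZ atM) //; last exact: (smooth_field_pt Mm).
by rewrite (dfunE atM _ sf' cv) opprD addrACA subrr add0r scalerBr.
Qed.

Lemma hat0_pointwise c v X Y Y' : chart_dom c (base v) -> smooth_field X -> smooth_field Y ->
  smooth_field Y' -> Y (base v) = Y' (base v) -> hat0 c v X Y = hat0 c v X Y'.
Proof.
move=> cv sX; apply: (pointwise_field Mm (F := fun Y => hat0 c v X Y) (x := base v)).
  by move=> *; exact: hat0_add.
by move=> *; exact: hat0_scale.
Qed.

(** [hat0] depends on [Y] only through its value and the principal part only through its germ. This
    is what makes [hat_loc] independent of the global extensions. *)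
Lemma hat_germ v X X' Y Y' : smooth_field X -> smooth_field X' -> smooth_field Y ->
  smooth_field Y' -> X (base v) = X' (base v) -> (\forall y \near base v, Y y = Y' y) ->
  hat v X Y = hat v X' Y'.
Proof.
move=> sX sX' sY sY' XX' YY'; rewrite (hat_pointwise sX sX' sY XX').
have [c cv] := atlas_cover atM (base v); apply: (tvec_eq cv).
have := hat0_pointwise cv sX' sY sY' (nbhs_singleton YY'); rewrite /hat0.
rewrite (@chart_diff_near_eq _ _ _ atM _ (fun y => Y y c) (fun y => Y' y c)) //.
- exact: addIr.
- exact: (smooth_field_pt Mm).
- by move: YY'; apply: filterS => y ->.
Qed.

Lemma hat_loc_global v X Y Y' (u : tvec (base v)) : smooth_field X -> smooth_field Y' ->
  X (base v) = u -> (\forall y \near base v, Y' y = Y y) -> hat_loc hat u Y = hat v X Y'.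
Proof.
move=> sX sY' Xu Y'Y; apply: xget_unique; first by exists X, Y'.
move=> w [X1 [Y1 [sX1 sY1 X1u Y1Y ->]]]; apply: hat_germ => //; first by rewrite X1u.
by move: Y'Y Y1Y; apply: filterS2 => y -> ->.
Qed.

Lemma christoffel_global c v X Y i j k : chart_dom c (base v) -> smooth_field X -> smooth_field Y ->
  X (base v) c = delta_mx 0 j -> (\forall y \near base v, Y y c = delta_mx 0 k) ->
  christoffel hat c v i j k = hat v X Y c 0 i.
Proof.
move=> cv sX sY Xj Yk; rewrite /christoffel (@hat_loc_global v X _ Y) //.
  by apply: (tvec_eq cv); rewrite Xj vector_ofE.
have := near_dom atM cv; move: Yk; apply: filterS2 => y Yy cy.
by apply: (tvec_eq cy); rewrite Yy vector_ofE.
Qed.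

Definition hat_gamma c v (a b : 'rV[R]_n) : 'rV[R]_n :=
  \sum_j \sum_k (a 0 j * b 0 k) *: \row_i christoffel hat c v i j k.

Lemma hat_gamma_linl c v b k a a' :
  hat_gamma c v (k *: a + a') b = k *: hat_gamma c v a b + hat_gamma c v a' b.
Proof.
rewrite /hat_gamma scaler_sumr -big_split; apply: eq_bigr => i _.
rewrite scaler_sumr -big_split; apply: eq_bigr => j _.
by rewrite !mxE mulrDl scalerDl scalerA mulrA.
Qed.

Lemma hat_gamma_linr c v a k b b' :
  hat_gamma c v a (k *: b + b') = k *: hat_gamma c v a b + hat_gamma c v a b'.
Proof.
rewrite /hat_gamma scaler_sumr -big_split; apply: eq_bigr => i _.
rewrite scaler_sumr -big_split; apply: eq_bigr => j _.
by rewrite !mxE mulrDr scalerDl scalerA mulrCA.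
Qed.

Lemma hat_gamma0l c v b : hat_gamma c v 0 b = 0.
Proof. by rewrite /hat_gamma big1 // => i _; rewrite big1 // => j _; rewrite mxE mul0r scale0r. Qed.

(** The relation between N and Gamma as an identity of linear maps; through it the transformation
    rule of [hat_gamma] applies to the horizontal spaces. *)
Lemma hat_gamma_fib c v a : hat_gamma c v a (fib v c) = a *m hat_coef hat c v.
Proof.
apply/rowP => i; rewrite mxE /hat_gamma summxE; apply: eq_bigr => l _.
rewrite summxE !mxE mulr_sumr; apply: eq_bigr => k _.
by rewrite !mxE mulrA.
Qed.

Lemma smooth_fieldZc (k : R) (X : vfield M) : smooth_field X -> smooth_field (fun x => k *: X x).
Proof. by move=> sX; apply: smooth_fieldZ => //; exact: smooth_fun_cst. Qed.

Lemma smooth_field_sum (I : Type) (r : seq I) (X : I -> vfield M) :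
  (forall i, smooth_field (X i)) -> smooth_field (fun x => \sum_(i <- r) X i x).
Proof.
by apply: (@smooth_sec_sum _ _ _ _ _ (fun (x : M) (w : tvec x) (c : chart M) => w c)) => // x; exact: tvec_trans.
Qed.

Lemma field_sum (L : lmodType R) (F : vfield M -> L) x (I : Type) (r : seq I) (X : I -> vfield M) :
  (forall X Y, smooth_field X -> smooth_field Y -> F (fun y => X y + Y y) = F X + F Y) ->
  (forall f X, smooth_fun f -> smooth_field X -> F (fun y => f y *: X y) = f x *: F X) ->
  (forall i, smooth_field (X i)) ->
  F (fun x => \sum_(i <- r) X i x) = \sum_(i <- r) F (X i).
Proof.
move=> FD FZ; apply: (@pointwise_sum _ _ _ _ _ (fun (x : M) (w : tvec x) (c : chart M) => w c) _ _ _ _ _ x) => //.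
by move=> s x0 c d; exact: tvec_trans.
Qed.

(** Both fields are replaced by constant combinations of global fields that are coordinate fields
    near [base v]. On these [hat0] equals [hat], since their components have zero derivative, and
    the Christoffel symbols appear. *)
Lemma hatE c v X Y : chart_dom c (base v) -> smooth_field X -> smooth_field Y ->
  hat v X Y c = chart_diff c (fun y => Y y c) (base v) (X (base v) c)
                + hat_gamma c v (X (base v) c) (Y (base v) c).
Proof.
move=> cv sX sY.
have /choice[E HE] : forall i, exists E : vfield M, smooth_field E /\
    \forall y \near base v, E y c = delta_mx 0 i.
  by move=> i; have [E ? ?] := frame_field Mm (delta_mx 0 i) cv; exists E.
have sE i : smooth_field (E i) by case: (HE i).
have nE i : \forall y \near base v, E i y c = delta_mx 0 i by case: (HE i).
set a := X (base v) c; set b := Y (base v) c.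
pose Xf x := \sum_j a 0 j *: E j x; pose Yf x := \sum_k b 0 k *: E k x.
have sXf : smooth_field Xf by apply: smooth_field_sum => j; exact: smooth_fieldZc.
have sYf : smooth_field Yf by apply: smooth_field_sum => j; exact: smooth_fieldZc.
have Xv : X (base v) = Xf (base v).
  apply: (tvec_eq cv); rewrite /Xf tcomp_sum -/a [LHS]row_sum_delta.
  by apply: eq_bigr => j _; rewrite tcompZ (nbhs_singleton (nE j)).
have Yv : Y (base v) = Yf (base v).
  apply: (tvec_eq cv); rewrite /Yf tcomp_sum -/b [LHS]row_sum_delta.
  by apply: eq_bigr => j _; rewrite tcompZ (nbhs_singleton (nE j)).
suff H : hat0 c v X Y = hat_gamma c v a b by rewrite -H /hat0 addrC subrK.
rewrite (hat0_pointwise cv sX sY sYf Yv).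
rewrite /Yf (field_sum (F := fun Y => hat0 c v X Y) (x := base v)).
- rewrite /hat_gamma exchange_big; apply: eq_bigr => k _.
  rewrite (hat0_scale cv (f := fun=> b 0 k)) //; last exact: smooth_fun_cst.
  have -> : hat0 c v X (E k) = hat v X (E k) c.
    rewrite /hat0 -(@chart_diff_near_eq _ _ _ atM _ (fun=> delta_mx 0 k)) //.
    + by rewrite chart_diff_cst // subr0.
    + exact: smooth_pt_cst.
    + by move: (nE k); apply: filterS => y ->.
  rewrite (hat_pointwise sX sXf (sE k) Xv).
  rewrite /Xf (field_sum (F := fun X => hat v X (E k)) (x := base v)).
  + rewrite tcomp_sum scaler_sumr; apply: eq_bigr => j _.
    rewrite (@hat_scalel _ _ _ _ _ hh v (fun=> a 0 j) (E j) (E k) (smooth_fun_cst _ atM) (sE j) (sE k)).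
    rewrite tcompZ scalerA mulrC; congr (_ *: _); apply/rowP => i.
    by rewrite mxE (@christoffel_global c v (E j) (E k)) // (nbhs_singleton (nE j)).
  + by move=> *; exact: hat_addl.
  + by move=> *; exact: hat_scalel.
  + by move=> j; exact: smooth_fieldZc.
- by move=> *; exact: hat0_add.
- by move=> *; exact: hat0_scale.
- by move=> j; exact: smooth_fieldZc.
Qed.

Lemma hat_locE c v (u : tvec (base v)) (Y : vfield M) : chart_dom c (base v) ->
  (\forall y \near base v, forall d, chart_dom d y -> smooth_pt (fun y => Y y d) y) ->
  hat_loc hat u Y c = chart_diff c (fun y => Y y c) (base v) (u c) + hat_gamma c v (u c) (Y (base v) c).
Proof.
move=> cv nY; have [Y' sY' Y'Y] := extend_field Mm nY.
have [X sX Xu] := field_exists Mm u.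
rewrite (hat_loc_global sX sY' Xu Y'Y) hatE // Xu (nbhs_singleton Y'Y).
rewrite (@chart_diff_near_eq _ _ _ atM _ (fun y => Y' y c) (fun y => Y y c) c) //.
  exact: (smooth_field_pt Mm).
by move: Y'Y; apply: filterS => y ->.
Qed.

(** The classical transformation rule of Christoffel symbols, obtained by writing the vector
    [hat v X Y] in two charts with [hatE] and cancelling the transformed derivative of [Y]. *)
Lemma hat_gamma_change c d v (u w : tvec (base v)) : chart_dom c (base v) -> chart_dom d (base v) ->
  'd (chart_rep c (chart_map d)) (chart_map c (base v)) (hat_gamma c v (u c) (w c))
  = chart_defect c d (base v) (u c) (w c) + hat_gamma d v (u d) (w d).
Proof.
move=> cv dv; have [X sX Xu] := field_exists Mm u; have [Y sY Yw] := field_exists Mm w.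
have := tcompE (hat v X Y) cv dv; rewrite !hatE // Xu Yw linearD /=.
rewrite (chart_diff_field_change atM u cv dv); last exact: (smooth_field_pt Mm).
by rewrite Yw -addrA => /addrI.
Qed.

(* The second-order terms in the transformation rules of [hat_gamma] and of the fibre
   components of [xi] cancel. *)
Lemma vertical_form_exists v (xi : tvec v) : exists w : tvec (base v),
  forall c, chart_dom c (base v) ->
    w c = rsubmx (xi c) + lsubmx (xi c) *m hat_coef hat c v.
Proof.
have [c cv] := atlas_cover atM (base v).
have [w wc] := tvec_exists atM (rsubmx (xi c) + lsubmx (xi c) *m hat_coef hat c v) cv.
exists w => d dv; rewrite (tcompE w cv dv) wc linearD /= -!hat_gamma_fib.
have := hat_gamma_change (dmap (@base R n M A) xi) (fib v) cv dv.
rewrite !dmap_baseE // => ->; rewrite addrA; congr (_ + _).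
rewrite -(chart_diffA_fib Mm A_open (xi d) dv) -(chart_diffA_fib Mm A_open (xi c) cv).
by rewrite (chart_diffA_section_change Mm A_open (Z := fun v => fib v) xi cv dv) //; exact: smooth_fib.
Qed.

(** [hat_horizontal] asks for its condition in every chart. The condition says that a tangent vector
    of [M], the one of [vertical_form_exists], is zero, so one chart decides. *)
Lemma hat_horizP v (xi : tvec v) c : chart_dom c (base v) ->
  hat_horizontal hat v xi <-> rsubmx (xi c) = - (lsubmx (xi c) *m hat_coef hat c v).
Proof.
move=> cv; have [w wE] := vertical_form_exists xi.
split=> [/(_ c cv)/spanned_byP //|H d dv]; apply/spanned_byP.
have w0 : w = 0 by apply: (tvec_eq cv); rewrite wE // H addNr.
by have := wE d dv; rewrite w0 => /esym/eqP; rewrite addr_eq0 => /eqP.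
Qed.

Lemma hat_horizontal_span v c : chart_dom c (base v) ->
  hat_horizontal hat v = spanned_by c (hat_coef hat c v).
Proof.
move=> cv; apply/seteqP; split=> xi.
  by move=> /(hat_horizP xi cv) H; apply/spanned_byP.
by move=> /spanned_byP H; apply/(hat_horizP xi cv).
Qed.

Lemma nonlin_coef_hat v c : chart_dom c (base v) ->
  nonlin_coef (hat_horizontal hat) c v = hat_coef hat c v.
Proof.
move=> cv; apply: xget_unique; first exact: hat_horizontal_span.
move=> N; rewrite /= (hat_horizontal_span cv) => /esym.
exact: (spanned_by_inj Mm A_open).
Qed.

Lemma smooth_christoffel c v i j k : chart_dom c (base v) ->
  smooth_pt (fun u : AA => christoffel hat c u i j k : R^o) v.
Proof.
move=> cv; have [X sX Xj] := frame_field Mm (delta_mx 0 j) cv.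
have [Y sY Yk] := frame_field Mm (delta_mx 0 k) cv.
apply: (@smooth_pt_near_eq _ _ _ atA _ (fun u => hat u X Y c 0 i : R^o)).
  have := near_point_dom atM A_open cv; have := near_base Mm A_open Xj.
  (* [nbhs_interior] is used because the components of [Y] must be constant near the base point of
     each [u] close to [v], not merely at that point. *)
  have := near_base Mm A_open (nbhs_interior Yk); apply: filterS3 => u Yu Xu cu.
  by rewrite (@christoffel_global c u X Y).
apply: smooth_pt_coord => //.
exact: (smooth_section_pt Mm A_open (hat_smooth hh sX sY)).
Qed.

Lemma hat_horizontal_is_horizontal : is_horizontal (hat_horizontal hat).
Proof.
split=> [v|v k xi eta Hx He|v xi Hx vx|v xi|c v cv|c k l].
- have [c cv] := atlas_cover atM (base v); apply/(hat_horizP _ cv).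
  by rewrite tcomp_0 !linear0 mul0mx oppr0.
- have [c cv] := atlas_cover atM (base v).
  move: Hx He => /(hat_horizP _ cv) Hx /(hat_horizP _ cv) He; apply/(hat_horizP _ cv).
  rewrite (_ : (k *: xi + eta) c = k *: xi c + eta c) //.
  by rewrite !linearP /= Hx He mulmxDl opprD -scalemxAl scalerN.
- have [c cv] := atlas_cover atM (base v).
  move: Hx vx => /(hat_horizP _ cv) Hx /(verticalP atM A_open _ cv) vx.
  apply: (tvecA_eq cv); rewrite -[LHS]hsubmxK Hx vx mul0mx oppr0.
  exact: row_mx0.
- have [c cv] := atlas_cover atM (base v).
  have [zeta zc] := tvecA_exists Mm A_open
    (row_mx (lsubmx (xi c)) (- (lsubmx (xi c) *m hat_coef hat c v))) cv.
  exists (xi - zeta), zeta; split; last by rewrite subrK.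
    apply/(verticalP atM A_open _ cv); rewrite (_ : (xi - zeta) c = xi c - zeta c) //.
    by rewrite linearB /= zc row_mxKl subrr.
  by apply/(hat_horizP _ cv); rewrite zc row_mxKl row_mxKr.
- by rewrite nonlin_coef_hat // -hat_horizontal_span.
- apply/(smooth_inP atA _ _ openT) => v _ cv.
  apply: (@smooth_pt_near_eq _ _ _ atA _
      (fun u : AA => \sum_j (fib u c 0 j * christoffel hat c u k l j) : R^o)).
    have := near_point_dom atM A_open (cv : chart_dom (c : chart M) (base v)).
    by apply: filterS => u cu; rewrite nonlin_coef_hat // mxE.
  apply: smooth_pt_sum => // j; apply: smooth_ptM => //; last exact: smooth_christoffel.
  by apply: smooth_pt_coord => //; exact: smooth_fib.
Qed.

(** In natural charts [V] is the map x |-> (x, V(x)), so the formula is the chain rule. The vector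
    [w] is kept apart from [V y] so that the point of [A] can be given independently of [V]. *)
Lemma smooth_comp_field (Z : section A) (V : vfield M) c y w
    (Ay : A (mkTM w)) : smooth_section Z -> V y = w ->
  (\forall z \near y, A (mkTM (V z))) -> chart_dom c y -> smooth_pt (fun z => V z c) y ->
  smooth_pt (fun z => comp_field Z V z c) y /\
  forall a, chart_diff c (fun z => comp_field Z V z c) y a
    = chart_diffA c (fun u => Z u c) (mk_point Ay) (row_mx a (chart_diff c (fun z => V z c) y a)).
Proof.
move=> sZ Vy nA cy sV; subst w.
have sZc := smooth_section_pt Mm A_open sZ (cy : chart_dom c (base (mk_point Ay))).
have mapE : chart_map (c : chart AA) (mk_point Ay) = row_mx (chart_map c y) (V y c) by [].
pose G z := chart_rep (c : chart AA) (fun u : AA => Z u c) z.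
have sF : smooth_pt (fun z => row_mx (chart_map c z) (V z c)) y.
  by apply: smooth_pt_row_mx => //; exact: smooth_pt_chart_map.
have E : \near y, G (row_mx (chart_map c y) (V y c)) = comp_field Z V y c.
  have := near_dom atM cy; move: nA; apply: filterS2 => z Az cz.
  rewrite /comp_field ext0_mk_point /G.
  rewrite (_ : row_mx _ _ = chart_map (c : chart AA) (mk_point Az)) //.
  by rewrite (point_chart_repE atM).
split.
  apply: smooth_pt_near_eq E _ => //; apply: smooth_pt_comp => //.
  by rewrite -mapE; exact: sZc.
move=> a; rewrite -(chart_diff_near_eq atM a cy _ E); last first.
  by apply: smooth_pt_comp => //; rewrite -mapE; exact: sZc.
rewrite chart_diff_comp //; last first.
  by rewrite -mapE; exact: (smooth_pt_differentiable sZc (cy : chart_dom (c : chart AA) (mk_point Ay))).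
rewrite chart_diff_row_mx //; last exact: smooth_pt_chart_map.
by rewrite chart_diff_chart_map // -mapE.
Qed.

Lemma ext0_fib (Z : section A) v : ext0 Z (mkTM (fib v)) = Z v.
Proof.
case: v => -[x w] p; rewrite /ext0 /=; case: pselect => [a|na].
  by have -> : p = mem_set a by exact: bool_irrelevance.
by case: na; exact: set_mem p.
Qed.

(** After the cancellation, the term Gamma(u, v) of [hat_loc hat u V] remains with a minus sign in
    the fibre direction; the derivative of [Z] is thus taken along the horizontal lift of [u]. *)
Lemma hat_extE (Z : section A) c v (u : tvec (base v)) : smooth_section Z ->
  chart_dom c (base v) ->
  hat_ext hat u Z c = chart_diffA c (fun u => Z u c) v (row_mx (u c) (- (u c *m hat_coef hat c v)))
    + hat_gamma c v (u c) (Z v c).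
Proof.
move=> sZ cv.
have H V : local_extension v V ->
    (hat_loc hat u (comp_field Z V) - vderiv Z (hat_loc hat u V)) c
    = chart_diffA c (fun u => Z u c) v (row_mx (u c) (- (u c *m hat_coef hat c v)))
      + hat_gamma c v (u c) (Z v c).
  move=> [Vv [U [oO Ov sV AV]]].
  have nO : \forall y \near base v, U y by apply: open_nbhs_nbhs.
  have sVd y d : U y -> chart_dom d y -> smooth_pt (fun y => V y d) y.
    by move=> Oy dy; exact: (smooth_inP atM d _ oO).1 (sV d) y Oy dy.
  have nV : \forall y \near base v, forall d, chart_dom d y -> smooth_pt (fun y => V y d) y.
    by move: nO; apply: filterS => y Oy d; exact: sVd.
  have nA y : U y -> \forall z \near y, A (mkTM (V z)).
    by move=> Oy; have := open_nbhs_nbhs (conj oO Oy); apply: filterS.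
  have Av : A (mkTM (fib v)) by rewrite -Vv; exact: AV.
  have [_ dE] := smooth_comp_field Av sZ Vv (nA _ Ov) cv (sVd _ _ Ov cv).
  have nc : \forall y \near base v, forall d, chart_dom d y ->
      smooth_pt (fun y => comp_field Z V y d) y.
    move: nO; apply: filterS => y Oy d dy.
    by have [] := smooth_comp_field (AV _ Oy) sZ erefl (nA _ Oy) dy (sVd _ _ Oy dy).
  rewrite tcompB hat_locE // vderivE // hat_locE // dE mk_point_fib Vv.
  rewrite /comp_field [ext0 Z _](_ : _ = Z v); last first.
    by rewrite Vv ext0_fib.
  rewrite hat_gamma_fib addrAC -[X in X + _ = _](chart_diffB (N := AA)); congr (chart_diffA _ _ _ _ + _).
  by rewrite opp_row_mx add_row_mx subr0 opprD addrA subrr add0r.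
(* [hat_ext] selects a value given by some extension; one exists, and by [H] all extensions give the
   same components. *)
have [V lV] := local_extension_exists Mm A_open v.
have Pex : exists w, [set w | exists2 V, local_extension v V &
    w = hat_loc hat u (comp_field Z V) - vderiv Z (hat_loc hat u V)] w.
  by exists (hat_loc hat u (comp_field Z V) - vderiv Z (hat_loc hat u V)); exists V.
have [V' lV' E] := xgetPex 0 Pex.
by rewrite /hat_ext E H.
Qed.

End Hat.

(** * The constructed connection *)

Section Built.
Variables (R : realType) (n : nat) (M : charted R n) (A : set (TM M)).
Hypotheses (Mm : is_manifold M) (A_open : open A).
Let atM := manifold_atlas Mm.
Let atA := subtangent_atlas atM A_open.
Notation AA := (subcharted A).
Implicit Types (c d : chart M) (v : AA).
Variables (hat : aniso_op A)
  (C : forall v : AA, tvec (base v) -> tvec (base v) -> tvec (base v)).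
Hypotheses (hh : is_aniso_connection hat) (hC : is_tensor12 C).
Let Hc := hat_horizontal hat.
Let hHc : is_horizontal Hc := hat_horizontal_is_horizontal Mm A_open hh.

Lemma vpart_hatE v (xi : tvec v) c : chart_dom c (base v) ->
  vpart Hc xi c = row_mx 0 (rsubmx (xi c) + lsubmx (xi c) *m hat_coef hat c v).
Proof.
move=> cv; have [eta ec] := tvecA_exists Mm A_open
  (row_mx 0 (rsubmx (xi c) + lsubmx (xi c) *m hat_coef hat c v)) cv.
have HE (z : tvec v) : vertical v z -> Hc (xi - z) <-> z c = eta c.
  move=> /(verticalP atM A_open _ cv) z0; rewrite /Hc (hat_horizP Mm A_open hh _ cv).
  rewrite (_ : (xi - z) c = xi c - z c) // !linearB /= z0 subr0 ec.
  rewrite -[z c]hsubmxK z0 row_mxKr; split=> [H|/eq_row_mx[_ ->]].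
    by congr row_mx; rewrite -[lsubmx _ *m _]opprK -H opprB addrC subrK.
  by rewrite opprD addrA subrr add0r.
rewrite /vpart (@xget_unique _ _ _ eta) //.
  have ve : vertical v eta by apply/(verticalP atM A_open _ cv); rewrite ec row_mxKl.
  by split => //; exact/(HE eta ve).
by move=> z [vz /(HE z vz) zE]; exact: (tvecA_eq cv).
Qed.

Lemma vpart_hat_vertical v (xi : tvec v) : vertical v (vpart Hc xi).
Proof.
have [c cv] := atlas_cover atM (base v); apply/(verticalP atM A_open _ cv).
by rewrite vpart_hatE // row_mxKl.
Qed.

Lemma dmap_hpart_hat v (xi : tvec v) :
  dmap (@base R n M A) (hpart Hc xi) = dmap (@base R n M A) xi.
Proof.
have Pex : exists z, [set zeta | Hc zeta /\ vertical v (xi - zeta)] z.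
  by have [eta [zeta [ve Hz ->]]] := horiz_sum hHc xi; exists zeta; rewrite /= addrK.
have [_ /=] := xgetPex 0 Pex; rewrite -/(hpart Hc xi) => vz.
have := dmap_base_lin Mm A_open 1 (xi - hpart Hc xi) (hpart Hc xi).
by rewrite !scale1r subrK => ->; rewrite [X in X + _]vz add0r.
Qed.

(* The vertical part of [xi], read in the tangent space at [base v]: its
   components are [xi^(n+k) + N^k_l xi^l]. *)
Definition vertical_form v (xi : tvec v) : tvec (base v) := vlift_inv (vpart Hc xi).

Lemma vertical_formE v (xi : tvec v) c : chart_dom c (base v) ->
  vertical_form xi c = rsubmx (xi c) + lsubmx (xi c) *m hat_coef hat c v.
Proof.
move=> cv; rewrite /vertical_form (vlift_invE atM A_open cv (vpart_hat_vertical xi)).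
by rewrite vpart_hatE // row_mxKr.
Qed.

Lemma vertical_form_lin v k (xi eta : tvec v) :
  vertical_form (k *: xi + eta) = k *: vertical_form xi + vertical_form eta.
Proof.
have [c cv] := atlas_cover atM (base v); apply: (tvec_eq cv).
have xE : (k *: xi + eta) c = k *: xi c + eta c by [].
have E := vertical_formE (k *: xi + eta) cv; rewrite xE in E; apply: etrans E _; apply/esym.
apply: etrans (congr2 (fun a b => k *: a + b) (vertical_formE xi cv) (vertical_formE eta cv)) _.
by rewrite !linearP /= mulmxDl -scalemxAl scalerDr addrACA.
Qed.

(** The fibre derivative along the vertical part and the derivative along the horizontal part add up
    to the derivative along [xi]: the two occurrences of [hat_coef] cancel. *)
Lemma built_connectionE (xi : vfieldA A) (Z : section A) v c : smooth_section Z ->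
  chart_dom c (base v) ->
  built_connection hat C xi Z v c = chart_diffA c (fun u => Z u c) v (xi v c)
    + C (vertical_form (xi v)) (Z v) c + hat_gamma hat c v (lsubmx (xi v c)) (Z v c).
Proof.
move=> sZ cv; rewrite /built_connection -/Hc -/(vertical_form (xi v)) !tcompD.
rewrite (vderivE Mm A_open _ sZ cv) (hat_extE Mm A_open hh _ sZ cv) dmap_hpart_hat.
rewrite (dmap_baseE atM A_open (xi v) cv) addrA; congr (_ + _).
rewrite addrAC; congr (_ + _).
rewrite -[LHS](chart_diffD (N := AA)) /chart_diffA; congr (chart_diff _ _ _ _).
rewrite add_row_mx add0r (vertical_formE _ cv) addrK.
exact: hsubmxK.
Qed.

(** [is_tensor12] states smoothness on pairs of coordinate vectors; this expansion transfers it to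
    [C] applied to arbitrary smooth arguments. *)
Lemma tensorE v (u w : tvec (base v)) c : chart_dom c (base v) ->
  C u w c = \sum_j \sum_k (u c 0 j * w c 0 k) *:
    C (coord_field c j (base v)) (coord_field c k (base v)) c.
Proof.
move=> cv; have CDl u1 u2 w' : C (u1 + u2) w' = C u1 w' + C u2 w'.
  by have := tensor_linl hC w' 1 u1 u2; rewrite !scale1r.
have CDr u' w1 w2 : C u' (w1 + w2) = C u' w1 + C u' w2.
  by have := tensor_linr hC u' 1 w1 w2; rewrite !scale1r.
have C0l w' : @C v 0 w' = 0 by apply: (addrI (C 0 w')); rewrite -CDl !addr0.
have C0r u' : @C v u' 0 = 0 by apply: (addrI (C u' 0)); rewrite -CDr !addr0.
have CZl a u' w' : @C v (a *: u') w' = a *: C u' w'.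
  by have := tensor_linl hC w' a u' 0; rewrite !addr0 C0l addr0.
have CZr a u' w' : @C v u' (a *: w') = a *: C u' w'.
  by have := tensor_linr hC u' a w' 0; rewrite !addr0 C0r addr0.
have E (z : tvec (base v)) : z = \sum_j z c 0 j *: coord_field c j (base v).
  apply: (tvec_eq cv); rewrite tcomp_sum [LHS]row_sum_delta; apply: eq_bigr => j _.
  by rewrite tcompZ vector_ofE.
rewrite {1}(E u) (big_morph (fun u => C u w) (id1 := 0) (op1 := +%R)) //.
rewrite tcomp_sum; apply: eq_bigr => j _.
rewrite CZl {1}(E w) (big_morph (C _) (id1 := 0) (op1 := +%R)) //.
rewrite tcompZ tcomp_sum scaler_sumr; apply: eq_bigr => k _.
by rewrite CZr tcompZ scalerA.
Qed.

Lemma smooth_mulmx_hat_coef c v (a : AA -> 'rV[R]_n) : chart_dom c (base v) ->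
  smooth_pt a v -> smooth_pt (fun u => a u *m hat_coef hat c u) v.
Proof.
move=> cv sa; apply: smooth_pt_row => // k.
apply: (@smooth_pt_near_eq _ _ _ atA _ (fun u : AA =>
    \sum_l (a u 0 l * \sum_j (fib u c 0 j * christoffel hat c u k l j)) : R^o)).
  by apply: near_all => u; rewrite mxE; apply: eq_bigr => l _; rewrite mxE.
apply: smooth_pt_sum => // l; apply: smooth_ptM => //; first exact: smooth_pt_coord.
apply: smooth_pt_sum => // j; apply: smooth_ptM => //; last exact: (smooth_christoffel Mm A_open hh).
by apply: smooth_pt_coord => //; exact: smooth_fib.
Qed.

Lemma smooth_lsubmx v (a : AA -> 'rV[R]_(n + n)) :
  smooth_pt a v -> smooth_pt (fun u => lsubmx (a u)) v.
Proof.
apply: (smooth_pt_comp atA (F := lsubmx)) => k.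
by apply: (@Ck_lsubmx R (n + n) n n); exact: Ck_id.
Qed.

Lemma smooth_rsubmx v (a : AA -> 'rV[R]_(n + n)) :
  smooth_pt a v -> smooth_pt (fun u => rsubmx (a u)) v.
Proof.
apply: (smooth_pt_comp atA (F := rsubmx)) => k.
by apply: (@Ck_rsubmx R (n + n) n n); exact: Ck_id.
Qed.

Lemma built_connection_smooth (xi : vfieldA A) (Z : section A) :
  smooth_field xi -> smooth_section Z -> smooth_section (built_connection hat C xi Z).
Proof.
move=> sxi sZ; apply/(smooth_sectionP Mm A_open) => v; have [c cv] := atlas_cover atM (base v).
exists c => //.
have sx := smooth_fieldA_pt Mm A_open sxi cv.
have sz := smooth_section_pt Mm A_open sZ cv.
have nd := near_point_dom atM A_open cv.
pose om u := rsubmx (xi u c) + lsubmx (xi u c) *m hat_coef hat c u.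
have sl := smooth_lsubmx sx.
have som : smooth_pt om v.
  by apply: smooth_ptD => //; [exact: smooth_rsubmx|exact: smooth_mulmx_hat_coef].
apply: (@smooth_pt_near_eq _ _ _ atA _ (fun u : AA => chart_diffA c (fun u => Z u c) u (xi u c)
   + \sum_j \sum_k ((om u 0 j * Z u c 0 k) : R^o) *:
       C (coord_field c j (base u)) (coord_field c k (base u)) c
   + \sum_j \sum_k ((lsubmx (xi u c) 0 j * Z u c 0 k) : R^o) *: \row_i christoffel hat c u i j k)).
  move: nd; apply: filterS => u cu; rewrite (built_connectionE _ sZ cu) (tensorE _ _ cu).
  by rewrite vertical_formE.
have szc k : smooth_pt (fun u : AA => Z u c 0 k : R^o) v by exact: smooth_pt_coord.
apply: smooth_ptD => //; first apply: smooth_ptD => //.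
- apply: (smooth_chart_diff atA (cv : chart_dom (c : chart AA) v) sz sx).
  by move: nd; apply: filterS => u cu; exact: (smooth_section_pt Mm A_open).
- apply: smooth_pt_sum => // j; apply: smooth_pt_sum => // k; apply: smooth_ptZ => //.
    by apply: smooth_ptM => //; exact: smooth_pt_coord.
  have := @tensor_smooth _ _ _ _ _ hC c j k => /(smooth_inP atA c _ openT).
  by move=> /(_ v I cv).
- apply: smooth_pt_sum => // j; apply: smooth_pt_sum => // k; apply: smooth_ptZ => //.
    by apply: smooth_ptM => //; exact: smooth_pt_coord.
  apply: smooth_pt_row => // i.
  apply: (@smooth_pt_near_eq _ _ _ atA _ (fun u : AA => christoffel hat c u i j k : R^o)).
    by apply: near_all => u; rewrite mxE.
  exact: (smooth_christoffel Mm A_open hh).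
Qed.

Lemma built_connection_linear : is_linear_connection (built_connection hat C).
Proof.
have CDl v (u1 u2 w' : tvec (base v)) : C (u1 + u2) w' = C u1 w' + C u2 w'.
  by have := tensor_linl hC w' 1 u1 u2; rewrite !scale1r.
have C0l v (w' : tvec (base v)) : C 0 w' = 0 by apply: (addrI (C 0 w')); rewrite -CDl !addr0.
have CZl v a (u' w' : tvec (base v)) : C (a *: u') w' = a *: C u' w'.
  by have := tensor_linl hC w' a u' 0; rewrite !addr0 C0l addr0.
have C0r v (u' : tvec (base v)) : C u' 0 = 0.
  by have := tensor_linr hC u' (-1) 0 0; rewrite scaler0 addr0 scaleN1r addNr.
have CZr v a (u' w' : tvec (base v)) : C u' (a *: w') = a *: C u' w'.
  by have := tensor_linr hC u' a w' 0; rewrite !addr0 C0r addr0.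
have vD v (xi eta : tvec v) : vertical_form (xi + eta) = vertical_form xi + vertical_form eta.
  by have := vertical_form_lin 1 xi eta; rewrite !scale1r.
have v0 v : vertical_form (0 : tvec v) = 0 by apply: (addrI (vertical_form (0 : tvec v))); rewrite -vD !addr0.
have vZ v a (xi : tvec v) : vertical_form (a *: xi) = a *: vertical_form xi.
  by have := vertical_form_lin a xi 0; rewrite !addr0 v0 addr0.
have gD c v a a' b : hat_gamma hat c v (a + a') b = hat_gamma hat c v a b + hat_gamma hat c v a' b.
  by have := hat_gamma_linl hat c v b 1 a a'; rewrite !scale1r.
have gZ c v k a b : hat_gamma hat c v (k *: a) b = k *: hat_gamma hat c v a b.
  by have := hat_gamma_linl hat c v b k a 0; rewrite !addr0 hat_gamma0l addr0.
have g0r c v a : hat_gamma hat c v a 0 = 0.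
  have := hat_gamma_linr hat c v a (-1) 0 0; rewrite scaler0 addr0 scaleN1r.
  by rewrite addNr.
have gZr c v k a b : hat_gamma hat c v a (k *: b) = k *: hat_gamma hat c v a b.
  by have := hat_gamma_linr hat c v a k b 0; rewrite !addr0 g0r addr0.
have szc := smooth_section_pt Mm A_open.
have rearr (a1 a2 b1 b2 c1 c2 : 'rV[R]_n) :
    a1 + a2 + (b1 + b2) + (c1 + c2) = a1 + b1 + c1 + (a2 + b2 + c2).
  by rewrite (addrACA a1 a2) [RHS]addrACA.
(* [built_connection] is abstracted, because unification would unfold its sum. *)
have [B BE] : exists B, B = built_connection hat C by exists (built_connection hat C).
have bE xi Z v c : smooth_section Z -> chart_dom c (base v) ->
    B xi Z v c = chart_diffA c (fun u => Z u c) v (xi v c)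
      + C (vertical_form (xi v)) (Z v) c + hat_gamma hat c v (lsubmx (xi v c)) (Z v c).
  by rewrite BE; exact: built_connectionE.
have bS := built_connection_smooth; rewrite -BE in bS *.
split=> [xi Z|xi eta Z sxi se sZ v|f xi Z sf sxi sZ v|k xi Z W sxi sZ sW v|f xi Z sf sxi sZ v].
- exact: bS.
- have [c cv] := atlas_cover atM (base v); apply: (tvec_eq cv).
  rewrite tcompD !bE //.
  rewrite (_ : (xi v + eta v) c = xi v c + eta v c) // vD CDl tcompD.
  rewrite [lsubmx _]linearD /= gD {1}/chart_diffA chart_diffD -/(chart_diffA _ _ _ _) -/(chart_diffA _ _ _ _).
  by rewrite [in RHS]addrACA; congr (_ + _); rewrite addrACA.
- have [c cv] := atlas_cover atM (base v); apply: (tvec_eq cv).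
  rewrite tcompZ !bE //.
  rewrite (_ : (f v *: xi v) c = f v *: xi v c) // vZ CZl tcompZ.
  rewrite [lsubmx _]linearZ /= gZ !scalerDr; congr (_ + _ + _).
  by rewrite /chart_diffA -[in LHS](addr0 (f v *: xi v c)) chart_diff_lin chart_diff0 addr0.
- have [c cv] := atlas_cover atM (base v); apply: (tvec_eq cv).
  have sc := smooth_fun_cst k atA.
  have sW' : smooth_section (fun a => k *: Z a + W a).
    apply/(smooth_sectionP Mm A_open) => u; have [d du] := atlas_cover atM (base u).
    exists d => //; apply: smooth_ptD => //; last exact: szc.
    by apply: (@smooth_ptZ _ _ _ atA _ (fun _ => k)); [exact: smooth_pt_cst|exact: szc].
  rewrite tcompD tcompZ !bE //.
  rewrite (tensor_linr hC) hat_gamma_linr tcompD tcompZ !scalerDr.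
  have -> : chart_diffA c (fun u => (k *: Z u + W u) c) v (xi v c)
      = k *: chart_diffA c (fun u => Z u c) v (xi v c) + chart_diffA c (fun u => W u c) v (xi v c).
    have s1 : smooth_pt (fun u : AA => k : R^o) v by exact: smooth_pt_cst.
    have s2 : smooth_pt (fun u : AA => k *: Z u c) v by apply: smooth_ptZ => //; exact: szc.
    rewrite /chart_diffA -[LHS]/(chart_diff (N := AA) c (fun u => k *: Z u c + W u c) v (xi v c)).
    rewrite (chart_diff_fD atA) //; last exact: szc.
    rewrite (chart_diff_fZ atA (f := fun=> k : R^o)) //; last exact: szc.
    by rewrite (chart_diff_cst atA) // scale0r add0r.
  exact: rearr.
- have [c cv] := atlas_cover atM (base v); apply: (tvec_eq cv).
  have sfv := (smooth_funP atA f).1 sf.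
  have sW' : smooth_section (fun a => f a *: Z a).
    apply/(smooth_sectionP Mm A_open) => u; have [d du] := atlas_cover atM (base u).
    by exists d => //; apply: (@smooth_ptZ _ _ _ atA _ f) => //; exact: szc.
  rewrite tcompD !tcompZ !bE // CZr tcompZ gZr !scalerDr !addrA.
  congr (_ + _ + _).
  rewrite /chart_diffA -[LHS]/(chart_diff (N := AA) c (fun u => (f u : R^o) *: Z u c) v (xi v c)).
  rewrite (chart_diff_fZ atA) //; last exact: szc.
  by rewrite (dfunA_E Mm A_open (xi v) (sfv v) cv).
Qed.

(** The vertical form of a horizontal lift is 0, which removes the term in [C], and a pulled-back
    field is differentiated only in base directions; what remains is [hatE]. *)
Lemma built_assoc_connection v X Y : smooth_field X -> smooth_field Y ->
  assoc_connection (built_connection hat C) Hc v X Y = hat v X Y.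
Proof.
move=> sX sY; have [c cv] := atlas_cover atM (base v); apply: (tvec_eq cv).
rewrite /assoc_connection built_connectionE //; last exact: smooth_pull_field.
have hE : hlift_field Hc X v c = row_mx (X (base v) c) (- (X (base v) c *m hat_coef hat c v)).
  by rewrite /hlift_field (hliftE Mm A_open hHc _ cv) nonlin_coef_hat.
have -> : vertical_form (hlift_field Hc X v) = 0.
  by apply: (tvec_eq cv); rewrite vertical_formE // hE row_mxKl row_mxKr addNr.
rewrite (tensorE _ _ cv) big1 ?addr0; last first.
  by move=> j _; rewrite big1 // => k _; rewrite mxE mul0r scale0r.
rewrite hE row_mxKl (hatE Mm hh cv sX sY); congr (_ + _).
rewrite (chart_diffA_pull Mm A_open (f := fun y => Y y c)) ?row_mxKl //.
exact: (smooth_field_pt Mm).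
Qed.

(** A vertical lift has zero base components, so both the derivative of the pulled-back field and
    the Christoffel term vanish. *)
Lemma built_assoc_tensor v X Y : smooth_field X -> smooth_field Y ->
  assoc_tensor (built_connection hat C) v X Y = C (pull X v) (pull Y v).
Proof.
move=> sX sY; have [c cv] := atlas_cover atM (base v); apply: (tvec_eq cv).
rewrite /assoc_tensor built_connectionE //; last exact: smooth_pull_field.
have hE : vlift_field X v c = row_mx 0 (X (base v) c) by rewrite /vlift_field (vliftE atM).
have -> : vertical_form (vlift_field X v) = pull X v.
  by apply: (tvec_eq cv); rewrite vertical_formE // hE row_mxKl row_mxKr mul0mx addr0.
rewrite hE row_mxKl hat_gamma0l addr0.
rewrite (chart_diffA_pull Mm A_open (f := fun y => Y y c)) ?row_mxKl ?chart_diff0 ?add0r //.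
exact: (smooth_field_pt Mm).
Qed.

(** The spray is the horizontal lift of the tautological section: contracting N^k_l = v^j
    Gamma^k_{lj} once more with v gives its quadratic term. *)
Lemma hat_spray_exists : exists S : vfieldA A,
  [/\ smooth_field S, is_spray_of hat S & forall v, S v = hlift Hc (fib v)].
Proof.
exists (fun v => hlift Hc (fib v)); split => //.
  exact: (smooth_hlift Mm A_open hHc (smooth_fib_section Mm A_open)).
move=> c v cv; rewrite (hliftE Mm A_open hHc _ cv) nonlin_coef_hat //; congr (row_mx _ (- _)).
apply/rowP => k; rewrite !mxE; apply: eq_bigr => i _.
by rewrite mxE mulr_sumr; apply: eq_bigr => j _; rewrite mulrA.
Qed.

End Built.

Theorem proposition4p4 (R : realType) (n : nat) (M : charted R n)
    (M_manifold : is_manifold M) (A : set (TM M)) (A_open : open A)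
    (A_nonzero : forall v : TM M, A v -> tfib v != 0)
    (A_onto : @tpi R n M @` A = setT) :
  (* (1) *)
  ((forall (nabla : vfieldA A -> section A -> section A)
      (Hc : forall v : subcharted A, set (tvec v)),
      is_linear_connection nabla -> is_horizontal Hc -> coef_homogeneous Hc ->
      is_aniso_connection (assoc_connection nabla Hc) /\
      exists2 C : forall v : subcharted A,
          tvec (base v) -> tvec (base v) -> tvec (base v),
        is_tensor12 C &
        forall v X Y, smooth_field X -> smooth_field Y ->
          C v (pull X v) (pull Y v) = assoc_tensor nabla v X Y)
   /\
   (forall (nabla1 nabla2 : vfieldA A -> section A -> section A)
      (Hc1 Hc2 : forall v : subcharted A, set (tvec v)),
      is_linear_connection nabla1 -> is_horizontal Hc1 ->
      coef_homogeneous Hc1 ->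
      coef_relation (assoc_connection nabla1 Hc1) Hc1 ->
      is_linear_connection nabla2 -> is_horizontal Hc2 ->
      coef_homogeneous Hc2 ->
      coef_relation (assoc_connection nabla2 Hc2) Hc2 ->
      (forall v X Y, smooth_field X -> smooth_field Y ->
        assoc_connection nabla1 Hc1 v X Y
          = assoc_connection nabla2 Hc2 v X Y) ->
      (forall v X Y, smooth_field X -> smooth_field Y ->
        assoc_tensor nabla1 v X Y = assoc_tensor nabla2 v X Y) ->
      (forall v, Hc1 v = Hc2 v) /\
      (forall xi Z, smooth_field xi -> smooth_section Z ->
        forall v, nabla1 xi Z v = nabla2 xi Z v)))
  /\
  (* (2) *)
  (forall (hat : aniso_op A)
     (C : forall v : subcharted A,
        tvec (base v) -> tvec (base v) -> tvec (base v)),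
     is_aniso_connection hat -> is_tensor12 C ->
     let Hc := hat_horizontal hat in
     let nabla := built_connection hat C in
     [/\ is_horizontal Hc, coef_relation hat Hc & is_linear_connection nabla] /\
     (forall v X Y, smooth_field X -> smooth_field Y ->
        assoc_connection nabla Hc v X Y = hat v X Y) /\
     (forall v X Y, smooth_field X -> smooth_field Y ->
        assoc_tensor nabla v X Y = C v (pull X v) (pull Y v)) /\
     exists S : vfieldA A,
       [/\ smooth_field S, is_spray_of hat S
         & forall v, S v = hlift Hc (fib v)]).
Proof.
split; last first.
  move=> hat C hh hC /=; split; [split|split; [|split]].
  - exact: hat_horizontal_is_horizontal.
  - by move=> c v cv; exact: nonlin_coef_hat.
  - exact: built_connection_linear.
  - exact: built_assoc_connection.
  - exact: built_assoc_tensor.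
  - exact: hat_spray_exists.
split=> [nabla Hc hn hHc _|nabla1 nabla2 Hc1 Hc2 h1 hH1 _ r1 h2 hH2 _ r2 conn tens].
  by split; [exact: assoc_connection_aniso|exact: assoc_tensor_exists].
have atM := manifold_atlas M_manifold.
have H12 v : Hc1 v = Hc2 v.
  have [c cv] := atlas_cover atM (base v).
  (* The coefficient relations express both spans through the Christoffel symbols of the associated
     connections, which coincide by [conn]. *)
  rewrite (horiz_span hH1 cv) (horiz_span hH2 cv) r1 // r2 //; congr spanned_by.
  apply/matrixP => l k; rewrite !mxE; apply: eq_bigr => j _.
  by rewrite /christoffel (hat_loc_eq _ _ conn).
split=> //; have E : Hc1 = Hc2 by exact: functional_extensionality_dep.
subst Hc2; exact: (connection_unique M_manifold A_open h1 h2 hH1).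
Qed.
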